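(* Let $(Y,\eta)$ be a compact Kähler manifold and $f:\mathbb{CP}^1\to Y$ a non-constant holomorphic map. Then $$\Big(\sup_YH^\eta\Big)\cdot\int_{\mathbb{CP}^1}f^*\eta\ \ge\ 2\pi\cdot\chi(\mathbb{CP}^1)=4\pi,$$ where $\chi$ denotes the Euler characteristic.
   Context: The Kähler metric is identified with its form, locally $\eta=\sqrt{-1}\eta_{\alpha\bar\beta}dw^\alpha\wedge d\bar w^\beta$, with curvature tensor $$R^\eta_{\alpha\bar\beta\gamma\bar\delta}=-\frac{\partial^2\eta_{\gamma\bar\delta}}{\partial w^\alpha\partial\bar w^\beta}+\eta^{\bar\nu\mu}\frac{\partial\eta_{\gamma\bar\nu}}{\partial w^\alpha}\frac{\partial\eta_{\mu\bar\delta}}{\partial\bar w^\beta}.$$ For $y\in Y$ and $W\in T^{1,0}_yY\setminus\{0\}$, the holomorphic sectional curvature is $H^\eta_y(W)=R^\eta(W,\overline W,W,\overline W)/|W|_\eta^4$. $H^\eta$ is the function on $Y$ given by $H^\eta(y)=\sup_{W}H^\eta_y(W)$, and $\sup_YH^\eta$ is its supremum over $Y$. *)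

(* Defs.v *)
From HB Require Import structures.
From mathcomp Require Import all_boot all_order all_algebra.
From mathcomp Require Import generic_quotient complex.
From mathcomp Require Import all_classical all_reals all_analysis.

Set Implicit Arguments.
Unset Strict Implicit.
Unset Printing Implicit Defensive.

Import Order.TTheory GRing.Theory Num.Theory.
Import numFieldNormedType.Exports.

Local Open Scope classical_set_scope.
Local Open Scope sesquilinear_scope.
Local Open Scope ring_scope.
Local Open Scope quotient_scope.

(* The complex numbers, packaged as a numClosedFieldType: with this type (and
   not with the bare R[i]) the field topology, the normed-module structure of
   'rV[C R]_n and complex differentiability are inferred. *)
Definition C (R : realType) : numClosedFieldType := R[i].

(** Complex manifolds *)

Record chart (R : realType) (n : nat) (X : topologicalType) := Chart {
  chart_dom : set X ;
  chart_fun :> X -> 'rV[C R]_n ;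
  chart_inv : 'rV[C R]_n -> X }.

Definition chart_img (R : realType) n (X : topologicalType) (phi : chart R n X) :
  set 'rV[C R]_n := phi @` chart_dom phi.

Record chartedSpace (R : realType) (n : nat) := ChartedSpace {
  carrier :> topologicalType ;
  atlas : set (chart R n carrier) ;
  chart_at : carrier -> chart R n carrier }.

(* Complex differentiability of psi o f o phi^-1 wherever it is defined. *)
Definition holomorphic_in (R : realType) m n (X Y : topologicalType)
    (phi : chart R m X) (psi : chart R n Y) (f : X -> Y) : Prop :=
  forall z, (phi @` (chart_dom phi `&` f @^-1` chart_dom psi)) z ->
    differentiable (psi \o f \o chart_inv phi : 'rV[C R]_m -> 'rV[C R]_n) z.

Record complex_manifold (R : realType) n (X : chartedSpace R n) : Prop := {
  manifold_hausdorff : hausdorff_space X ;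
  manifold_second_countable : @second_countable X ;
  chart_at_atlas : forall x : X, atlas (chart_at x) ;
  chart_at_dom : forall x : X, chart_dom (chart_at x) x ;
  chart_dom_open : forall phi, @atlas _ _ X phi -> open (chart_dom phi) ;
  chart_img_open : forall phi, @atlas _ _ X phi -> open (chart_img phi) ;
  chart_invK : forall phi, @atlas _ _ X phi ->
    forall x, chart_dom phi x -> chart_inv phi (phi x) = x ;
  chart_continuous : forall phi, @atlas _ _ X phi ->
    {within chart_dom phi, continuous phi} ;
  chart_inv_continuous : forall phi, @atlas _ _ X phi ->
    {within chart_img phi, continuous (chart_inv phi)} ;
  chart_compatible : forall phi psi, @atlas _ _ X phi -> @atlas _ _ X psi ->
    holomorphic_in phi psi id }.

Definition holomorphic_map (R : realType) m n
    (X : chartedSpace R m) (Y : chartedSpace R n) (f : X -> Y) : Prop :=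
  continuous f /\
  forall phi psi, atlas phi -> atlas psi -> holomorphic_in phi psi f.

(** Calculus of smooth complex-valued functions on open subsets of C^n *)

Section Wirtinger.
Variables (R : realType) (n : nat).
Implicit Types (F : 'rV[C R]_n -> C R) (U : set 'rV[C R]_n) (z v : 'rV[C R]_n).

(* F restricted to the real line through z with direction v. *)
Definition real_line F z v (t : R) : R[i] := F (z + (t%:C)%C *: v).

Definition real_derivable F z v : Prop :=
  derivable (fun t => complex.Re (real_line F z v t)) 0 1 /\
  derivable (fun t => complex.Im (real_line F z v t)) 0 1.

Definition real_derive v F z : C R :=
  Complex (derive1 (fun t => complex.Re (real_line F z v t)) 0)
          (derive1 (fun t => complex.Im (real_line F z v t)) 0).

Fixpoint Ck_on (k : nat) U F : Prop :=
  match k with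
  | 0 => forall z, U z -> {for z, continuous F}
  | k'.+1 => forall v,
      (forall z, U z -> real_derivable F z v) /\ Ck_on k' U (real_derive v F)
  end.

Definition smooth_on U F : Prop := forall k, Ck_on k U F.

Definition basis_vec (a : 'I_n) : 'rV[C R]_n := delta_mx 0 a.

(* d/dw^a = (d/dx^a - i d/dy^a) / 2 where w^a = x^a + i y^a *)
Definition dw (a : 'I_n) F z : C R :=
  (real_derive (basis_vec a) F z
    - 'i * real_derive ('i *: basis_vec a) F z) / 2.

Definition dwbar (a : 'I_n) F z : C R :=
  (real_derive (basis_vec a) F z
    + 'i * real_derive ('i *: basis_vec a) F z) / 2.

End Wirtinger.

(** (1,1)-forms *)

(* In a chart phi, [eta phi z a b] is the coefficient of the form
   sqrt(-1) * sum_(a, b) eta_{a bbar} dw^a /\ dwbar^b at z = phi(y). *)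
Definition form11 (R : realType) n (X : chartedSpace R n) :=
  chart R n X -> 'rV[C R]_n -> 'M[C R]_n.

(* Row-vector convention: jacobian F z a m = dF^m / dw^a. *)
Definition chart_jacobian (R : realType) m n (X Y : topologicalType)
    (phi : chart R m X) (psi : chart R n Y) (f : X -> Y) (z : 'rV[C R]_m) :
  'M[C R]_(m, n) :=
  jacobian (psi \o f \o chart_inv phi : 'rV[C R]_m -> 'rV[C R]_n) z.

Definition pullback_in (R : realType) m n
    (X : chartedSpace R m) (Y : chartedSpace R n) (f : X -> Y) (eta : form11 Y)
    (phi : chart R m X) (psi : chart R n Y) (z : 'rV[C R]_m) : 'M[C R]_m :=
  let J := chart_jacobian phi psi f z in
  J *m eta psi (psi (f (chart_inv phi z))) *m J ^t*.

Definition pullback (R : realType) m n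
    (X : chartedSpace R m) (Y : chartedSpace R n) (f : X -> Y) (eta : form11 Y) :
  form11 X :=
  fun phi z => pullback_in f eta phi (chart_at (f (chart_inv phi z))) z.

Definition sqnorm (R : realType) n (g : 'M[C R]_n) (W : 'rV[C R]_n) : C R :=
  \sum_a \sum_b g a b * W 0 a * (W 0 b)^*.

(* [kahler_closed] is the vanishing of the coefficients of
   dw^c /\ dw^a /\ dwbar^b and dwbar^c /\ dw^a /\ dwbar^b in d(eta). *)
Record kahler_metric (R : realType) n (X : chartedSpace R n) (eta : form11 X) :
  Prop := {
  kahler_smooth : forall phi, atlas phi -> forall a b,
    smooth_on (chart_img phi) (fun z => eta phi z a b) ;
  kahler_hermitian : forall phi, atlas phi -> forall z, chart_img phi z ->
    (eta phi z) ^t* = eta phi z ;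
  kahler_posdef : forall phi, atlas phi -> forall z, chart_img phi z ->
    forall W, W != 0 -> 0 < sqnorm (eta phi z) W ;
  kahler_glue : forall phi psi, atlas phi -> atlas psi ->
    forall x, chart_dom phi x -> chart_dom psi x ->
    eta phi (phi x) = pullback_in id eta phi psi (phi x) ;
  kahler_closed : forall phi, atlas phi -> forall z, chart_img phi z ->
    forall a b c,
      dw c (fun w => eta phi w a b) z = dw a (fun w => eta phi w c b) z /\
      dwbar c (fun w => eta phi w a b) z = dwbar b (fun w => eta phi w a c) z }.

(** Curvature *)

Section Curvature.
Variables (R : realType) (n : nat).
Implicit Types (g : 'rV[C R]_n -> 'M[C R]_n) (z W : 'rV[C R]_n).

(* R_{a bbar c dbar}; the inverse metric eta^{nubar mu} is the (nu, mu) entry of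
   invmx g. *)
Definition curvature g z (a b c d : 'I_n) : C R :=
  - dw a (dwbar b (fun w => g w c d)) z
  + \sum_nu \sum_mu
      invmx (g z) nu mu * dw a (fun w => g w c nu) z
                        * dwbar b (fun w => g w mu d) z.

(* The quotient is a real number when g is a Hermitian metric; Re only serves
   to land in R. *)
Definition hol_sect_curv g z W : R :=
  complex.Re ((\sum_a \sum_b \sum_c \sum_d
         curvature g z a b c d * W 0 a * (W 0 b)^* * W 0 c * (W 0 d)^*)
      / sqnorm (g z) W ^+ 2 : R[i]).

End Curvature.

(* Vectors of T^{1,0}_y are given by their components in the chart chart_at y. *)
Definition hsc_at (R : realType) n (X : chartedSpace R n) (eta : form11 X)
    (y : X) : \bar R :=
  ereal_sup [set (hol_sect_curv (eta (chart_at y)) (chart_at y y) W)%:E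
            | W in [set W : 'rV[C R]_n | W != 0]].

Definition sup_hsc (R : realType) n (X : chartedSpace R n) (eta : form11 X) :
  \bar R := ereal_sup (range (hsc_at eta)).

(** The complex projective line *)

Section ProjectiveLine.
Variable R : realType.

Definition punctured_plane : topologicalType :=
  set_type [set v : 'rV[C R]_2 | v != 0].

Definition collinear (v w : punctured_plane) : bool :=
  `[< exists2 a : C R, a != 0 & \val w = a *: \val v >].

Lemma collinear_refl : reflexive collinear.
Proof.
by move=> v; apply/asboolP; exists 1; [exact: oner_neq0 | rewrite scale1r].
Qed.

Lemma collinear_sym : symmetric collinear.
Proof.
suff H v w : collinear v w -> collinear w v by move=> v w; apply/idP/idP; exact: H.
move=> /asboolP[a a0 av]; apply/asboolP; exists a^-1; first by rewrite invr_eq0.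
by rewrite av scalerA mulVf// scale1r.
Qed.

Lemma collinear_trans : transitive collinear.
Proof.
move=> v u w /asboolP[a a0 av] /asboolP[b b0 bw]; apply/asboolP.
by exists (b * a); [rewrite mulf_neq0 | rewrite bw av scalerA].
Qed.

Canonical collinear_equiv :=
  EquivRel collinear collinear_refl collinear_sym collinear_trans.

Definition CP1_space : topologicalType :=
  quotient_topology {eq_quot collinear_equiv}.

Definition line_of (v : punctured_plane) : CP1_space :=
  \pi_({eq_quot collinear_equiv})%qT v.

(* The vector with i-th entry 1 and other entry z. *)
Definition affine_vec (i : 'I_2) (z : C R) : 'rV[C R]_2 :=
  \row_k (if k == i then 1 else z).

Lemma affine_vec_neq0 i z : affine_vec i z \in [set v : 'rV[C R]_2 | v != 0].
Proof.
rewrite inE /=; apply/eqP => /rowP/(_ i).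
by rewrite !mxE eqxx => /eqP; rewrite oner_eq0.
Qed.

Definition homog (p : CP1_space) : 'rV[C R]_2 :=
  \val (repr (p : {eq_quot collinear_equiv})).

(* [Z_0 : Z_1] |-> Z_j / Z_i on { Z_i <> 0 }, with j the index other than i. *)
Definition CP1_chart (i : 'I_2) : chart R 1 CP1_space := {|
  chart_dom := [set p | homog p 0 i != 0] ;
  chart_fun := fun p => const_mx (homog p 0 (rev_ord i) / homog p 0 i) ;
  chart_inv := fun z => line_of (exist _ (affine_vec i (z 0 0))
                                         (affine_vec_neq0 i (z 0 0))) |}.

Definition CP1 : chartedSpace R 1 := {|
  carrier := CP1_space ;
  atlas := range CP1_chart ;
  chart_at := fun p => if homog p 0 0 != 0 then CP1_chart 0 else CP1_chart 1 |}.

(* The affine chart omits only the point [0 : 1], and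
   sqrt(-1) dz /\ dzbar = 2 dx /\ dy. *)
Definition CP1_integral (omega : form11 CP1) : \bar R :=
  (\int[(@lebesgue_measure R) \x (@lebesgue_measure R)]_p
    (2 * complex.Re (omega (CP1_chart 0) (const_mx (Complex p.1 p.2 : C R)) 0 0
                     : R[i]))%:E)%E.

End ProjectiveLine.

(** Euler characteristic *)

Section EulerCharacteristic.
Variable R : realType.

Definition open_disc n : set 'rV[R]_n := [set v | \sum_i v 0 i ^+ 2 < 1].
Definition closed_disc n : set 'rV[R]_n := [set v | \sum_i v 0 i ^+ 2 <= 1].
Definition unit_sphere n : set 'rV[R]_n := [set v | \sum_i v 0 i ^+ 2 = 1].

(* A finite CW structure on a Hausdorff space, given by characteristic maps Phi i
   from closed discs of dimension d i: the open cells partition X, and each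
   boundary sphere is mapped into cells of lower dimension. *)
Record finite_CW (X : topologicalType) (I : finType) (d : I -> nat)
    (Phi : forall i, 'rV[R]_(d i) -> X) : Prop := {
  CW_hausdorff : hausdorff_space X ;
  CW_continuous : forall i, {within @closed_disc (d i), continuous (Phi i)} ;
  CW_partition : forall x, exists! p : {i : I & 'rV[R]_(d i)},
    open_disc (tagged p) /\ Phi (tag p) (tagged p) = x ;
  CW_boundary : forall i v, @unit_sphere (d i) v ->
    exists j w, [/\ (d j < d i)%N, @open_disc (d j) w & Phi j w = Phi i v] }.

(* chi is the alternating sum of the numbers of cells of a finite CW structure
   on X (it does not depend on the structure). *)
Definition euler_characteristic (X : topologicalType) (chi : int) : Prop :=
  exists (I : finType) (d : I -> nat) (Phi : forall i, 'rV[R]_(d i) -> X),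
    finite_CW Phi /\ chi = \sum_(i : I) (-1) ^+ d i.

End EulerCharacteristic.

(* Main.v *)
Require Import Defs.
From HB Require Import structures.
From mathcomp Require Import all_boot all_order all_algebra.
From mathcomp Require Import generic_quotient complex.
From mathcomp Require Import all_classical all_reals all_analysis.
From mathcomp Require Import measurable_realfun ring lra.

(** Let [u] be the density of [f^* eta] in the affine coordinate [z] of the
    projective line, so that the integral of [f^* eta] is twice that of [u] over
    the plane. If [F] is the expression of [f] in a chart of [Y], then [u] is the
    squared length of [F'], and its mixed derivative is minus the curvature in the
    direction [F'] plus the squared length of the covariant derivative of [F']
    ([mixed_XE]). With the Cauchy-Schwarz inequality this gives
    [lap (ln u) >= - 4 S u] where [u > 0], [S] being an upper bound of the
    holomorphic sectional curvature; multiplied out, the inequality holds at the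
    zeros of [u] too ([curv_log], [curv_lap], [density_ineq]).

    Put [q = 1 + |z|^2] and [omega = 2 / q^2], whose integral is [2 pi]
    ([omega_integral]). Since [f] is defined at infinity, [v = u q^2] is bounded
    ([pdens_bound]), and as [lap (ln (q^2)) = 4 omega] the function [ln v] satisfies
    [lap (ln v) >= 4 (omega - S u)]. If [ln v] were smooth on the sphere, its
    Laplacian would have integral zero, and [2 pi <= S * integral of u] would
    follow. This remains true for the actual [v] ([area_inequality]): one replaces
    [ln v] by [ln (v + e)], which satisfies the same inequality with right-hand side
    multiplied by [v / (v + e)], tests it against a logarithmic cut-off whose
    Laplacian has a negligible negative part, and lets [e] tend to zero. The limit
    needs [u > 0] almost everywhere ([U_ae_gt0]), which follows from the same
    inequality tested against bump functions: on the zeros of [u] the function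
    [ln (v + e)] tends to minus infinity, while the integrals stay bounded from below.

    The computation above differentiates [F] three times, whereas a holomorphic map
    is only assumed to be differentiable. The derivative of a holomorphic function
    is holomorphic by Cauchy's formula ([cauchy_formula], [derivative_diff]), itself
    deduced from Goursat's lemma ([goursat]) applied to a homotopy of circles.

    Finally the Euler characteristic comes from the cell structure of the projective
    line with one point and one disc ([CP1_euler]), and non-constancy provides a
    point where [u > 0] ([pdens_nonzero]), which settles the cases where the
    supremum of the curvature is infinite. *)

Set Implicit Arguments.
Unset Strict Implicit.
Unset Printing Implicit Defensive.

Import Order.TTheory GRing.Theory Num.Theory.
Import numFieldNormedType.Exports.

Local Open Scope classical_set_scope.
Local Open Scope ring_scope.

(** * Complex numbers through real and imaginary parts *)

Notation re := complex.Re.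
Notation im := complex.Im.

Section Modulus.
Variable R : realType.
Implicit Types z w : C R.

(** The modulus as a real number; the library norm of [C R] has values in [C R]. *)
Definition cmod z : R := re `|z|.

Definition cr (x : R) : C R := Complex x 0.

Lemma normE z : `|z| = cr (cmod z).
Proof. by rewrite /cmod; case: z. Qed.

Lemma cmodE z : cmod z = Num.sqrt (re z ^+ 2 + im z ^+ 2).
Proof. by case: z. Qed.

Lemma cmod_sqr z : cmod z ^+ 2 = re z ^+ 2 + im z ^+ 2.
Proof. by rewrite cmodE sqr_sqrtr// addr_ge0// sqr_ge0. Qed.

Lemma cmod_ge0 z : 0 <= cmod z. Proof. by rewrite cmodE sqrtr_ge0. Qed.
Hint Resolve cmod_ge0 : core.

Lemma cmod1_gt0 z : 0 < cmod z + 1.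
Proof. by have := cmod_ge0 z; lra. Qed.

Lemma cmodM z w : cmod (z * w) = cmod z * cmod w.
Proof. by rewrite /cmod normrM !normE /= mulr0 subr0. Qed.

Lemma cmodD z w : cmod (z + w) <= cmod z + cmod w.
Proof.
have := ler_normD z w; rewrite !normE => h.
have : (cr (cmod (z + w)) : R[i]) <= cr (cmod z + cmod w).
  by move: h; congr (_ <= _); rewrite /cr; congr Complex; rewrite addr0.
by rewrite lecE /= => /andP[].
Qed.

Lemma cmodN z : cmod (- z) = cmod z. Proof. by rewrite /cmod normrN. Qed.

Lemma cmodB z w : cmod (z - w) = cmod (w - z).
Proof. by rewrite -cmodN opprB. Qed.

Lemma cmod0 : cmod 0 = 0. Proof. by rewrite /cmod normr0. Qed.

Lemma cmod1 : cmod 1 = 1. Proof. by rewrite /cmod normr1. Qed.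

Lemma cmod_eq0 z : (cmod z == 0) = (z == 0).
Proof.
apply/eqP/eqP => [h|->]; last exact: cmod0.
by apply/eqP; rewrite -normr_eq0 normE h.
Qed.

Lemma cmod_gt0 z : (0 < cmod z) = (z != 0).
Proof. by rewrite lt_def cmod_ge0 andbT cmod_eq0. Qed.

Lemma cmodV z : cmod z^-1 = (cmod z)^-1.
Proof.
have [->|z0] := eqVneq z 0; first by rewrite invr0 cmod0 invr0.
have h : cmod z != 0 by rewrite cmod_eq0.
by apply: (mulfI h); rewrite -cmodM !mulfV// cmod1.
Qed.

Lemma cmodX z n : cmod (z ^+ n) = cmod z ^+ n.
Proof. by elim: n => [|n ih]; rewrite ?expr0 ?cmod1// !exprS cmodM ih. Qed.

Lemma cmod_cr (x : R) : cmod (cr x) = `|x|.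
Proof. by rewrite cmodE /= expr0n addr0 sqrtr_sqr. Qed.

Lemma cmod_conj z : cmod (z^*) = cmod z.
Proof. by rewrite !cmodE; case: z => a b /=; rewrite sqrrN. Qed.

Lemma le_re z : `|re z| <= cmod z.
Proof. by rewrite cmodE -sqrtr_sqr ler_wsqrtr// lerDl sqr_ge0. Qed.

Lemma le_im z : `|im z| <= cmod z.
Proof. by rewrite cmodE -sqrtr_sqr ler_wsqrtr// lerDr sqr_ge0. Qed.

Lemma cmod_le z : cmod z <= `|re z| + `|im z|.
Proof.
have -> : z = Complex (re z) 0 + Complex 0 (im z).
  by case: z => a b; apply/eqP; rewrite eq_complex /= addr0 add0r !eqxx.
apply: (le_trans (cmodD _ _)); rewrite !cmodE /= expr0n /= add0r addr0 !sqrtr_sqr.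
by rewrite addr0 add0r.
Qed.

Lemma cmod_sub z w : cmod z - cmod w <= cmod (z - w).
Proof. by rewrite lerBlDr; have := cmodD (z - w) w; rewrite subrK. Qed.

Lemma ceq z w : re z = re w -> im z = im w -> z = w.
Proof. by case: z w => [a b] [c d] /= -> ->. Qed.

Lemma reD z w : re (z + w) = re z + re w. Proof. by case: z w => [a b] [c d]. Qed.
Lemma imD z w : im (z + w) = im z + im w. Proof. by case: z w => [a b] [c d]. Qed.
Lemma reN z : re (- z) = - re z. Proof. by case: z. Qed.
Lemma imN z : im (- z) = - im z. Proof. by case: z. Qed.
Lemma reM z w : re (z * w) = re z * re w - im z * im w.
Proof. by case: z w => [a b] [c d]. Qed.
Lemma imM z w : im (z * w) = re z * im w + im z * re w.
Proof. by case: z w => [a b] [c d]. Qed.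
Lemma re_conj z : re (z^*) = re z. Proof. by case: z. Qed.
Lemma im_conj z : im (z^*) = - im z. Proof. by case: z. Qed.
Definition cE := (reD, imD, reN, imN, reM, imM, re_conj, im_conj).

Lemma crM x y : cr (x * y) = cr x * cr y.
Proof. by apply: ceq; rewrite cE /= ?mulr0 ?mul0r ?subr0 ?addr0. Qed.
Lemma crD x y : cr (x + y) = cr x + cr y.
Proof. by apply: ceq; rewrite cE /= ?addr0. Qed.
Lemma crN x : cr (- x) = - cr x.
Proof. by apply: ceq; rewrite cE /= ?oppr0. Qed.

Lemma cr0 : cr 0 = 0. Proof. by []. Qed.
Lemma cr1 : cr 1 = 1. Proof. by []. Qed.

Lemma re_sum (I : Type) (r : seq I) (P : pred I) (F : I -> C R) :
  re (\sum_(i <- r | P i) F i) = \sum_(i <- r | P i) re (F i).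
Proof. exact: (big_morph (fun z : C R => re z) reD). Qed.

Lemma im_sum (I : Type) (r : seq I) (P : pred I) (F : I -> C R) :
  im (\sum_(i <- r | P i) F i) = \sum_(i <- r | P i) im (F i).
Proof. exact: (big_morph (fun z : C R => im z) imD). Qed.

(** Neighbourhoods in [C R] are given by balls of radius in [C R]; real radii
    suffice, which turns topological statements into real estimates. *)
Lemma nbhs_cmod z (A : set (C R)) :
  nbhs z A <-> exists2 d : R, 0 < d & forall w, cmod (w - z) < d -> A w.
Proof.
split=> [/nbhs_normP[e /= e0 h]|[d d0 h]].
  have e0' : (0 : R[i]) < e by exact: e0.
  exists (re e); first by move: e0'; rewrite ltcE => /andP[].
  move=> w hw; apply: h => /=; rewrite distrC normE.
  move: e0'; rewrite ltcE => /andP[/eqP e1 e2].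
  have -> : e = cr (re e) by apply: ceq => //=; rewrite -e1.
  by rewrite (_ : (_ < _) = ((cr (cmod (w - z)) : R[i]) < cr (re e)))// ltcR.
apply/nbhs_normP; exists (cr d) => /=; first by rewrite (_ : (_ < _) = ((cr 0 : R[i]) < cr d))// ltcR.
move=> w /=; rewrite distrC normE => hw; apply: h.
by move: hw; rewrite (_ : (_ < _) = ((cr (cmod (w - z)) : R[i]) < cr d))// ltcR.
Qed.

End Modulus.
#[export] Hint Resolve cmod_ge0 : core.
Arguments cr {R} x.
Arguments cmod {R} z.

(** * Real curves in the complex plane and complex differentiability *)

Section Derivatives.
Variable R : realType.
Implicit Types (c : R -> C R) (F : C R -> C R) (t : R) (z : C R).

(** Without quotients the estimate also holds for [h = 0], so that estimates can be
    composed without distinguishing cases. *)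
Lemma is_derive_epsP (f : R -> R) (t d : R) : is_derive t 1 f d <->
  forall e : R, 0 < e -> exists2 r : R, 0 < r &
    forall h, `|h| < r -> `|f (t + h) - f t - d * h| <= e * `|h|.
Proof.
split=> [[df dv] e e0|H].
  have : (h^-1 *: ((f \o shift t) (h *: 1) - f t)) @[h --> 0^'] --> d.
    by move: df => /cvg_ex[l hl]; rewrite -dv /derive (cvg_lim _ hl).
  move=> /cvgrPdist_le/(_ _ e0); rewrite near_withinE => /nbhs_normP[r /= r0 hr].
  exists r => // h hh; have [->|h0] := eqVneq h 0.
    by rewrite addr0 subrr mulr0 subr0 normr0 mulr0.
  have /= := hr h; rewrite sub0r normrN => /(_ hh h0).
  rewrite scaler1 distrC -(ler_pM2r (_ : 0 < `|h|)) ?normr_gt0// -normrM.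
  by congr (`|_| <= _); rewrite [h + t]addrC /GRing.scale /=; field.
have cv : (h^-1 *: ((f \o shift t) (h *: 1) - f t)) @[h --> 0^'] --> d.
  apply/cvgrPdist_le => e e0; have [r r0 hr] := H _ e0.
  rewrite near_withinE; apply/nbhs_normP; exists r => //= h /=; rewrite sub0r normrN => hh h0.
  rewrite -(ler_pM2r (_ : 0 < `|h|)) ?normr_gt0// -normrM.
  have := hr h hh; congr (_ <= _); rewrite distrC; congr (`|_|).
  by rewrite [h *: 1]scaler1 [h + t]addrC /GRing.scale /=; field.
by split; [apply: cvgP cv | apply: cvg_lim cv].
Qed.

Lemma is_derive_continuous (f : R -> R) (t d : R) : is_derive t 1 f d -> continuous_at t f.
Proof.
move=> h; apply: differentiable_continuous; apply/derivable1_diffP.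
exact: (@ex_derive _ _ _ _ _ _ _ h).
Qed.

Definition cder c t (d : C R) :=
  is_derive t 1 (fun s => re (c s)) (re d) /\
  is_derive t 1 (fun s => im (c s)) (im d).

Lemma cder_epsP c t d : cder c t d <->
  forall e : R, 0 < e -> exists2 r : R, 0 < r &
    forall h, `|h| < r -> cmod (c (t + h) - c t - d * cr h) <= e * `|h|.
Proof.
split=> [[/is_derive_epsP h1 /is_derive_epsP h2] e e0|H].
  have e2 : 0 < e / 2 by rewrite divr_gt0.
  have [r1 r10 H1] := h1 _ e2; have [r2 r20 H2] := h2 _ e2.
  exists (Num.min r1 r2); first by rewrite lt_min r10.
  move=> h; rewrite lt_min => /andP[/H1 {}H1 /H2 {}H2].
  apply: le_trans (cmod_le _) _; rewrite !cE /= mulr0 subr0 mulr0 add0r.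
  apply: (le_trans (lerD H1 H2)); lra.
split; apply/is_derive_epsP => e e0; have [r r0 hr] := H _ e0; exists r => // h /hr {}hr.
  by have := le_trans (le_re _) hr; rewrite !cE /= mulr0 subr0.
by have := le_trans (le_im _) hr; rewrite !cE /= mulr0 add0r.
Qed.

Lemma cder_eq c t d d' : cder c t d -> d = d' -> cder c t d'.
Proof. by move=> h <-. Qed.

Lemma cder_uniq c t d d' : cder c t d -> cder c t d' -> d = d'.
Proof.
move=> [h1 h2] [h3 h4]; apply: ceq.
  by rewrite -(@derive_val _ _ _ _ _ _ _ h1) -(@derive_val _ _ _ _ _ _ _ h3).
by rewrite -(@derive_val _ _ _ _ _ _ _ h2) -(@derive_val _ _ _ _ _ _ _ h4).
Qed.

Lemma cder_near c c' t d : (\forall s \near t, c s = c' s) -> cder c t d -> cder c' t d.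
Proof.
move=> /nbhs_normP[r0 /= r00 hr0] /cder_epsP H; apply/cder_epsP => e e0.
have [r r_0 hr] := H _ e0; exists (Num.min r r0); first by rewrite lt_min r_0.
move=> h; rewrite lt_min => /andP[h1 h2]; rewrite -!hr0 ?hr//=.
  by rewrite subrr normr0.
by rewrite opprD addrA subrr sub0r normrN.
Qed.

Lemma cderD c1 c2 t d1 d2 : cder c1 t d1 -> cder c2 t d2 ->
  cder (fun s => c1 s + c2 s) t (d1 + d2).
Proof.
move=> [h1 h2] [h3 h4]; split.
  under eq_fun do rewrite reD; rewrite reD; exact: is_deriveD.
under eq_fun do rewrite imD; rewrite imD; exact: is_deriveD.
Qed.

Lemma cderM c1 c2 t d1 d2 : cder c1 t d1 -> cder c2 t d2 ->
  cder (fun s => c1 s * c2 s) t (d1 * c2 t + c1 t * d2).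
Proof.
move=> [h1 h2] [h3 h4]; split.
  under eq_fun do rewrite reM.
  apply: is_derive_eq; rewrite !cE /GRing.scale /=; ring.
under eq_fun do rewrite imM.
apply: is_derive_eq; rewrite !cE /GRing.scale /=; ring.
Qed.

Lemma cder_conj c t d : cder c t d -> cder (fun s => (c s)^*) t d^*.
Proof.
move=> [h1 h2]; split.
  by under eq_fun do rewrite re_conj; rewrite re_conj.
under eq_fun do rewrite im_conj; rewrite im_conj; exact: is_deriveN.
Qed.

Lemma cder_cst (a : C R) t : cder (fun=> a) t 0.
Proof. by split; exact: is_derive_cst. Qed.

Lemma cder_cr t : cder cr t 1.
Proof. by split; [exact: is_derive_id | exact: is_derive_cst]. Qed.

(** Stated as an estimate so that it can be composed with the one for curves; it
    agrees with the library derivative over the field [C R], see [cdiffP]. *)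
Definition cdiff F z (l : C R) :=
  forall e : R, 0 < e -> exists2 r : R, 0 < r &
    forall h, cmod h < r -> cmod (F (z + h) - F z - l * h) <= e * cmod h.

(** Contour integrals and directional derivatives see a function only along real
    curves, hence through this chain rule. *)
Lemma cdiff_cder F c t l d : cdiff F (c t) l -> cder c t d ->
  cder (F \o c) t (l * d).
Proof.
move=> HF /cder_epsP Hc; apply/cder_epsP => e e0 /=.
pose K := cmod d + 1; have K0 : 0 < K by exact: cmod1_gt0.
pose L := cmod l + 1; have L0 : 0 < L by exact: cmod1_gt0.
have eK : 0 < e / (2 * K) by rewrite divr_gt0// mulr_gt0.
have [r1 r10 H1] := HF _ eK.
have m0 : 0 < Num.min 1 (e / (2 * L)) by rewrite lt_min ltr01 divr_gt0// mulr_gt0.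
have [r2 r20 H2] := Hc _ m0.
exists (Num.min r2 (r1 / K)); first by rewrite lt_min r20 divr_gt0.
move=> h; rewrite lt_min => /andP[/H2 h2]; rewrite ltr_pdivlMr// => hh.
pose k := c (t + h) - c t.
have kE : cmod (k - d * cr h) <= Num.min 1 (e / (2 * L)) * `|h| by exact: h2.
have kK : cmod k <= K * `|h|.
  have := cmodD (k - d * cr h) (d * cr h); rewrite subrK => /le_trans; apply.
  rewrite /K mulrDl mul1r addrC lerD//; first by rewrite cmodM cmod_cr.
  by apply: le_trans kE _; rewrite ler_piMl// ge_min lexx.
have kr : cmod k < r1 by apply: le_lt_trans kK _; rewrite mulrC.
have := H1 k kr; rewrite /k [c t + _]addrC subrK -/k => {}H1.
have -> : F (c (t + h)) - F (c t) - l * d * cr h =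
   (F (c (t + h)) - F (c t) - l * k) + l * (k - d * cr h) by ring.
apply: le_trans (cmodD _ _) _.
have A : e / (2 * K) * cmod k <= e / 2 * `|h|.
  have -> : e / 2 * `|h| = e / (2 * K) * (K * `|h|) by field; rewrite gt_eqF.
  by rewrite ler_wpM2l// ltW// divr_gt0// mulr_gt0.
have B : cmod (l * (k - d * cr h)) <= e / 2 * `|h|.
  rewrite cmodM; apply: (@le_trans _ _ (L * (e / (2 * L) * `|h|))).
    apply: ler_pM; [exact: cmod_ge0|exact: cmod_ge0| |]; first by rewrite /L lerDl.
    by apply: le_trans kE _; rewrite ler_wpM2r// ge_min lexx orbT.
  by rewrite le_eqVlt; apply/orP; left; apply/eqP; field; rewrite gt_eqF.
apply: (le_trans (lerD (le_trans H1 A) B)); lra.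
Qed.

Lemma cdiff_uniq F z l l' : cdiff F z l -> cdiff F z l' -> l = l'.
Proof.
move=> h h'.
have k : cder (fun s => z + cr s) 0 1.
  by have := cderD (cder_cst z 0) (cder_cr 0); rewrite add0r.
have z0 : z = z + cr 0 by rewrite (_ : cr 0 = 0)// addr0.
rewrite z0 in h h'.
have := cder_uniq (cdiff_cder (c := fun s => z + cr s) h k) (cdiff_cder (c := fun s => z + cr s) h' k).
by rewrite !mulr1.
Qed.

Lemma cdiff_continuous F z l : cdiff F z l -> {for z, continuous F}.
Proof.
move=> H; move=> A /nbhs_cmod[d d0 hd].
have [r r0 hr] := H 1 ltr01.
pose K := cmod l + 1; have K0 : 0 < K by exact: cmod1_gt0.
apply/nbhs_cmod; exists (Num.min r (d / K)); first by rewrite lt_min r0 divr_gt0.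
move=> w; rewrite lt_min => /andP[/hr]; rewrite [z + _]addrC subrK => h1.
rewrite ltr_pdivlMr// => h2; apply: hd; apply: le_lt_trans h2.
have := cmodD (F w - F z - l * (w - z)) (l * (w - z)); rewrite subrK => /le_trans; apply.
rewrite /K [leRHS]mulrC mulrDl [leLHS]addrC cmodM; apply: lerD => //.
Qed.

End Derivatives.

(** * Integrals of complex-valued functions on segments *)

Section ComplexIntegral.
Variable R : realType.
Implicit Types (c : R -> C R) (F : C R -> C R) (a b t : R) (z : C R).
Local Notation mu := (@lebesgue_measure R).

Definition ccont c t :=
  continuous_at t (fun s => re (c s)) /\ continuous_at t (fun s => im (c s)).

Lemma cder_ccont c t d : cder c t d -> ccont c t.
Proof.
by move=> [h1 h2]; split; [exact: is_derive_continuous h1|exact: is_derive_continuous h2].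
Qed.

Lemma ccontD c1 c2 t : ccont c1 t -> ccont c2 t -> ccont (fun s => c1 s + c2 s) t.
Proof.
move=> [h1 h2] [h3 h4]; split.
  by rewrite (funext (fun s => reD (c1 s) (c2 s))); exact: (cvgD h1 h3).
by rewrite (funext (fun s => imD (c1 s) (c2 s))); exact: (cvgD h2 h4).
Qed.

Lemma ccontM c1 c2 t : ccont c1 t -> ccont c2 t -> ccont (fun s => c1 s * c2 s) t.
Proof.
move=> [h1 h2] [h3 h4]; split.
  by rewrite (funext (fun s => reM (c1 s) (c2 s))); exact: (cvgB (cvgM h1 h3) (cvgM h2 h4)).
by rewrite (funext (fun s => imM (c1 s) (c2 s))); exact: (cvgD (cvgM h1 h4) (cvgM h2 h3)).
Qed.

Lemma ccont_cst z t : ccont (fun=> z) t.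
Proof. by split; exact: cst_continuous. Qed.

Definition ccont_on a b c := forall t, a <= t <= b -> ccont c t.

Lemma within_segment_continuous a b (f : R -> R) :
  (forall t, a <= t <= b -> continuous_at t f) -> {within `[a, b], continuous f}.
Proof.
by move=> h; apply: continuous_in_subspaceT => t; rewrite inE /= in_itv /=; exact: h.
Qed.

Lemma integrable_cont a b (f : R -> R) :
  (forall t, a <= t <= b -> continuous_at t f) ->
  mu.-integrable `[a, b] (EFin \o f).
Proof.
move=> h; apply: continuous_compact_integrable; first exact: segment_compact.
exact: within_segment_continuous.
Qed.

Lemma cont_re c a b : ccont_on a b c ->
  forall t, a <= t <= b -> continuous_at t (fun s => re (c s)).
Proof. by move=> h t /h[]. Qed.

Lemma cont_im c a b : ccont_on a b c ->
  forall t, a <= t <= b -> continuous_at t (fun s => im (c s)).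
Proof. by move=> h t /h[]. Qed.

Definition cint a b c : C R :=
  Complex (\int[mu]_(t in `[a, b]) re (c t)) (\int[mu]_(t in `[a, b]) im (c t)).

Lemma eq_cint a b c1 c2 : (forall t, a <= t <= b -> c1 t = c2 t) -> cint a b c1 = cint a b c2.
Proof.
move=> h; rewrite /cint; congr Complex; apply: eq_Rintegral => t;
by rewrite inE /= in_itv /= => /h ->.
Qed.

Lemma Rint_split a m b (f : R -> R) : a <= m -> m <= b ->
  (forall t, a <= t <= b -> continuous_at t f) ->
  \int[mu]_(t in `[a, b]) f t = \int[mu]_(t in `[a, m]) f t + \int[mu]_(t in `[m, b]) f t.
Proof.
move=> am mb h; have h1 := integrable_cont h.
have h2 : mu.-integrable `[m, b] (EFin \o f).
  by apply: integrable_cont => t /andP[h2 h3]; apply: h; rewrite (le_trans am).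
have := Rintegral_itvB h1 (_ : (BLeft a <= BRight m)%O) (_ : (BRight m <= BRight b)%O).
rewrite !bnd_simp => /(_ am mb).
rewrite Rintegral_itv_obnd_cbnd; last first.
  by apply: integrableS h2 => //; apply: subset_itvr; rewrite bnd_simp.
by move=> <-; rewrite addrC subrK.
Qed.

Lemma cint_split a m b c : a <= m -> m <= b -> ccont_on a b c ->
  cint a b c = cint a m c + cint m b c.
Proof.
move=> am mb h; apply: ceq; rewrite ?cE /=; apply: Rint_split => //.
  exact: cont_re.
exact: cont_im.
Qed.

Lemma cintD a b c1 c2 : ccont_on a b c1 -> ccont_on a b c2 ->
  cint a b (fun t => c1 t + c2 t) = cint a b c1 + cint a b c2.
Proof.
move=> h1 h2; apply: ceq; rewrite ?cE /=.
  under eq_Rintegral do rewrite reD.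
  by apply: RintegralD => //; apply: integrable_cont; exact: cont_re.
under eq_Rintegral do rewrite imD.
by apply: RintegralD => //; apply: integrable_cont; exact: cont_im.
Qed.

Lemma cintZ a b z c : ccont_on a b c ->
  cint a b (fun t => z * c t) = z * cint a b c.
Proof.
move=> h; have h1 := integrable_cont (cont_re h); have h2 := integrable_cont (cont_im h).
have Z k (f : R -> R) : mu.-integrable `[a, b] (EFin \o f) -> mu.-integrable `[a, b] (EFin \o (fun t => k * f t)).
  by move=> hf; exact: (@integrableZl _ _ R mu `[a, b]%classic (measurable_itv _) k _ hf).
apply: ceq; rewrite ?cE /=.
  under eq_Rintegral do rewrite reM.
  rewrite RintegralB//; [|exact: Z|exact: Z].
  by rewrite !RintegralZl.
under eq_Rintegral do rewrite imM.
rewrite RintegralD//; [|exact: Z|exact: Z].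
by rewrite !RintegralZl.
Qed.

Lemma Rint_bound a b (f : R -> R) (M : R) : a <= b ->
  (forall t, a <= t <= b -> continuous_at t f) ->
  (forall t, a <= t <= b -> `|f t| <= M) ->
  `|\int[mu]_(t in `[a, b]) f t| <= M * (b - a).
Proof.
move=> ab h hM; apply: le_trans (le_normr_Rintegral _ (integrable_cont h)) _ => //.
have -> : M * (b - a) = \int[mu]_(t in `[a, b]) M.
  rewrite Rintegral_cst//= lebesgue_measure_itv /= lte_fin.
  by move: ab; rewrite le_eqVlt => /predU1P[->|->//]; rewrite ltxx /= subrr.
apply: le_Rintegral => //.
- by apply: integrable_cont => t /h ht; apply: continuous_comp => //; exact: norm_continuous.
- by apply: integrable_cont => t _; exact: cst_continuous.
Qed.

(** The factor 2 comes from bounding the real and imaginary parts separately. *)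
Lemma cint_bound a b c (M : R) : a <= b -> ccont_on a b c ->
  (forall t, a <= t <= b -> cmod (c t) <= M) -> cmod (cint a b c) <= 2 * M * (b - a).
Proof.
move=> ab h hM; apply: le_trans (cmod_le _) _ => /=.
have h1 := Rint_bound ab (cont_re h) (fun t ht => le_trans (le_re _) (hM t ht)).
have h2 := Rint_bound ab (cont_im h) (fun t ht => le_trans (le_im _) (hM t ht)).
by apply: le_trans (lerD h1 h2) _; rewrite -mulrDl -mulr2n mulr_natl.
Qed.

Lemma Rint_FTC a b (f P : R -> R) : a <= b ->
  (forall t, a <= t <= b -> continuous_at t f) ->
  (forall t, a <= t <= b -> is_derive t 1 P (f t)) ->
  \int[mu]_(t in `[a, b]) f t = P b - P a.
Proof.
rewrite le_eqVlt => /predU1P[<- _ _|ab h hP].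
  by rewrite set_itv1 Rintegral_set1 subrr.
have Pc t : a <= t <= b -> continuous_at t P by move=> /hP ht; exact: is_derive_continuous ht.
have := continuous_FTC2 (f := f) (F := P) ab (within_segment_continuous h) _ _.
rewrite /Rintegral => -> //.
- split.
  + move=> t; rewrite in_itv /= => /andP[h1 h2].
    have ht : a <= t <= b by rewrite !ltW.
    by apply: (@ex_derive _ _ _ _ _ _ _ (hP t ht)).
  + by apply: cvg_at_right_filter; apply: Pc; rewrite lexx ltW.
  + by apply: cvg_at_left_filter; apply: Pc; rewrite lexx ltW.
- move=> t; rewrite in_itv /= => /andP[h1 h2].
  have ht : a <= t <= b by rewrite !ltW.
  by rewrite derive1E; apply: (@derive_val _ _ _ _ _ _ _ (hP t ht)).
Qed.

Lemma cint_FTC a b c (P : R -> C R) : a <= b -> ccont_on a b c ->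
  (forall t, a <= t <= b -> cder P t (c t)) -> cint a b c = P b - P a.
Proof.
move=> ab h hP; apply: ceq; rewrite ?cE /=.
  by apply: (@Rint_FTC a b _ (fun t => re (P t))) => // t; [move=> /h[]|move=> /hP[]].
by apply: (@Rint_FTC a b _ (fun t => im (P t))) => // t; [move=> /h[]|move=> /hP[]].
Qed.

End ComplexIntegral.

(** * Goursat's lemma *)

Section Bisection.
Variable R : realType.
Implicit Types s t d : R.

(** A square where the property fails has a quarter where it fails. The nested
    squares obtained in this way shrink to a point, and the property holds for all
    small squares containing that point. *)
Lemma bisection_principle (P : R -> R -> R -> Prop) :
  (forall s t d, 0 < d -> 0 <= s -> s + d + d <= 1 -> 0 <= t -> t + d + d <= 1 ->
     P s t d -> P (s + d) t d -> P s (t + d) d -> P (s + d) (t + d) d ->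
     P s t (d + d)) ->
  (forall a b, 0 <= a <= 1 -> 0 <= b <= 1 -> exists2 r : R, 0 < r &
     forall s t d, 0 < d < r -> 0 <= s -> s + d <= 1 -> 0 <= t -> t + d <= 1 ->
       s <= a <= s + d -> t <= b <= t + d -> P s t d) ->
  P 0 0 1.
Proof.
move=> Psub Ploc; apply: contrapT => nP.
pose good (q : R * R * R) := [/\ 0 < q.2, 0 <= q.1.1, q.1.1 + q.2 <= 1, 0 <= q.1.2 & q.1.2 + q.2 <= 1].
pose bad (q : R * R * R) := ~ P q.1.1 q.1.2 q.2.
have step q : exists q' : R * R * R, good q -> bad q ->
    [/\ good q', bad q', q'.2 = q.2 / 2, q.1.1 <= q'.1.1 <= q.1.1 + q.2 / 2 & q.1.2 <= q'.1.2 <= q.1.2 + q.2 / 2].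
  have [gq|] := pselect (good q); last by move=> h; exists q.
  have [bq|] := pselect (bad q); last by move=> h; exists q.
  move: q gq bq => [[s t] d] [/= d0 s0 s1 t0 t1] bq.
  pose d' := d / 2; have dE : d = d' + d' by rewrite /d'; lra.
  have d'0 : 0 < d' by rewrite /d' divr_gt0.
  have H q' : bad q' -> q' \in [:: (s, t, d'); (s + d', t, d'); (s, t + d', d'); (s + d', t + d', d')] ->
     exists q'' : R * R * R, good (s, t, d) -> bad (s, t, d) ->
    [/\ good q'', bad q'', q''.2 = d / 2, s <= q''.1.1 <= s + d / 2 & t <= q''.1.2 <= t + d / 2].
    move=> bq' q'in; exists q' => _ _; split => //.
    - by move: q'in; rewrite !inE => /or4P[] /eqP ->; rewrite /good /=; split; lra.
    - by move: q'in; rewrite !inE => /or4P[] /eqP ->.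
    - by move: q'in; rewrite !inE => /or4P[] /eqP -> /=; apply/andP; split; lra.
    - by move: q'in; rewrite !inE => /or4P[] /eqP -> /=; apply/andP; split; lra.
  apply: contrapT => noq; apply: bq; rewrite /= dE; apply: Psub; try lra.
  - by apply: contrapT => h; apply: noq; apply: (H (s, t, d')) => //; rewrite !inE eqxx.
  - by apply: contrapT => h; apply: noq; apply: (H (s + d', t, d')) => //; rewrite !inE eqxx orbT.
  - by apply: contrapT => h; apply: noq; apply: (H (s, t + d', d')) => //; rewrite !inE eqxx !orbT.
  - by apply: contrapT => h; apply: noq; apply: (H (s + d', t + d', d')) => //; rewrite !inE eqxx !orbT.
have [g Hg] := choice step.
pose q n := iter n g (0, 0, 1 : R).
have qgb n : good (q n) /\ bad (q n).
  elim: n => [|n [ih1 ih2]]; first by split => //; rewrite /good /=; split; lra.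
  by rewrite /q iterS; have [] := Hg _ ih1 ih2.
have qS n : [/\ (q n.+1).2 = (q n).2 / 2, (q n).1.1 <= (q n.+1).1.1 <= (q n).1.1 + (q n).2 / 2
    & (q n).1.2 <= (q n.+1).1.2 <= (q n).1.2 + (q n).2 / 2].
  by have [h1 h2] := qgb n; rewrite /q iterS; have [] := Hg _ h1 h2.
have side n : (q n).2 = 2^-1 ^+ n.
  elim: n => [|n ih]; first by rewrite expr0.
  by have [-> _ _] := qS n; rewrite ih exprS mulrC.
(* the lower corners increase and the upper corners decrease *)
have lim (x : nat -> R) : (forall n, x n <= x n.+1 <= x n + (q n).2 / 2) ->
   exists a, forall n, x n <= a <= x n + (q n).2.
  move=> hx.
  have low m n : x n <= x (n + m)%N.
    by elim: m => [|m ih]; rewrite ?addn0// addnS (le_trans ih)//; case/andP: (hx (n + m)%N).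
  have up m n : x (n + m)%N + (q (n + m)%N).2 <= x n + (q n).2.
    elim: m => [|m ih]; rewrite ?addn0// addnS; apply: le_trans ih.
    by have [-> _ _] := qS (n + m)%N; have /andP[_] := hx (n + m)%N; lra.
  have ub n m : x n <= x m + (q m).2.
    have p k : 0 <= (q k).2 by have [[/ltW]] := qgb k.
    have [nm|mn] := leqP n m.
      by rewrite -(subnKC nm); apply: le_trans (low (m - n)%N n) _; rewrite lerDl.
    rewrite -(subnKC (ltnW mn)); apply: le_trans (up (n - m)%N m).
    by rewrite lerDl.
  have hs : has_sup (range x).
    by split; [exists (x 0%N); exists 0%N | exists (x 0%N + (q 0%N).2) => _ [n _ <-]].
  exists (sup (range x)) => n; apply/andP; split.
    by apply: ub_le_sup; [exact: hs.2 | exists n].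
  by apply: ge_sup; [exact: hs.1 | move=> _ [m _ <-]].
have [a ha] := lim (fun n => (q n).1.1) (fun n => let: And3 _ h _ := qS n in h).
have [b hb] := lim (fun n => (q n).1.2) (fun n => let: And3 _ _ h := qS n in h).
have ha01 : 0 <= a <= 1 by have := ha 0%N; rewrite /q /= add0r.
have hb01 : 0 <= b <= 1 by have := hb 0%N; rewrite /q /= add0r.
have [r r0 hr] := Ploc a b ha01 hb01.
have [n hn] : exists n, 2^-1 ^+ n < r.
  have h : `|2^-1 : R| < 1 by rewrite ger0_norm// invf_lt1// ltr1n.
  have /cvgrPdist_lt/(_ _ r0)[n _ hn] := cvg_expr h.
  exists n; have := hn n (leqnn n); rewrite /= sub0r normrN ger0_norm//.
have [[h1 h2 h3 h4 h5] bq] := qgb n; apply: bq; apply: hr => //.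
by rewrite h1 /= side.
Qed.

End Bisection.

Section Goursat.
Variable R : realType.
Implicit Types (F : C R -> C R) (s t d : R) (z : C R).

(** [E] is a C^1 map from the unit square to the domain of [H], with partial
    derivatives [Es] and [Et]. The integral of [H w dw] along the image of the
    boundary of a small square of side [d] is at most [e d^2]: near a point [H] is
    an affine function, which has a primitive, up to an error [o(d)]. The bisection
    principle adds up these bounds. *)
Variables (E Es Et : R -> R -> C R) (K : R) (H dH : C R -> C R).
Hypothesis K_ge0 : 0 <= K.
Hypothesis E_s : forall s t, cder (E^~ t) s (Es s t).
Hypothesis E_t : forall s t, cder (E s) t (Et s t).
Hypothesis Es_cont : forall s t, ccont (Es^~ t) s.
Hypothesis Et_cont : forall s t, ccont (Et s) t.
Hypothesis Es_le : forall s t, 0 <= s <= 1 -> 0 <= t <= 1 -> cmod (Es s t) <= K.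
Hypothesis Et_le : forall s t, 0 <= s <= 1 -> 0 <= t <= 1 -> cmod (Et s t) <= K.
Hypothesis E_lip : forall s t s' t', 0 <= s <= 1 -> 0 <= t <= 1 -> 0 <= s' <= 1 -> 0 <= t' <= 1 ->
  cmod (E s t - E s' t') <= K * (`|s - s'| + `|t - t'|).
Hypothesis H_diff : forall s t, 0 <= s <= 1 -> 0 <= t <= 1 -> cdiff H (E s t) (dH (E s t)).

Let hor (G : C R -> C R) s t := G (E s t) * Es s t.
Let ver (G : C R -> C R) s t := G (E s t) * Et s t.

(* the integral of G along the image of the counterclockwise boundary of the square
   of side d with lower left corner (s, t) *)
Let bd G s t d := cint t (t + d) (ver G (s + d)) - cint t (t + d) (ver G s)
   + cint s (s + d) (hor G ^~ t) - cint s (s + d) (hor G^~ (t + d)).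

Let hor_cont G dG s t : cdiff G (E s t) dG -> ccont (hor G^~ t) s.
Proof.
move=> h; apply: ccontM; last exact: Es_cont.
exact: cder_ccont (cdiff_cder (c := E^~ t) h (E_s s t)).
Qed.

Let ver_cont G dG s t : cdiff G (E s t) dG -> ccont (ver G s) t.
Proof.
move=> h; apply: ccontM; last exact: Et_cont.
exact: cder_ccont (cdiff_cder h (E_t s t)).
Qed.

Let bd_split s t d : 0 < d -> 0 <= s -> s + d + d <= 1 -> 0 <= t -> t + d + d <= 1 ->
  bd H s t (d + d) = bd H s t d + bd H (s + d) t d + bd H s (t + d) d + bd H (s + d) (t + d) d.
Proof.
move=> d0 s0 s1 t0 t1; rewrite /bd.
have V s' : 0 <= s' <= 1 -> cint t (t + (d + d)) (ver H s') = cint t (t + d) (ver H s') + cint (t + d) (t + d + d) (ver H s').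
  move=> hs'; rewrite (@cint_split _ t (t + d)) ?addrA//; try lra.
  by move=> x hx; apply: ver_cont; apply: H_diff; lra.
have U t' : 0 <= t' <= 1 -> cint s (s + (d + d)) (hor H ^~ t') = cint s (s + d) (hor H ^~ t') + cint (s + d) (s + d + d) (hor H^~ t').
  move=> ht'; rewrite (@cint_split _ s (s + d)) ?addrA//; try lra.
  by move=> x hx; apply: hor_cont; apply: H_diff; lra.
have [hs hs1 hs2] : [/\ 0 <= s <= 1, 0 <= s + d <= 1 & 0 <= s + (d + d) <= 1] by split; lra.
have [ht ht1 ht2] : [/\ 0 <= t <= 1, 0 <= t + d <= 1 & 0 <= t + (d + d) <= 1] by split; lra.
rewrite !(V _ hs) !(V _ hs2) !(U _ ht) !(U _ ht2) !addrA; ring.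
Qed.

Let bd_affine (x y w : C R) s t d : 0 <= d -> bd (fun u => x + y * (u - w)) s t d = 0.
Proof.
move=> d0; set G := fun u => _.
pose P (u : C R) := x * u + y * (u - w) ^+ 2 / 2.
have dP u : cdiff P u (G u).
  move=> e e0; exists (e / (cmod y + 1)); first by rewrite divr_gt0// cmod1_gt0.
  move=> h; rewrite ltr_pdivlMr ?cmod1_gt0// => hh.
  have -> : P (u + h) - P u - G u * h = y * h / 2 * h by rewrite /P /G; field.
  rewrite cmodM ler_wpM2r ?cmod_ge0// !cmodM cmodV.
  have -> : cmod (2 : C R) = 2.
    have -> : (2 : C R) = cr 2 by apply: ceq; rewrite /= ?addr0.
    by rewrite cmod_cr ger0_norm.
  have := cmod_ge0 y; have := cmod_ge0 h; nra.
have dG u : cdiff G u y.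
  move=> e e0; exists 1 => // h _.
  by rewrite (_ : _ - _ - _ = 0) ?cmod0 ?mulr_ge0 ?cmod_ge0 ?ltW// /G; ring.
have V s' : cint t (t + d) (ver G s') = P (E s' (t + d)) - P (E s' t).
  apply: (@cint_FTC _ _ _ _ (fun t => P (E s' t))); first by rewrite lerDl.
    by move=> u _; exact: ver_cont (dG _).
  by move=> u _; exact: cdiff_cder (dP _) (E_t _ _).
have U t' : cint s (s + d) (hor G ^~ t') = P (E (s + d) t') - P (E s t').
  apply: (@cint_FTC _ _ _ _ (fun s => P (E s t'))); first by rewrite lerDl.
    by move=> u _; exact: hor_cont (dG _).
  by move=> u _; exact: (cdiff_cder (c := E^~ t') (dP _) (E_s _ _)).
rewrite /bd !V !U; ring.
Qed.

Let bd_add (G1 G2 : C R -> C R) s t d : 0 < d -> 0 <= s -> s + d <= 1 -> 0 <= t -> t + d <= 1 ->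
  (forall s t, 0 <= s <= 1 -> 0 <= t <= 1 -> exists l, cdiff G1 (E s t) l) ->
  (forall s t, 0 <= s <= 1 -> 0 <= t <= 1 -> exists l, cdiff G2 (E s t) l) ->
  bd (fun u => G1 u + G2 u) s t d = bd G1 s t d + bd G2 s t d.
Proof.
move=> d0 s0 s1 t0 t1 h1 h2.
have V s' : 0 <= s' <= 1 -> cint t (t + d) (ver (fun u => G1 u + G2 u) s') =
   cint t (t + d) (ver G1 s') + cint t (t + d) (ver G2 s').
  move=> hs'; rewrite -cintD.
  - by apply: eq_cint => x _; rewrite /ver mulrDl.
  - by move=> x hx; have [|l hl] := h1 s' x hs'; [lra|exact: ver_cont hl].
  - by move=> x hx; have [|l hl] := h2 s' x hs'; [lra|exact: ver_cont hl].
have U t' : 0 <= t' <= 1 -> cint s (s + d) (hor (fun u => G1 u + G2 u) ^~ t') =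
   cint s (s + d) (hor G1 ^~ t') + cint s (s + d) (hor G2 ^~ t').
  move=> ht'; rewrite -cintD.
  - by apply: eq_cint => x _; rewrite /hor mulrDl.
  - by move=> x hx; have [|//|l hl] := h1 x t'; [lra|exact: hor_cont hl].
  - by move=> x hx; have [|//|l hl] := h2 x t'; [lra|exact: hor_cont hl].
have [hs hs1] : 0 <= s <= 1 /\ 0 <= s + d <= 1 by split; lra.
have [ht ht1] : 0 <= t <= 1 /\ 0 <= t + d <= 1 by split; lra.
rewrite /bd !(V _ hs) !(V _ hs1) !(U _ ht) !(U _ ht1); ring.
Qed.

Let bd_bound (G : C R -> C R) (M : R) s t d : 0 < d -> 0 <= s -> s + d <= 1 -> 0 <= t -> t + d <= 1 ->
  (forall s t, 0 <= s <= 1 -> 0 <= t <= 1 -> exists l, cdiff G (E s t) l) -> 0 <= M ->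
  (forall s' t', s <= s' <= s + d -> t <= t' <= t + d -> cmod (G (E s' t')) <= M) ->
  cmod (bd G s t d) <= 8 * M * K * d.
Proof.
move=> d0 s0 s1 t0 t1 h M0 hM.
have dd x : x <= x + d by rewrite lerDl ltW.
have V s' : s <= s' <= s + d -> cmod (cint t (t + d) (ver G s')) <= 2 * (M * K) * d.
  move=> hs'; have := @cint_bound R t (t + d) (ver G s') (M * K).
  rewrite [t + d - t]addrC addKr; apply => //.
    by move=> x hx; have [||l hl] := h s' x; [lra|lra|exact: ver_cont hl].
  move=> x hx; rewrite /ver cmodM ler_pM ?cmod_ge0//; first by apply: hM; lra.
  by apply: Et_le; lra.
have U t' : t <= t' <= t + d -> cmod (cint s (s + d) (hor G ^~ t')) <= 2 * (M * K) * d.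
  move=> ht'; have := @cint_bound R s (s + d) (hor G ^~ t') (M * K).
  rewrite [s + d - s]addrC addKr; apply => //.
    by move=> x hx; have [||l hl] := h x t'; [lra|lra|exact: hor_cont hl].
  move=> x hx; rewrite /hor cmodM ler_pM ?cmod_ge0//; first by apply: hM; lra.
  by apply: Es_le; lra.
have [hs hs1] : s <= s <= s + d /\ s <= s + d <= s + d by split; lra.
have [ht ht1] : t <= t <= t + d /\ t <= t + d <= t + d by split; lra.
rewrite /bd; apply: le_trans (cmodD _ _) _; rewrite cmodN.
apply: le_trans (lerD (cmodD _ _) (U _ ht1)) _.
have := cmodD (cint t (t + d) (ver G (s + d))) (- cint t (t + d) (ver G s)).
rewrite cmodN; have := V _ hs; have := V _ hs1; have := U _ ht; lra.
Qed.

Let bd0 : bd H 0 0 1 = 0.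
Proof.
apply/eqP; rewrite -cmod_eq0; apply/eqP/le_anti; rewrite cmod_ge0 andbT.
apply/ler_addgt0Pl => e e0; rewrite addr0.
(* bd_bound gives a factor 8 K, and E s t moves by at most 2 (K + 1) d *)
pose e' := e / (16 * (K + 1) * (K + 1)).
have K1 : 0 < K + 1 by rewrite ltr_wpDl.
have KK : 0 < 16 * (K + 1) * (K + 1) by rewrite !mulr_gt0.
have e'0 : 0 < e' by rewrite divr_gt0.
suff : cmod (bd H 0 0 1) <= e * 1 ^+ 2 by rewrite expr1n mulr1.
apply: (bisection_principle (P := fun s t d => cmod (bd H s t d) <= e * d ^+ 2)).
  move=> s t d d0 s0 s1 t0 t1 h1 h2 h3 h4; rewrite bd_split//.
  have -> : e * (d + d) ^+ 2 = e * d ^+ 2 + e * d ^+ 2 + e * d ^+ 2 + e * d ^+ 2 by ring.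
  apply: le_trans (cmodD _ _) _; rewrite lerD//.
  apply: le_trans (cmodD _ _) _; rewrite lerD//.
  by apply: le_trans (cmodD _ _) _; rewrite lerD.
move=> a b a01 b01; have [r r0 hr] := H_diff a01 b01 e'0.
exists (r / (2 * (K + 1))); first by rewrite divr_gt0// mulr_gt0.
move=> s t d /andP[d0]; rewrite ltr_pdivlMr ?mulr_gt0// => dr s0 s1 t0 t1 ha hb.
pose w := E a b; pose A u := H w + dH w * (u - w).
have dA u : cdiff A u (dH w).
  move=> x x0; exists 1 => // h _.
  by rewrite (_ : _ - _ - _ = 0) ?cmod0 ?mulr_ge0 ?cmod_ge0 ?ltW// /A; ring.
pose G u := H u - A u.
have dG s' t' : 0 <= s' <= 1 -> 0 <= t' <= 1 -> cdiff G (E s' t') (dH (E s' t') - dH w).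
  move=> hs' ht' x x0; have [r1 r10 h1] := H_diff hs' ht' x0; exists r1 => // h /h1.
  by congr (_ <= _); congr cmod; rewrite /G /A; ring.
have HE : (fun u => G u + A u) = H by apply: funext => u; rewrite /G subrK.
have := @bd_add G A s t d d0 s0 s1 t0 t1; rewrite HE => ->; last 2 first.
- by move=> s' t' h1 h2; exists (dH (E s' t') - dH w); exact: dG.
- by move=> s' t' h1 h2; exists (dH w).
rewrite [bd A _ _ _]bd_affine; last exact: ltW.
rewrite addr0.
have := @bd_bound G (e' * (2 * (K + 1) * d)) s t d d0 s0 s1 t0 t1.
have M0 : 0 <= e' * (2 * (K + 1) * d) by apply: mulr_ge0; [exact: ltW|apply: mulr_ge0; [apply: mulr_ge0; [by []|exact: ltW]|exact: ltW]].
move=> /(_ _ M0) hh; apply: (le_trans (hh _ _)).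
- by move=> s' t' h1 h2; exists (dH (E s' t') - dH w); exact: dG.
- move=> s' t' hs' ht'.
  have L : cmod (E s' t' - w) <= 2 * (K + 1) * d.
    apply: (@le_trans _ _ (K * (`|s' - a| + `|t' - b|))); first by apply: E_lip; lra.
    have : `|s' - a| <= d by rewrite ler_norml; lra.
    have : `|t' - b| <= d by rewrite ler_norml; lra.
    have := normr_ge0 (s' - a); have := normr_ge0 (t' - b); nra.
  have Lr : cmod (E s' t' - w) < r by apply: le_lt_trans L _; rewrite mulrC.
  have := hr _ Lr; rewrite [E a b + _]addrC subrK => /le_trans.
  rewrite /G /A opprD addrA; apply.
  by rewrite ler_wpM2l// ltW.
- have -> : 8 * (e' * (2 * (K + 1) * d)) * K * d = e * d ^+ 2 * (K / (K + 1)).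
    by rewrite /e'; field; rewrite gt_eqF.
  apply: ler_piMr; first by rewrite mulr_ge0 ?sqr_ge0// ltW.
  by rewrite ler_pdivrMr// mul1r lerDl.
Qed.

(** For a homotopy of closed curves [E s] the last two integrals are equal, and the
    first two then agree. *)
Lemma goursat :
  cint 0 1 (fun t => H (E 1 t) * Et 1 t) - cint 0 1 (fun t => H (E 0 t) * Et 0 t)
  + cint 0 1 (fun s => H (E s 0) * Es s 0) - cint 0 1 (fun s => H (E s 1) * Es s 1) = 0.
Proof. by have := bd0; rewrite /bd !add0r. Qed.

End Goursat.

(** * Cauchy's formula and derivatives of holomorphic functions *)

Section Cauchy.
Variable R : realType.
Implicit Types (F : C R -> C R) (s t r : R) (z w a : C R).

(** [(C R)^o] is [C R] as a normed space over itself. *)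
Lemma cdiffP F z (l : C R) :
  cdiff F z l <-> is_derive (z : (C R)^o) 1 (F : (C R)^o -> (C R)^o) l.
Proof.
have cle (x y : R) : ((cr x : R[i]) <= cr y) = (x <= y) by rewrite lecR.
have nle (x : C R) (y : R) : (`|x| <= cr y) = (cmod x <= y) by rewrite normE; exact: cle.
split=> [H|[df dv] e e0].
  have cv : (h^-1 *: (((F : (C R)^o -> (C R)^o) \o shift (z : (C R)^o)) (h *: (1 : (C R)^o)) - F z)) @[h --> 0^'] --> (l : (C R)^o).
    apply/cvgrPdist_le => e e0.
    have [ere eim] : 0 < re e /\ im e = 0 by move: e0; rewrite ltcE /= => /andP[/eqP -> ->].
    have eE : e = cr (re e) by apply: ceq; rewrite ?eim.
    have [r r0 hr] := H _ ere.
    rewrite near_withinE; apply/nbhs_cmod; exists r => // h; rewrite subr0 => hh h0.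
    rewrite eE nle -(ler_pM2r (_ : 0 < cmod h)) ?cmod_gt0// -cmodM.
    have := hr h hh; congr (_ <= _); rewrite cmodB; congr cmod.
    rewrite /= /shift [h *: _]mulr1 [h + z]addrC /GRing.scale /=; field; exact: h0.
  by split; [apply: cvgP cv | apply: cvg_lim cv].
have : (h^-1 *: (((F : (C R)^o -> (C R)^o) \o shift (z : (C R)^o)) (h *: (1 : (C R)^o)) - F z)) @[h --> 0^'] --> (l : (C R)^o).
  by move: df => /cvg_ex[l' hl]; rewrite -dv /derive (cvg_lim _ hl).
have ce0 : (0 : C R) < cr e by rewrite (_ : (_ < _) = ((cr 0 : R[i]) < cr e))// ltcR.
move=> /cvgrPdist_le/(_ _ ce0); rewrite near_withinE => /nbhs_cmod[r r0 hr].
exists r => // h hh; have [->|h0] := eqVneq h 0.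
  by rewrite addr0 subrr mulr0 subr0 cmod0 mulr0.
have := hr h; rewrite subr0 => /(_ hh h0); rewrite nle.
rewrite -(ler_pM2r (_ : 0 < cmod h)) ?cmod_gt0// -cmodM.
congr (_ <= _); rewrite cmodB; congr cmod.
rewrite /= /shift [h *: _]mulr1 [h + z]addrC /GRing.scale /=; field; exact: h0.
Qed.

Lemma cdiffM F G z (l m : C R) : cdiff F z l -> cdiff G z m ->
  cdiff (fun w => F w * G w) z (l * G z + F z * m).
Proof.
move=> /cdiffP h1 /cdiffP h2; apply/cdiffP.
have := is_deriveM h1 h2; rewrite /GRing.scale /= => h.
by apply: (is_derive_eq h); ring.
Qed.

Lemma cdiff_invsub z a : z != a -> cdiff (fun w => (w - a)^-1) z (- (z - a)^-1 ^+ 2).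
Proof.
move=> za e e0; set c := z - a.
have c0 : c != 0 by rewrite subr_eq0.
have m0 : 0 < cmod c by rewrite cmod_gt0.
exists (Num.min (cmod c / 2) (e * cmod c ^+ 3 / 2)).
  by rewrite lt_min divr_gt0//= divr_gt0// mulr_gt0// exprn_gt0.
move=> h; rewrite lt_min => /andP[h1 h2].
have chm : cmod c / 2 <= cmod (c + h).
  by have := cmod_sub c (- h); rewrite opprK cmodN; lra.
have ch0 : c + h != 0 by rewrite -cmod_gt0; apply: lt_le_trans chm; rewrite divr_gt0.
have -> : (z + h - a)^-1 - c^-1 - - c^-1 ^+ 2 * h = (h / (c ^+ 2 * (c + h))) * h.
  have -> : z + h - a = c + h by rewrite /c; ring.
  by field; rewrite ch0 c0.
rewrite cmodM ler_wpM2r ?cmod_ge0// cmodM cmodV ler_pdivrMr; last first.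
  by rewrite cmod_gt0 mulf_neq0// expf_neq0.
apply: (le_trans (ltW h2)).
have -> : e * cmod c ^+ 3 / 2 = e * (cmod c ^+ 2 * (cmod c / 2)) by ring.
rewrite cmodM cmodX; apply: ler_wpM2l; first exact: ltW.
by apply: ler_wpM2l => //; rewrite exprn_ge0// ltW.
Qed.

Lemma cdiff_near F G z l : (exists2 d : R, 0 < d & forall w, cmod (w - z) < d -> F w = G w) ->
  cdiff F z l -> cdiff G z l.
Proof.
move=> [d d0 h] H e e0; have [r r0 hr] := H e e0; exists (Num.min d r); first by rewrite lt_min d0.
move=> k; rewrite lt_min => /andP[kd kr]; rewrite -!h ?subrr ?cmod0//; first exact: hr.
by rewrite [z + k]addrC addrK.
Qed.

Definition ci : C R := Complex 0 1.

Definition circ t : C R := Complex (cos (2 * pi * t)) (sin (2 * pi * t)).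

Lemma cmod_circ t : cmod (circ t) = 1.
Proof. by rewrite cmodE /= cos2Dsin2 sqrtr1. Qed.

Lemma circ_neq0 t : circ t != 0.
Proof. by rewrite -cmod_gt0 cmod_circ. Qed.

Lemma circ01 : circ 1 = circ 0.
Proof.
rewrite /circ mulr1 mulr0 cos0 sin0 [2 * pi]mulr_natl; congr Complex; last exact: sin2pi.
exact: cos2pi.
Qed.

Lemma cder_circ t : cder circ t (cr (2 * pi) * ci * circ t).
Proof.
have hl : is_derive t 1 (fun s : R => 2 * pi * s) (2 * pi).
  have := is_deriveZ (2 * pi : R) (is_derive_id t (1 : R)).
  by rewrite /GRing.scale /= mulr1.
split; rewrite /circ /ci ?cE /=.
  have := is_derive1_comp (is_derive_cos (2 * pi * t)) hl.
  by move=> h; apply: (is_derive_eq h); ring.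
have := is_derive1_comp (is_derive_sin (2 * pi * t)) hl.
by move=> h; apply: (is_derive_eq h); ring.
Qed.

Lemma cder_circle z (c : C R) t :
  cder (fun t => z + c * circ t) t (c * (cr (2 * pi) * ci * circ t)).
Proof.
apply: (@cder_eq _ _ _ (0 + (0 * circ t + c * (cr (2 * pi) * ci * circ t)))).
  by apply: cderD; [exact: cder_cst|apply: cderM; [exact: cder_cst|exact: cder_circ]].
by rewrite mul0r !add0r.
Qed.

Lemma circ_ccont t : ccont circ t.
Proof. exact: cder_ccont (cder_circ t). Qed.

Lemma circ_lip s t : cmod (circ s - circ t) <= 4 * pi * `|s - t|.
Proof.
have pi0 : 0 <= 2 * pi :> R by rewrite mulr_ge0 ?pi_ge0.
wlog st : s t / t <= s.
  move=> h; have [/h//|/ltW/h] := leP t s.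
  by rewrite cmodB distrC.
have cc x : ccont (fun t => cr (2 * pi) * ci * circ t) x.
  by apply: ccontM; [exact: ccont_cst | exact: circ_ccont].
have <- := @cint_FTC R t s _ circ st (fun x _ => cc x) (fun x _ => cder_circ x).
rewrite ger0_norm ?subr_ge0//.
apply: le_trans (cint_bound st (fun x _ => cc x) (M := 2 * pi) _) _.
  move=> x _; rewrite !cmodM cmod_cr cmod_circ mulr1 ger0_norm//.
  by rewrite cmodE /= expr0n expr1n add0r sqrtr1 mulr1.
by rewrite ler_wpM2r ?subr_ge0//; lra.
Qed.

Lemma ccont_bounded (c : R -> C R) : ccont_on 0 1 c ->
  exists2 M : R, 0 <= M & forall t, 0 <= t <= 1 -> cmod (c t) <= M.
Proof.
have main (f : R -> R) : (forall t, 0 <= t <= 1 -> continuous_at t f) ->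
    exists2 M : R, 0 <= M & forall t, 0 <= t <= 1 -> `|f t| <= M.
  move=> h; have := @EVT_max R (fun t => `|f t|) 0 1 ler01.
  have hc : {within `[0, 1], continuous (fun t => `|f t|)}.
    apply: within_segment_continuous => t /h ht; apply: continuous_comp => //; exact: norm_continuous.
  move=> /(_ hc)[x x01 hx]; exists `|f x| => // t t01; apply: hx.
move=> h; have [M1 M10 h1] := main _ (cont_re h); have [M2 M20 h2] := main _ (cont_im h).
exists (M1 + M2); first by rewrite addr_ge0.
by move=> t ht; apply: le_trans (cmod_le _) _; rewrite lerD ?h1 ?h2.
Qed.

Section Disc.
Variables (F dF : C R -> C R) (a : C R) (rho r : R).
Hypothesis r_gt0 : 0 < r.
Hypothesis r_rho : r < rho.
Hypothesis F_diff : forall z, cmod (z - a) < rho -> cdiff F z (dF z).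

Let gam t := a + cr r * circ t.

Let gam_a t : cmod (gam t - a) = r.
Proof. by rewrite /gam addrC addKr cmodM cmod_circ mulr1 cmod_cr gtr0_norm. Qed.

Let gamz z t : r - cmod (z - a) <= cmod (gam t - z).
Proof.
have := cmod_sub (gam t - a) (z - a); rewrite gam_a.
by rewrite opprB addrA subrK.
Qed.

Let ker t := F (gam t) * (cr r * circ t).

Let ker_cont : ccont_on 0 1 ker.
Proof.
move=> t _; have hg := cder_circle a (cr r) t; apply: ccontM.
  have hF : cdiff F (gam t) (dF (gam t)) by apply: F_diff; rewrite gam_a.
  exact: cder_ccont (cdiff_cder hF hg).
by apply: ccontM; [exact: ccont_cst | exact: circ_ccont].
Qed.

(* With w = gam t, Kn n z is (2 i pi)^-1 times the integral of F w (w - z)^-n dw over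
   the circle. *)
Let Kn n z := cint 0 1 (fun t => ker t * (gam t - z)^-1 ^+ n).

Let q_cont z t : cmod (z - a) < r -> ccont (fun t => (gam t - z)^-1) t.
Proof.
move=> hz.
have hg := cder_circle a (cr r) t.
have n0 : gam t - z != 0.
  by rewrite -cmod_gt0; apply: lt_le_trans (gamz z t); rewrite subr_gt0.
have hq := @cdiff_invsub (gam t) z (_ : gam t != z).
rewrite subr_eq0 in n0.
exact: cder_ccont (cdiff_cder (hq n0) hg).
Qed.

Let qn_cont z n : cmod (z - a) < r -> ccont_on 0 1 (fun t => ker t * (gam t - z)^-1 ^+ n).
Proof.
move=> hz t ht; apply: ccontM; first exact: ker_cont.
elim: n => [|n ih]; first by under eq_fun do rewrite expr0; exact: ccont_cst.
by under eq_fun do rewrite exprS; apply: ccontM => //; exact: q_cont.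
Qed.

Let circle_cont z (e : R) : 0 < e -> e <= r - cmod (z - a) ->
  ccont_on 0 1 (fun t => F (z + cr e * circ t)).
Proof.
move=> e0 er t _; have hg := cder_circle z (cr e) t.
have hF : cdiff F (z + cr e * circ t) (dF (z + cr e * circ t)).
  apply: F_diff; apply: le_lt_trans r_rho.
  have -> : z + cr e * circ t - a = (z - a) + cr e * circ t by ring.
  by apply: le_trans (cmodD _ _) _; rewrite cmodM cmod_circ cmod_cr gtr0_norm; lra.
exact: cder_ccont (cdiff_cder (c := fun t => z + cr e * circ t) hF hg).
Qed.

(* The circle gam is joined to a small circle around z by circles whose centre moves
   linearly from z to a while the radius grows from e to r; none of them meets z. *)
Let small_circle z (e : R) : cmod (z - a) < r -> 0 < e -> e <= r - cmod (z - a) ->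
  Kn 1 z = cint 0 1 (fun t => F (z + cr e * circ t)).
Proof.
move=> hz e0 er.
have za0 := cmod_ge0 (z - a).
pose E s t := z + cr s * (a - z) + (cr e + cr s * cr (r - e)) * circ t.
pose Es (s t : R) := (a - z) + cr (r - e) * circ t.
pose Et s t := (cr e + cr s * cr (r - e)) * (cr (2 * pi) * ci * circ t).
have radE s : cr e + cr s * cr (r - e) = cr ((1 - s) * e + s * r).
  by rewrite -crM -crD; congr cr; ring.
have rad_bound s : 0 <= s <= 1 -> e <= (1 - s) * e + s * r <= r by move=> hs; apply/andP; split; nra.
have radM s : 0 <= s <= 1 -> cmod (cr e + cr s * cr (r - e)) = (1 - s) * e + s * r.
  by move=> /rad_bound hs; rewrite radE cmod_cr ger0_norm//; lra.
have E_dist s t : 0 <= s <= 1 -> cmod (E s t - a) <= r /\ e <= cmod (E s t - z).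
  move=> hs; have h1 := radM s hs; have /andP[s0 s1] := hs; split.
    have -> : E s t - a = cr (1 - s) * (z - a) + (cr e + cr s * cr (r - e)) * circ t.
      by rewrite /E [cr (1 - s)]crD crN cr1; ring.
    apply: le_trans (cmodD _ _) _; rewrite !cmodM h1 cmod_circ cmod_cr ger0_norm; last lra.
    by nra.
  have -> : E s t - z = (cr e + cr s * cr (r - e)) * circ t - cr s * (z - a).
    by rewrite /E; ring.
  apply: le_trans (cmod_sub _ _); rewrite !cmodM h1 cmod_circ cmod_cr ger0_norm//.
  by nra.
pose H w := F w * (w - z)^-1.
pose dH w := dF w * (w - z)^-1 + F w * - (w - z)^-1 ^+ 2.
have I1 : cmod (cr (2 * pi) * ci) = 2 * pi.
  rewrite cmodM cmod_cr ger0_norm ?mulr_ge0 ?pi_ge0//.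
  by rewrite cmodE /= expr0n expr1n add0r sqrtr1 mulr1.
pose K := 2 * r + 4 * pi * r.
have pi0 : 0 < pi :> R := pi_gt0 R.
have rpi : 0 < pi * r by rewrite mulr_gt0.
have := @goursat R E Es Et K H dH.
have K0 : 0 <= K by rewrite /K; lra.
have E_s s t : cder (E^~ t) s (Es s t).
  apply: (@cder_eq _ _ _ ((0 + (1 * (a - z) + cr s * 0)) +
      ((0 + (1 * cr (r - e) + cr s * 0)) * circ t + (cr e + cr s * cr (r - e)) * 0))).
    apply: cderD; [apply: cderD; [exact: cder_cst|]|].
      by apply: cderM; [exact: cder_cr|exact: cder_cst].
    apply: cderM; last exact: cder_cst.
    apply: cderD; first exact: cder_cst.
    by apply: cderM; [exact: cder_cr|exact: cder_cst].
  by rewrite /Es; ring.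
have E_t s t : cder (E s) t (Et s t) by exact: cder_circle.
move=> /(_ K0 E_s E_t).
have c1 s t : ccont (Es^~ t) s by exact: ccont_cst.
have c2 s t : ccont (Et s) t.
  by do 2 (apply: ccontM; first exact: ccont_cst); exact: circ_ccont.
have b1 s t : 0 <= s <= 1 -> 0 <= t <= 1 -> cmod (Es s t) <= K.
  move=> _ _; apply: le_trans (cmodD _ _) _.
  by rewrite (cmodB a z) cmodM cmod_circ mulr1 cmod_cr ger0_norm /K; lra.
have b2 s t : 0 <= s <= 1 -> 0 <= t <= 1 -> cmod (Et s t) <= K.
  move=> hs _; rewrite /Et 2!cmodM I1 cmod_circ mulr1 radM// /K.
  by have := rad_bound s hs; nra.
have b3 s t s' t' : 0 <= s <= 1 -> 0 <= t <= 1 -> 0 <= s' <= 1 -> 0 <= t' <= 1 ->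
    cmod (E s t - E s' t') <= K * (`|s - s'| + `|t - t'|).
  move=> hs ht hs' ht'.
  have -> : E s t - E s' t' = cr (s - s') * Es s t + (cr e + cr s' * cr (r - e)) * (circ t - circ t').
    by rewrite /E /Es [cr (s - s')]crD crN; ring.
  apply: le_trans (cmodD _ _) _; rewrite !cmodM radM// cmod_cr mulrDr lerD//.
    by rewrite mulrC ler_wpM2r// b1.
  have L := circ_lip t t'; have rb := rad_bound s' hs'.
  apply: (@le_trans _ _ (r * (4 * pi * `|t - t'|))).
    by apply: ler_pM => //; [lra|exact: cmod_ge0|lra].
  by rewrite mulrA ler_wpM2r// /K; nra.
have hd s t : 0 <= s <= 1 -> 0 <= t <= 1 -> cdiff H (E s t) (dH (E s t)).
  move=> hs _; have [h1 h2] := E_dist s t hs.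
  apply: cdiffM; first by apply: F_diff; exact: le_lt_trans h1 r_rho.
  by apply: cdiff_invsub; rewrite -subr_eq0 -cmod_gt0; exact: lt_le_trans h2.
move=> /(_ c1 c2 b1 b2 b3 hd).
have -> : cint 0 1 (fun s => H (E s 1) * Es s 1) = cint 0 1 (fun s => H (E s 0) * Es s 0).
  by apply: eq_cint => s _; rewrite /E /Es circ01.
rewrite addrK => /eqP; rewrite subr_eq0 => /eqP.
pose c := cr (2 * pi) * ci : C R.
have -> : cint 0 1 (fun t => H (E 1 t) * Et 1 t) = c * Kn 1 z.
  rewrite -cintZ; last exact: qn_cont.
  apply: eq_cint => t _; rewrite /H /Et /ker /E expr1 /c.
  have -> : z + cr 1 * (a - z) + (cr e + cr 1 * cr (r - e)) * circ t = gam t.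
    by rewrite radE subrr mul0r add0r mul1r cr1 /gam; ring.
  by rewrite radE subrr mul0r add0r mul1r; ring.
have zc := circle_cont e0 er.
have -> : cint 0 1 (fun t => H (E 0 t) * Et 0 t) = c * cint 0 1 (fun t => F (z + cr e * circ t)).
  rewrite -cintZ//; apply: eq_cint => t _; rewrite /H /Et /E /c cr0 !mul0r !addr0.
  rewrite [z + _]addrC addrK; field.
  by rewrite circ_neq0 -cmod_gt0 cmod_cr normr_gt0 gt_eqF.
move/mulfI; apply; rewrite -cmod_gt0 /c I1; lra.
Qed.

(** The mean of [F] over the circle of radius [e] around [z] tends to [F z]. *)
Lemma cauchy_formula z : cmod (z - a) < r -> F z = Kn 1 z.
Proof.
move=> hz; apply/eqP; rewrite eq_sym -subr_eq0 -cmod_eq0; apply/eqP/le_anti; rewrite cmod_ge0 andbT.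
apply/ler_addgt0Pl => x x0; rewrite addr0.
have hF : cdiff F z (dF z) by apply: F_diff; exact: lt_trans hz r_rho.
have /nbhs_cmod[d d0 hd] : nbhs z [set w | cmod (F w - F z) < x / 2].
  have cF : F @ z --> F z := cdiff_continuous hF.
  apply: (cF [set w | cmod (w - F z) < x / 2]).
  by apply/nbhs_cmod; exists (x / 2) => //; rewrite divr_gt0.
pose e := Num.min (d / 2) (r - cmod (z - a)).
have e0 : 0 < e by rewrite lt_min divr_gt0//= subr_gt0.
have ed : e < d by rewrite gt_min; apply/orP; left; lra.
have er : e <= r - cmod (z - a) by rewrite ge_min lexx orbT.
rewrite (small_circle hz e0 er).
have zc := circle_cont e0 er.
have -> : F z = cint 0 1 (fun=> F z).
  rewrite (@cint_FTC _ _ _ _ (fun t => cr t * F z))//.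
  - by rewrite cr0 mul0r subr0 cr1 mul1r.
  - by move=> t _; exact: ccont_cst.
  - move=> t _; apply: (@cder_eq _ _ _ (1 * F z + cr t * 0)); last by ring.
    by apply: cderM; [exact: cder_cr|exact: cder_cst].
have -> : forall u v : C R, u - v = u + (-1) * v by move=> u v; rewrite mulN1r.
rewrite -cintZ; last by move=> t _; exact: ccont_cst.
rewrite -cintD//; last by move=> t _; apply: ccont_cst.
have -> : x = 2 * (x / 2) * (1 - 0) by rewrite subr0 mulr1; field.
apply: cint_bound => //.
  by move=> t ht; apply: ccontD; [exact: zc|exact: ccont_cst].
move=> t _; rewrite mulN1r; apply: ltW; apply: hd.
by rewrite [z + _]addrC addrK cmodM cmod_circ mulr1 cmod_cr gtr0_norm.
Qed.

(* the factor 1 / 2 leaves room for the perturbed point on the same side of the circle *)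
Let room z (h : C R) t : cmod h < (r - cmod (z - a)) / 2 ->
  let m := (r - cmod (z - a)) / 2 in
  m <= cmod (gam t - z) /\ m <= cmod (gam t - (z + h)).
Proof.
move=> hh /=; have h1 := gamz z t; have := cmod_sub (gam t - z) h.
by rewrite opprD addrA; have := cmod_ge0 h; split; lra.
Qed.

Let qle z t (m : R) : 0 < m -> m <= cmod (gam t - z) -> gam t - z != 0 /\ cmod (gam t - z)^-1 <= m^-1.
Proof.
move=> m0 h; have h0 := lt_le_trans m0 h; split; first by rewrite -cmod_gt0.
by rewrite cmodV lef_pV2.
Qed.

(* Differentiation under the integral sign: the kernels (w - z)^-n have a quadratic
   remainder that is uniform in t. *)
Let Kn_diff n z (l : C R) (B : R) : cmod (z - a) < r ->
  (forall (h : C R) t, cmod h < (r - cmod (z - a)) / 2 -> 0 <= t <= 1 ->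
     let q := (gam t - z)^-1 in let q' := (gam t - (z + h))^-1 in
     cmod (q' ^+ n - q ^+ n - l * q ^+ n.+1 * h) <= B * cmod h ^+ 2) -> 0 <= B ->
  cdiff (Kn n) z (l * Kn n.+1 z).
Proof.
move=> hz H B0 e e0; have [M M0 hM] := ccont_bounded ker_cont.
have MB : 0 < 2 * (M * B) + 1 by have := mulr_ge0 M0 B0; lra.
exists (Num.min ((r - cmod (z - a)) / 2) (e / (2 * (M * B) + 1))).
  by rewrite lt_min !divr_gt0// subr_gt0.
move=> h; rewrite lt_min => /andP[h1 h2].
have hzh : cmod (z + h - a) < r.
  have -> : z + h - a = (z - a) + h by ring.
  by apply: le_lt_trans (cmodD _ _) _; lra.
have c1 := qn_cont n hzh; have c2 := qn_cont n hz; have c3 := qn_cont n.+1 hz.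
have -> : Kn n (z + h) - Kn n z - l * Kn n.+1 z * h =
   cint 0 1 (fun t => ker t * (gam t - (z + h))^-1 ^+ n + ((-1) * (ker t * (gam t - z)^-1 ^+ n)
       + (- (l * h)) * (ker t * (gam t - z)^-1 ^+ n.+1))).
  rewrite cintD//; last first.
    by move=> t ht; apply: ccontD; apply: ccontM; [exact: ccont_cst|exact: c2|exact: ccont_cst|exact: c3].
  rewrite cintD; last first.
  - by move=> t ht; apply: ccontM; [exact: ccont_cst|exact: c3].
  - by move=> t ht; apply: ccontM; [exact: ccont_cst|exact: c2].
  rewrite (@cintZ _ _ _ (-1) _ c2) (@cintZ _ _ _ (- (l * h)) _ c3) /Kn.
  set k1 := cint _ _ _; set k2 := cint _ _ _; set k3 := cint _ _ _; ring.
have hb : cmod (cint 0 1 (fun t => ker t * (gam t - (z + h))^-1 ^+ n + ((-1) * (ker t * (gam t - z)^-1 ^+ n)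
       + (- (l * h)) * (ker t * (gam t - z)^-1 ^+ n.+1)))) <= 2 * (M * (B * cmod h ^+ 2)) * (1 - 0).
  apply: cint_bound => //.
    move=> t ht; apply: ccontD; first exact: c1.
    by apply: ccontD; apply: ccontM; [exact: ccont_cst|exact: c2|exact: ccont_cst|exact: c3].
  move=> t ht; have := H h t h1 ht => /= Ht.
  rewrite (_ : _ + _ = ker t * ((gam t - (z + h))^-1 ^+ n - (gam t - z)^-1 ^+ n - l * (gam t - z)^-1 ^+ n.+1 * h)); last by ring.
  by rewrite cmodM ler_pM ?cmod_ge0 ?hM.
apply: (le_trans hb); rewrite subr0 mulr1.
have -> : 2 * (M * (B * cmod h ^+ 2)) = (2 * (M * B) * cmod h) * cmod h by ring.
rewrite ler_wpM2r ?cmod_ge0//; move: h2; rewrite ltr_pdivlMr//.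
by have := cmod_ge0 h; nra.
Qed.

Let K1_diff z : cmod (z - a) < r -> cdiff (Kn 1) z (Kn 2 z).
Proof.
move=> hz; set m := (r - cmod (z - a)) / 2.
have m0 : 0 < m by rewrite divr_gt0// subr_gt0.
have mi : 0 <= m^-1 by rewrite invr_ge0 ltW.
rewrite -[Kn 2 z]mul1r; apply: (@Kn_diff 1 z 1 (m^-1 ^+ 3)) => //; last by rewrite exprn_ge0.
move=> h t hh ht /=; have [r1 r2] := room t hh.
have [n1 q1] := qle m0 r1; have [n2 q2] := qle m0 r2.
have -> : (gam t - (z + h))^-1 ^+ 1 - (gam t - z)^-1 ^+ 1 - 1 * (gam t - z)^-1 ^+ 2 * h
   = ((gam t - z)^-1 * (gam t - z)^-1 * (gam t - (z + h))^-1) * h ^+ 2.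
  by field; rewrite n1 n2.
rewrite cmodM cmodX ler_wpM2r ?sqr_ge0// !cmodM 2!exprSr expr1.
by do 2 (apply: ler_pM; rewrite ?mulr_ge0 ?cmod_ge0//).
Qed.

Let K2_diff z : cmod (z - a) < r -> cdiff (Kn 2) z (2 * Kn 3 z).
Proof.
move=> hz; set m := (r - cmod (z - a)) / 2.
have m0 : 0 < m by rewrite divr_gt0// subr_gt0.
have mi : 0 <= m^-1 by rewrite invr_ge0 ltW.
apply: (@Kn_diff 2 z 2 (3 * m^-1 ^+ 4)) => //; last by rewrite mulr_ge0// exprn_ge0.
move=> h t hh ht /=; have [r1 r2] := room t hh.
have [n1 q1] := qle m0 r1; have [n2 q2] := qle m0 r2.
have -> : (gam t - (z + h))^-1 ^+ 2 - (gam t - z)^-1 ^+ 2 - 2 * (gam t - z)^-1 ^+ 3 * h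
   = ((gam t - (z + h))^-1 + (gam t - z)^-1 + (gam t - z)^-1) *
     ((gam t - z)^-1 * (gam t - z)^-1 * (gam t - (z + h))^-1) * h ^+ 2.
  by field; rewrite n1 n2.
rewrite cmodM cmodX ler_wpM2r ?sqr_ge0// cmodM.
have -> : 3 * m^-1 ^+ 4 = (m^-1 + m^-1 + m^-1) * (m^-1 * m^-1 * m^-1) by ring.
apply: ler_pM; rewrite ?cmod_ge0//.
  by apply: le_trans (cmodD _ _) (lerD (le_trans (cmodD _ _) (lerD _ _)) _).
rewrite !cmodM.
by do 2 (apply: ler_pM; rewrite ?mulr_ge0 ?cmod_ge0//).
Qed.

(** On the disc [F] is [Kn 1], hence [dF] is [Kn 2], which is differentiable. *)
Lemma derivative_diff z : cmod (z - a) < r -> exists l, cdiff dF z l.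
Proof.
move=> hz; exists (2 * Kn 3 z).
have near : exists2 d : R, 0 < d & forall w, cmod (w - z) < d -> cmod (w - a) < r.
  exists (r - cmod (z - a)); first by rewrite subr_gt0.
  by move=> w hw; have := cmodD (w - z) (z - a); rewrite addrA subrK; lra.
apply: cdiff_near (K2_diff hz); have [d d0 hd] := near; exists d => // w /hd hw.
have h1 : cdiff F w (dF w) by apply: F_diff; exact: lt_trans hw r_rho.
apply: cdiff_uniq h1; apply: cdiff_near (K1_diff hw).
exists (r - cmod (w - a)); first by rewrite subr_gt0.
move=> v hv; rewrite -cauchy_formula//.
by have := cmodD (v - w) (w - a); rewrite addrA subrK; lra.
Qed.

End Disc.

End Cauchy.

(** * Functions of class C^2 on the plane and Green's identity *)

Section Plane.
Variable R : realType.
Local Notation mu := (@lebesgue_measure R).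
Local Notation mu2 := (mu \x mu)%E.
Local Notation T := (R * R)%type.
Implicit Types (f g : T -> R) (p : T).

(** An open set of the plane is a countable union of rational boxes, which relates
    the product topology to the product sigma-algebra. *)
Lemma measurable_open (A : set T) : open A ->
  measurable (A : set (measurableTypeR R * measurableTypeR R)).
Proof.
move=> oA.
pose B (q : (rat * rat) * (rat * rat)) : set T :=
  [set p | (ratr q.1.1 < p.1 < ratr q.1.2) && (ratr q.2.1 < p.2 < ratr q.2.2)].
have -> : A = \bigcup_(q in [set q | B q `<=` A]) B q.
  apply/seteqP; split => [p Ap|p [q /= h] /h//].
  have [/= [U V] /= [nU nV] UV] : nbhs p A by move: oA; rewrite openE => /(_ _ Ap).
  have box (a : R) (W : set R) : nbhs a W -> exists q : rat * rat,
      ratr q.1 < a < ratr q.2 /\ forall x, ratr q.1 < x < ratr q.2 -> W x.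
    move=> /nbhs_ballP[e /= e0 hW].
    have [q1 h1] : exists q : rat, ratr q \in `]a - e, a[%R by apply: rat_in_itvoo; rewrite ltrBlDr ltrDl.
    have [q2 h2] : exists q : rat, ratr q \in `]a, a + e[%R by apply: rat_in_itvoo; rewrite ltrDl.
    move: h1 h2; rewrite !in_itv /= => /andP[h1 h2] /andP[h3 h4].
    exists (q1, q2) => /=; split; first by rewrite h2 h3.
    by move=> x /andP[h5 h6]; apply: hW; rewrite /ball /= ltr_norml; lra.
  have [q1 [h1 H1]] := box _ _ nU; have [q2 [h2 H2]] := box _ _ nV.
  exists (q1, q2); last by rewrite /B /= h1 h2.
  by move=> [x y] /= /andP[/H1 h3 /H2 h4]; apply: UV.
rewrite bigcup_mkcond; apply: countable_bigcupT_measurable => [|q].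
  exact: countableP.
case: ifP => // _.
have -> : B q = `]ratr q.1.1, ratr q.1.2[%classic `*` `]ratr q.2.1, ratr q.2.2[%classic.
  by apply/seteqP; split => [[x y]|[x y]] /=; rewrite /B /= !in_itv /= => /andP.
by apply: measurableX; exact: measurable_itv.
Qed.

Lemma continuous_measurable2 f : continuous f ->
  measurable_fun [set: measurableTypeR R * measurableTypeR R] f.
Proof.
move=> cf; apply: (measurability _ (RGenOpens.measurableE R)).
move=> _ [_ [a [b ->] <-]]; rewrite setTI; apply: measurable_open.
by move/continuousP : cf => /(_ _ (interval_open _ _)); apply.
Qed.

(** A function bundled with its pure partial derivatives of order 1 and 2: the
    Laplacian involves no mixed derivative. *)
Record jet := Jet { j0 : T -> R ; jx : T -> R ; jy : T -> R ; jxx : T -> R ; jyy : T -> R }.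

Record isC2 (f : jet) : Prop := {
  c0 : continuous (j0 f) ; cx : continuous (jx f) ; cy : continuous (jy f) ;
  cxx : continuous (jxx f) ; cyy : continuous (jyy f) ;
  dx : forall x y : R, is_derive x 1 (fun s => j0 f (s, y)) (jx f (x, y)) ;
  dy : forall x y : R, is_derive y 1 (fun s => j0 f (x, s)) (jy f (x, y)) ;
  dxx : forall x y : R, is_derive x 1 (fun s => jx f (s, y)) (jxx f (x, y)) ;
  dyy : forall x y : R, is_derive y 1 (fun s => jy f (x, s)) (jyy f (x, y)) }.

Definition lap (f : jet) p := jxx f p + jyy f p.
Definition grad2 (f : jet) p := jx f p ^+ 2 + jy f p ^+ 2.

Definition jmul (f g : jet) := Jet
  (fun p => j0 f p * j0 g p)
  (fun p => jx f p * j0 g p + j0 f p * jx g p)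
  (fun p => jy f p * j0 g p + j0 f p * jy g p)
  (fun p => jxx f p * j0 g p + 2 * (jx f p * jx g p) + j0 f p * jxx g p)
  (fun p => jyy f p * j0 g p + 2 * (jy f p * jy g p) + j0 f p * jyy g p).

Definition jcomp (a a1 a2 : R -> R) (f : jet) := Jet
  (fun p => a (j0 f p))
  (fun p => a1 (j0 f p) * jx f p)
  (fun p => a1 (j0 f p) * jy f p)
  (fun p => a2 (j0 f p) * jx f p ^+ 2 + a1 (j0 f p) * jxx f p)
  (fun p => a2 (j0 f p) * jy f p ^+ 2 + a1 (j0 f p) * jyy f p).

Lemma contM f g : continuous f -> continuous g -> continuous (fun p => f p * g p).
Proof. by move=> cf cg p; exact: (cvgM (cf p) (cg p)). Qed.

Lemma contD f g : continuous f -> continuous g -> continuous (fun p => f p + g p).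
Proof. by move=> cf cg p; exact: (cvgD (cf p) (cg p)). Qed.

Lemma contB f g : continuous f -> continuous g -> continuous (fun p => f p - g p).
Proof. by move=> cf cg p; exact: (cvgB (cf p) (cg p)). Qed.

Lemma contC (k : R) : continuous (fun _ : T => k).
Proof. exact: cst_continuous. Qed.

Lemma contX f n : continuous f -> continuous (fun p => f p ^+ n).
Proof.
move=> cf; elim: n => [|n ih]; first exact: contC.
by rewrite (_ : (fun p => f p ^+ n.+1) = (fun p => f p * f p ^+ n));
  [exact: contM | apply: funext => p; rewrite exprS].
Qed.

Lemma isC2_mul (f g : jet) : isC2 f -> isC2 g -> isC2 (jmul f g).
Proof.
move=> F G; split => /=.
- by apply: contM; exact: c0.
- by apply: contD; apply: contM; [exact: cx|exact: c0|exact: c0|exact: cx].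
- by apply: contD; apply: contM; [exact: cy|exact: c0|exact: c0|exact: cy].
- apply: contD; [apply: contD|]; [|apply: contM; [exact: contC|]|]; apply: contM;
    [exact: cxx|exact: c0|exact: cx|exact: cx|exact: c0|exact: cxx].
- apply: contD; [apply: contD|]; [|apply: contM; [exact: contC|]|]; apply: contM;
    [exact: cyy|exact: c0|exact: cy|exact: cy|exact: c0|exact: cyy].
- move=> x y; have h1 := dx F x y; have h2 := dx G x y.
  by apply: is_derive_eq; rewrite /GRing.scale /=; ring.
- move=> x y; have h1 := dy F x y; have h2 := dy G x y.
  by apply: is_derive_eq; rewrite /GRing.scale /=; ring.
- move=> x y; have h1 := dx F x y; have h2 := dx G x y; have h3 := dxx F x y; have h4 := dxx G x y.
  by apply: is_derive_eq; rewrite /GRing.scale /=; ring.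
- move=> x y; have h1 := dy F x y; have h2 := dy G x y; have h3 := dyy F x y; have h4 := dyy G x y.
  by apply: is_derive_eq; rewrite /GRing.scale /=; ring.
Qed.

Lemma isC2_comp (a a1 a2 : R -> R) (f : jet) : isC2 f ->
  (forall p, is_derive (j0 f p) 1 a (a1 (j0 f p))) ->
  (forall p, is_derive (j0 f p) 1 a1 (a2 (j0 f p))) ->
  (forall p, continuous_at (j0 f p) a2) ->
  isC2 (jcomp a a1 a2 f).
Proof.
move=> F d1 d2 k2.
have k0 p : continuous_at p (fun p => a (j0 f p)).
  by apply: continuous_comp; [exact: c0|exact: is_derive_continuous (d1 p)].
have k1 : continuous (fun p => a1 (j0 f p)).
  by move=> p; apply: continuous_comp; [exact: c0|exact: is_derive_continuous (d2 p)].
have {}k2 : continuous (fun p => a2 (j0 f p)).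
  by move=> p; apply: continuous_comp; [exact: c0|exact: k2].
split => //=.
- by apply: contM => //; exact: cx.
- by apply: contM => //; exact: cy.
- by apply: contD; apply: contM => //; [apply: contX; exact: cx|exact: cxx].
- by apply: contD; apply: contM => //; [apply: contX; exact: cy|exact: cyy].
- by move=> x y; exact: (@is_derive1_comp _ a _ x _ _ (d1 (x, y)) (dx F x y)).
- by move=> x y; exact: (@is_derive1_comp _ a _ y _ _ (d1 (x, y)) (dy F x y)).
- move=> x y; have h1 := (@is_derive1_comp _ a1 (fun s => j0 f (s, y)) x _ _ (d2 (x, y)) (dx F x y)).
  have h2 := dxx F x y; have h := is_deriveM h1 h2.
  by apply: (is_derive_eq h); rewrite /GRing.scale /=; ring.
- move=> x y; have h1 := (@is_derive1_comp _ a1 (fun s => j0 f (x, s)) y _ _ (d2 (x, y)) (dy F x y)).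
  have h2 := dyy F x y; have h := is_deriveM h1 h2.
  by apply: (is_derive_eq h); rewrite /GRing.scale /=; ring.
Qed.

Definition supported (A : R) f := forall p, A <= `|p.1| \/ A <= `|p.2| -> f p = 0.

Record jet_supported (A : R) (g : jet) : Prop := {
  sup0 : supported A (j0 g) ; supx : supported A (jx g) ; supy : supported A (jy g) ;
  supxx : supported A (jxx g) ; supyy : supported A (jyy g) }.

Lemma supported_integrable (A : R) f : continuous f -> supported A f ->
  mu2.-integrable setT (EFin \o f).
Proof.
move=> cf sf.
pose D := (`[- A, A] `*` `[- A, A])%classic : set (measurableTypeR R * measurableTypeR R).
have mD : measurable D by apply: measurableX; exact: measurable_itv.
have -> : EFin \o f = (EFin \o f) \_ D.
  apply: funext => p; rewrite patchE; case: ifPn => // pD /=; congr EFin; apply: sf.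
  apply: contrapT => /not_orP[/negP h1 /negP h2]; move/negP: pD; apply; rewrite inE /D /=.
  by move: h1 h2; rewrite -!ltNge !ltr_norml !in_itv /= => /andP[/ltW -> /ltW ->] /andP[/ltW -> /ltW ->].
rewrite -integrable_mkcond//; apply: measurable_bounded_integrable => //.
- have muD : mu2 D = (mu `[(- A)%R, A] * mu `[(- A)%R, A])%E.
    by apply: product_measure1E; exact: measurable_itv.
  have l : (mu `[(- A)%R, A] < +oo)%E.
    by rewrite lebesgue_measure_itv /=; case: ifP => // _; rewrite -EFinB ltry.
  have : (mu2 D < +oo)%E by rewrite muD; apply: lte_mul_pinfty => //; rewrite ge0_fin_numE.
  exact.
- by apply: measurable_funTS; exact: continuous_measurable2.
- have : compact (f @` D).
    apply: continuous_compact; first exact: continuous_subspaceT.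
    by apply: compact_setX; exact: segment_compact.
  move=> /compact_bounded[M [Mr hM]]; exists M; split => // x Mx p Dp.
  by apply: (hM x Mx); exists p.
Qed.

(** [(g f1 - f g1)' = g f2 - f g2]. *)
Lemma green_slice (A : R) (f f1 f2 g g1 g2 : R -> R) : 0 < A ->
  (forall x : R, is_derive x 1 f (f1 x)) -> (forall x : R, is_derive x 1 f1 (f2 x)) ->
  (forall x : R, is_derive x 1 g (g1 x)) -> (forall x : R, is_derive x 1 g1 (g2 x)) ->
  continuous f2 -> continuous g2 ->
  (forall x : R, A <= `|x| -> g x = 0) -> (forall x : R, A <= `|x| -> g1 x = 0) -> (forall x : R, A <= `|x| -> g2 x = 0) ->
  (\int[mu]_x (g x * f2 x - f x * g2 x)%:E = 0)%E.
Proof.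
move=> A0 df df1 dg dg1 cf2 cg2 sg sg1 sg2.
have dc (b : R -> R) (b1 : R -> R) : (forall x : R, is_derive x 1 b (b1 x)) -> continuous b.
  by move=> h x; exact: is_derive_continuous (h x).
have AA : - A < A by rewrite -subr_gt0 opprK addr_gt0.
transitivity (\int[mu]_(x in `[(- A)%R, A]) (g x * f2 x - f x * g2 x)%:E)%E.
  rewrite [RHS]integral_mkcond; apply: eq_integral => x _; rewrite patchE; case: ifPn => // xA.
  have Ax : A <= `|x|.
    rewrite leNgt; apply: contra xA; rewrite inE /= in_itv /= ltr_norml => /andP[h1 h2].
    by rewrite !ltW.
  by rewrite sg// sg2// mul0r mulr0 subr0.
pose P x := g x * f1 x - f x * g1 x.
have dP (x : R) : is_derive x 1 P (g x * f2 x - f x * g2 x).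
  have h1 := df x; have h2 := df1 x; have h3 := dg x; have h4 := dg1 x.
  by apply: is_derive_eq; rewrite /GRing.scale /=; ring.
have cP := dc _ _ dP.
have nA : `|A| = A by rewrite gtr0_norm.
rewrite (@continuous_FTC2 _ _ P)//.
- by rewrite /P !sg ?sg1 ?normrN ?nA// !mul0r !mulr0 !subr0 -EFinB subrr.
- apply: continuous_subspaceT => x.
  by apply: (cvgB (cvgM (dc _ _ dg x) (cf2 x)) (cvgM (dc _ _ df x) (cg2 x))).
- split.
  + by move=> x _; apply: (@ex_derive _ _ _ _ _ _ _ (dP x)).
  + by apply: cvg_at_right_filter; exact: cP.
  + by apply: cvg_at_left_filter; exact: cP.
- by move=> x _; rewrite derive1E; apply: (@derive_val _ _ _ _ _ _ _ (dP x)).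
Qed.

Lemma cont_fst f (y : R) : continuous f -> continuous (fun x : R => f (x, y)).
Proof.
by move=> cf x; apply: continuous_comp; [exact: (cvg_pair cvg_id (cvg_cst y))|exact: cf].
Qed.

Lemma cont_snd f (x : R) : continuous f -> continuous (fun y : R => f (x, y)).
Proof.
by move=> cf y; apply: continuous_comp; [exact: (cvg_pair (cvg_cst x) cvg_id)|exact: cf].
Qed.

(** Green's second identity: by Fubini each pure second derivative reduces to the
    one-dimensional identity. *)
Lemma green (A : R) (f g : jet) : 0 < A -> isC2 f -> isC2 g -> jet_supported A g ->
  \int[mu2]_p (j0 g p * lap f p) = \int[mu2]_p (j0 f p * lap g p).
Proof.
move=> A0 F G [s0 sx sy sxx syy].
pose k1 p := j0 g p * jxx f p - j0 f p * jxx g p.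
pose k2 p := j0 g p * jyy f p - j0 f p * jyy g p.
have i1 : mu2.-integrable setT (EFin \o k1).
  apply: (@supported_integrable A).
    by apply: contB; apply: contM; [exact: c0|exact: cxx|exact: c0|exact: cxx].
  by move=> p hp; rewrite /k1 s0// sxx// mul0r mulr0 subr0.
have i2 : mu2.-integrable setT (EFin \o k2).
  apply: (@supported_integrable A).
    by apply: contB; apply: contM; [exact: c0|exact: cyy|exact: c0|exact: cyy].
  by move=> p hp; rewrite /k2 s0// syy// mul0r mulr0 subr0.
have z1 : (\int[mu2]_p (k1 p)%:E = 0)%E.
  rewrite -(integral21_prod_meas1 i1); apply: integral0_eq => y _.
  rewrite /fubini_G /=; apply: (@green_slice A _ (fun x => jx f (x, y)) _ _ (fun x => jx g (x, y))) => //.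
  - by move=> x; exact: dx.
  - by move=> x; exact: dxx.
  - by move=> x; exact: dx.
  - by move=> x; exact: dxx.
  - by apply: cont_fst; exact: cxx.
  - by apply: cont_fst; exact: cxx.
  - by move=> x hx; apply: s0; left.
  - by move=> x hx; apply: sx; left.
  - by move=> x hx; apply: sxx; left.
have z2 : (\int[mu2]_p (k2 p)%:E = 0)%E.
  rewrite -(integral12_prod_meas1 i2); apply: integral0_eq => x _.
  rewrite /fubini_F /=; apply: (@green_slice A _ (fun y => jy f (x, y)) _ _ (fun y => jy g (x, y))) => //.
  - by move=> y; exact: dy.
  - by move=> y; exact: dyy.
  - by move=> y; exact: dy.
  - by move=> y; exact: dyy.
  - by apply: cont_snd; exact: cyy.
  - by apply: cont_snd; exact: cyy.
  - by move=> y hy; apply: s0; right.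
  - by move=> y hy; apply: sy; right.
  - by move=> y hy; apply: syy; right.
have ig : mu2.-integrable setT (EFin \o (fun p => j0 g p * lap f p)).
  apply: (@supported_integrable A); last by move=> p hp; rewrite s0// mul0r.
  by apply: contM; [exact: c0|apply: contD; [exact: cxx|exact: cyy]].
have i_f : mu2.-integrable setT (EFin \o (fun p => j0 f p * lap g p)).
  apply: (@supported_integrable A); last by move=> p hp; rewrite /lap sxx// syy// addr0 mulr0.
  by apply: contM; [exact: c0|apply: contD; [exact: cxx|exact: cyy]].
apply/eqP; rewrite -subr_eq0 -RintegralB//; apply/eqP.
transitivity (\int[mu2]_p (k1 p + k2 p)).
  by apply: eq_Rintegral => p _; rewrite /k1 /k2 /lap; ring.
by rewrite RintegralD// /Rintegral z1 z2 /= addr0.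
Qed.

End Plane.

(** * Test functions *)

Section TestFunctions.
Variable R : realType.
Local Notation T := (R * R)%type.
Implicit Types (p : T) (s : R).

Lemma is_derive_near (f g : R -> R) (t d : R) : (\forall s \near t, f s = g s) ->
  is_derive t 1 f d -> is_derive t 1 g d.
Proof.
move=> /nbhs_normP[r0 /= r00 hr0] /is_derive_epsP H; apply/is_derive_epsP => e e0.
have [r r_0 hr] := H _ e0; exists (Num.min r r0); first by rewrite lt_min r_0.
move=> h; rewrite lt_min => /andP[h1 h2]; rewrite -!hr0 ?hr//=.
  by rewrite subrr normr0.
by rewrite opprD addrA subrr sub0r normrN.
Qed.

Lemma is_derive_pow k s : is_derive s 1 (fun x : R => x ^+ k.+1) (k.+1%:R * s ^+ k).
Proof.
elim: k => [|k ih].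
  by rewrite expr0 mulr1; under eq_fun do rewrite expr1; exact: is_derive_id.
under eq_fun do rewrite exprS.
apply: is_derive_eq; rewrite /GRing.scale /=.
have -> : k.+2%:R = k.+1%:R + 1 :> R by rewrite -natr1.
rewrite !exprS mulr1; set a := k.+1%:R. by ring.
Qed.

(** The truncated power is of class C^(k-1); composed with a C^2 function it gives
    compactly supported C^2 functions. *)
Definition tpow k s : R := Num.max s 0 ^+ k.

Lemma tpow_ge0 k s : 0 <= tpow k s.
Proof. by rewrite exprn_ge0// le_max lexx orbT. Qed.

Lemma tpow0 k s : s <= 0 -> tpow k.+1 s = 0.
Proof. by move=> s0; rewrite /tpow max_r// expr0n. Qed.

Lemma tpow_pos k s : 0 <= s -> tpow k s = s ^+ k.
Proof. by move=> s0; rewrite /tpow max_l. Qed.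

Lemma is_derive_tpow k s : is_derive s 1 (tpow k.+2) (k.+2%:R * tpow k.+1 s).
Proof.
have [s0|s0|->] := ltgtP s 0.
- apply: (@is_derive_near (fun=> 0)); last by rewrite tpow0 ?ltW// mulr0; exact: is_derive_cst.
  by apply: filterS (lt_nbhsl s0) => x x0; rewrite tpow0 ?ltW.
- apply: (@is_derive_near (fun x => x ^+ k.+2)).
    by apply: filterS (lt_nbhsr s0) => x x0; rewrite tpow_pos ?ltW.
  by rewrite tpow_pos ?ltW//; exact: is_derive_pow.
- rewrite tpow0// mulr0; apply/is_derive_epsP => e e0; exists (Num.min 1 e); first by rewrite lt_min ltr01.
  move=> h; rewrite lt_min => /andP[h1 he]; rewrite add0r mul0r subr0 (tpow0 k.+1 (lexx 0)) subr0.
  have [h0|h0] := leP h 0; first by rewrite tpow0// normr0 mulr_ge0// ltW.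
  move: h1 he; rewrite (tpow_pos k.+2 (ltW h0)) normrX gtr0_norm// => h1 he.
  rewrite exprSr exprS ler_wpM2r ?(ltW h0)//; apply: le_trans (ltW he).
  by rewrite ler_piMr ?(ltW h0)// exprn_ile1 ?ltW.
Qed.

Lemma tpow_cont k : continuous (tpow k.+1).
Proof.
move=> s; rewrite /tpow; have h : continuous_at s (fun x : R => Num.max x 0).
  by apply: continuous_max; [exact: cvg_id|exact: cvg_cst].
elim: k => [|k ih]; first by under eq_fun do rewrite expr1.
rewrite (_ : (fun x : R => Num.max x 0 ^+ k.+2) = (fun x : R => Num.max x 0 * Num.max x 0 ^+ k.+1)); last first.
  by apply: funext => x; rewrite exprS.
exact: (cvgM h ih).
Qed.

Definition jquad (c k a b : R) : jet R := Jet
  (fun p => c + k * ((p.1 - a) ^+ 2 + (p.2 - b) ^+ 2))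
  (fun p => 2 * k * (p.1 - a)) (fun p => 2 * k * (p.2 - b))
  (fun=> 2 * k) (fun=> 2 * k).

Lemma cont_1 : continuous (fun p : T => p.1). Proof. by move=> [x y]; exact: cvg_fst. Qed.
Lemma cont_2 : continuous (fun p : T => p.2). Proof. by move=> [x y]; exact: cvg_snd. Qed.

Lemma isC2_quad c k a b : isC2 (jquad c k a b).
Proof.
have c1 : continuous (fun p : T => p.1 - a) by apply: contB; [exact: cont_1|exact: contC].
have c2 : continuous (fun p : T => p.2 - b) by apply: contB; [exact: cont_2|exact: contC].
split => //=.
- apply: contD; first exact: contC.
  by apply: contM; [exact: contC|apply: contD; exact: contX].
- by apply: contM => //; exact: contC.
- by apply: contM => //; exact: contC.
- exact: contC.
- exact: contC.
- by move=> x y; apply: is_derive_eq; rewrite /GRing.scale /=; ring.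
- by move=> x y; apply: is_derive_eq; rewrite /GRing.scale /=; ring.
- by move=> x y; apply: is_derive_eq; rewrite /GRing.scale /=; ring.
- by move=> x y; apply: is_derive_eq; rewrite /GRing.scale /=; ring.
Qed.

Lemma lap_comp a a1 a2 (f : jet R) p :
  lap (jcomp a a1 a2 f) p = a2 (j0 f p) * grad2 f p + a1 (j0 f p) * lap f p.
Proof. by rewrite /lap /grad2 /=; ring. Qed.

Definition jtpow m (f : jet R) := jcomp (tpow m.+3) (fun s => m.+3%:R * tpow m.+2 s)
  (fun s => m.+3%:R * (m.+2%:R * tpow m.+1 s)) f.

Lemma isC2_tpow m (f : jet R) : isC2 f -> isC2 (jtpow m f).
Proof.
move=> F; apply: isC2_comp => // p.
- exact: is_derive_tpow.
- have h := is_deriveZ m.+3%:R (is_derive_tpow m (j0 f p)).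
  by apply: (is_derive_eq h).
- by apply: cvgMr; apply: cvgMr; exact: tpow_cont.
Qed.

Lemma tpow_supported m (f : jet R) A : (forall p, A <= `|p.1| \/ A <= `|p.2| -> j0 f p <= 0) ->
  jet_supported A (jtpow m f).
Proof. by move=> h; split => p /h hp /=; rewrite !tpow0// ?mulr0 ?mul0r ?addr0. Qed.

Definition q p : R := 1 + (p.1 ^+ 2 + p.2 ^+ 2).

(** Half of the area density of the round unit sphere in stereographic coordinates;
    also a quarter of the Laplacian of [ln (q^2)]. *)
Definition omega p : R := 2 / q p ^+ 2.
Definition jq := jquad 1 1 0 0.

Lemma jqE p : j0 jq p = q p.
Proof. by rewrite /= /q mul1r !subr0. Qed.

Lemma q_ge1 p : 1 <= q p.
Proof. by rewrite /q lerDl addr_ge0 ?sqr_ge0. Qed.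

Lemma q_gt0 p : 0 < q p.
Proof. exact: lt_le_trans (q_ge1 p). Qed.

Lemma omega_gt0 p : 0 < omega p.
Proof. by rewrite /omega divr_gt0// exprn_gt0// q_gt0. Qed.

Definition jlog (L : R) := jcomp (fun s => 1 - ln s / L) (fun s => - (L * s)^-1)
  (fun s => (L * s ^+ 2)^-1) jq.

Lemma isC2_log L : 0 < L -> isC2 (jlog L).
Proof.
move=> L0; apply: isC2_comp; [exact: isC2_quad| | |] => p; rewrite jqE; have q0 := q_gt0 p.
- have h := is_derive1_ln q0.
  by apply: is_derive_eq; rewrite /GRing.scale /=; field; rewrite !gt_eqF.
- have Lq : L * q p != 0 by rewrite mulf_neq0// gt_eqF.
  have h1 : is_derive (q p) 1 (fun s : R => L * s) L.
    by apply: is_derive_eq; rewrite /GRing.scale /= mulr1.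
  have h2 := is_deriveN (is_deriveV Lq h1).
  apply: (is_derive_eq h2); rewrite /GRing.scale /=; field; rewrite !gt_eqF//.
- have Lq : L * q p ^+ 2 != 0 by rewrite mulf_neq0// ?expf_neq0// gt_eqF.
  apply: cvgV => //; apply: cvgMr; exact: exprn_continuous.
Qed.

Lemma jlogE L p : j0 (jlog L) p = 1 - ln (q p) / L.
Proof. by rewrite -jqE. Qed.

(** The logarithmic cut-off equals 1 at the origin and vanishes for [q >= expR L]; as
    the Laplacian of [ln q] is [2 omega], the negative part of its own Laplacian is
    only [O(omega / L)]. *)
Definition chi L := jtpow 0 (jlog L).

Lemma isC2_chi L : 0 < L -> isC2 (chi L).
Proof. by move=> /isC2_log; exact: isC2_tpow. Qed.

Lemma jlog_le1 L p : 0 < L -> j0 (jlog L) p <= 1.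
Proof.
by move=> L0; rewrite jlogE lerBlDr lerDl divr_ge0 ?ln_ge0 ?q_ge1 ?ltW.
Qed.

Lemma chi_range L p : 0 < L -> 0 <= j0 (chi L) p <= 1.
Proof.
move=> L0; rewrite (_ : j0 (chi L) p = tpow 3 (j0 (jlog L) p))// tpow_ge0 /=.
by rewrite exprn_ile1 ?le_max ?lexx ?orbT// ge_max jlog_le1//= ler01.
Qed.

(** The gradient term in the Laplacian is non-negative, so that only the Laplacian of
    [ln q] enters the lower bound. *)
Lemma chi_lap L p : 0 < L -> - (6 * omega p / L) <= lap (chi L) p.
Proof.
move=> L0; rewrite lap_comp.
have q0 := q_gt0 p.
have -> : lap (jlog L) p = - (2 * omega p / L).
  rewrite lap_comp jqE /grad2 /lap /= /omega !subr0.
  have -> : (2 * 1 * p.1) ^+ 2 + (2 * 1 * p.2) ^+ 2 = 4 * (q p - 1) by rewrite /q; ring.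
  by field; rewrite !gt_eqF.
set f := j0 (jlog L) p; have f1 : f <= 1 by exact: jlog_le1.
have w0 := omega_gt0 p.
have t1 : tpow 2 f <= 1.
  by rewrite exprn_ile1 ?le_max ?lexx ?orbT// ge_max f1 ler01.
have wL : 0 < omega p / L by rewrite divr_gt0.
have g0 : 0 <= 3 * (2 * tpow 1 f) * grad2 (jlog L) p.
  by rewrite !mulr_ge0 ?tpow_ge0// /grad2 addr_ge0 ?sqr_ge0.
have tw : tpow 2 f * (omega p / L) <= omega p / L by rewrite ler_piMl// ltW.
have -> : 3 * tpow 2 f * - (2 * omega p / L) = - (6 * (tpow 2 f * (omega p / L))) by ring.
have -> : 6 * omega p / L = 6 * (omega p / L) by ring.
move: (tpow 2 f * _) tw g0 => X; lra.
Qed.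

Lemma chi_supported L : 0 < L ->
  jet_supported (expR L) (chi L).
Proof.
move=> L0; apply: tpow_supported => p hp.
rewrite jlogE subr_le0 ler_pdivlMr// mul1r.
have E1 : 1 <= expR L by rewrite -expR0 ler_expR ltW.
suff : expR L <= q p by rewrite -ler_ln ?posrE ?expR_gt0 ?q_gt0// expRK.
have sq (x : R) : expR L <= `|x| -> expR L <= x ^+ 2.
  move=> h; apply: (le_trans h); rewrite -real_normK ?num_real// expr2.
  by rewrite ler_peMl// (le_trans E1).
case: hp => /sq h; rewrite /q; have := sqr_ge0 p.1; have := sqr_ge0 p.2; lra.
Qed.

Lemma chi_cvg p (L : nat -> R) : (forall n, n.+1%:R <= L n) ->
  j0 (chi (L n)) p @[n --> \oo] --> (1 : R).
Proof.
move=> hL; have -> : (1 : R) = tpow 3 1 by rewrite tpow_pos// expr1n.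
have L0 n : 0 < L n by apply: lt_le_trans (hL n).
apply: (@continuous_cvg _ _ _ _ _ (fun n => j0 (jlog (L n)) p) (tpow 3)); first exact: tpow_cont.
have -> : (fun n => j0 (jlog (L n)) p) = (fun n => 1 - ln (q p) * (L n)^-1).
  by apply: funext => n; rewrite jlogE.
rewrite -[X in _ --> X]subr0; apply: cvgB; first exact: cvg_cst.
rewrite -(mulr0 (ln (q p))); apply: cvgMr.
apply: (squeeze_cvgr _ (cvg_cst 0) (@cvg_harmonic R)).
by apply: nearW => n; rewrite invr_ge0 (ltW (L0 n)) /= lef_pV2 ?posrE ?hL ?ltr0n.
Qed.

End TestFunctions.

(** * The area of the sphere *)

Section Area.
Variable R : realType.
Local Notation mu := (@lebesgue_measure R).
Local Notation mu2 := (mu \x mu)%E.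
Local Notation T := (R * R)%type.

Lemma even_integral (f F : R -> R) (l : R) : (forall x, 0 <= f x) -> continuous f ->
  (forall x, f (- x) = f x) -> (forall x : R, is_derive x 1 F (f x)) -> F 0 = 0 ->
  F x @[x --> +oo] --> l -> (\int[mu]_x (f x)%:E)%E = (2 * l)%:E.
Proof.
move=> f0 cf ef dF F0 Fl.
rewrite ge0_symfun_integralT//; last by move=> x; rewrite /= ef.
have -> : [set x : R | 0 <= x] = `[0, +oo[%classic by apply/seteqP; split => x /=; rewrite in_itv /= andbT.
rewrite (@ge0_continuous_FTC2y _ f F 0 l)//.
- by rewrite F0 sube0 EFinM.
- exact: continuous_subspaceT.
- by apply: cvg_at_right_filter; exact: is_derive_continuous (dF 0).
- by move=> x _; rewrite derive1E; apply: (@derive_val _ _ _ _ _ _ _ (dF x)).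
Qed.

(** The primitive comes from the substitution [y = s tan th]. *)
Lemma inner_integral (s : R) : 0 < s ->
  (\int[mu]_y (2 / (s ^+ 2 + y ^+ 2) ^+ 2)%:E)%E = (pi / s ^+ 3)%:E.
Proof.
move=> s0.
have pos (y : R) : 0 < s ^+ 2 + y ^+ 2 by rewrite ltr_pwDl ?exprn_gt0 ?sqr_ge0.
pose th (y : R) := atan (y / s).
pose F (y : R) := (th y + sin (th y) * cos (th y)) * (s ^+ 3)^-1.
have -> : pi / s ^+ 3 = 2 * ((pi / 2 + sin (pi / 2) * cos (pi / 2)) * (s ^+ 3)^-1).
  by rewrite cos_pihalf mulr0 addr0; field; rewrite gt_eqF.
apply: (@even_integral _ F).
- by move=> y; rewrite divr_ge0// exprn_ge0// ltW.
- move=> y; apply: cvgMr; apply: cvgV; first by rewrite expf_neq0// gt_eqF.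
  apply: (@continuous_comp _ _ _ (fun y : R => s ^+ 2 + y ^+ 2) (fun z => z ^+ 2)); last exact: exprn_continuous.
  by apply: cvgD; [exact: cvg_cst|exact: exprn_continuous].
- by move=> y; rewrite sqrrN.
- move=> y.
  have d1 : is_derive y 1 th ((1 + (y / s) ^+ 2)^-1 * s^-1).
    have dl : is_derive y 1 (fun y : R => y / s) s^-1.
      by apply: is_derive_eq; rewrite /GRing.scale /=; ring.
    exact: (@is_derive1_comp _ atan (fun y : R => y / s) y _ _ (is_derive1_atan (y / s)) dl).
  have d2 := is_derive1_comp (is_derive_sin (th y)) d1.
  have d3 := is_derive1_comp (is_derive_cos (th y)) d1.
  have d4 := is_deriveM (is_deriveD d1 (is_deriveM d2 d3)) (is_derive_cst ((s ^+ 3)^-1 : R) y (1 : R)).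
  apply: (is_derive_eq d4); rewrite /GRing.scale /=.
  have c2 : cos (th y) ^+ 2 = (1 + (y / s) ^+ 2)^-1.
    by rewrite /th cos_atan exprVn sqr_sqrtr// addr_ge0// sqr_ge0.
  have s2 : sin (th y) ^+ 2 = 1 - cos (th y) ^+ 2 by rewrite -(cos2Dsin2 (th y)) addrC addKr.
  have y2 : 1 + (y / s) ^+ 2 = (s ^+ 2 + y ^+ 2) / s ^+ 2 by field; rewrite gt_eqF.
  rewrite y2 in c2 *.
  have -> : 2 / (s ^+ 2 + y ^+ 2) ^+ 2 = (2 * cos (th y) ^+ 2) * (((s ^+ 2 + y ^+ 2) / s ^+ 2)^-1 / s) * (s ^+ 3)^-1.
    by rewrite c2; field; rewrite !gt_eqF// pos.
  rewrite -[2 * _](_ : 1 - sin (th y) ^+ 2 + cos (th y) ^+ 2 = _); last by rewrite s2; ring.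
  move: (cos (th y)) (sin (th y)) ((_ / _)^-1) => c0 s0' k; ring.
- by rewrite /F /th mul0r atan0 sin0 mul0r addr0 mul0r.
- apply: cvgMl.
  have tl : th y @[y --> +oo] --> pi / 2.
    apply: (@cvg_comp _ _ _ (fun y => y / s) atan _ +oo); last exact: cvgy_atan.
    apply/cvgryPge => A; near=> y; rewrite ler_pdivlMr//; near: y; exact: nbhs_pinfty_ge.
  apply: cvgD => //; apply: cvgM.
    by apply: (continuous_cvg _ _ tl); exact: continuous_sin.
  by apply: (continuous_cvg _ _ tl); exact: continuous_cos.
Unshelve. all: by end_near. Qed.

(** The primitive [pi x / sqrt (1 + x^2)] is [pi sin (atan x)]. *)
Lemma outer_integral : (\int[mu]_x (pi / Num.sqrt (1 + x ^+ 2) ^+ 3)%:E)%E = (2 * pi)%:E.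
Proof.
have pos (x : R) : 0 < 1 + x ^+ 2 by rewrite ltr_pwDl ?sqr_ge0.
have spos (x : R) : 0 < Num.sqrt (1 + x ^+ 2) by rewrite sqrtr_gt0.
have -> : 2 * pi = 2 * (pi * sin (pi / 2)) :> R by rewrite sin_pihalf mulr1.
apply: (@even_integral _ (fun x => pi * sin (atan x))).
- by move=> x; rewrite divr_ge0 ?pi_ge0// exprn_ge0// ltW.
- move=> x; apply: cvgMr; apply: cvgV; first by rewrite expf_neq0// gt_eqF.
  apply: (@continuous_comp _ _ _ (fun x : R => Num.sqrt (1 + x ^+ 2)) (fun z => z ^+ 3)); last exact: exprn_continuous.
  apply: (@continuous_comp _ _ _ (fun x : R => 1 + x ^+ 2) Num.sqrt); last exact: sqrt_continuous.
  by apply: cvgD; [exact: cvg_cst|exact: exprn_continuous].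
- by move=> x; rewrite sqrrN.
- move=> x; have d2 := is_derive1_comp (is_derive_sin (atan x)) (is_derive1_atan x).
  have d3 := is_deriveZ pi d2; apply: (is_derive_eq d3); rewrite /GRing.scale /=.
  rewrite cos_atan; congr (_ * _); have := sqr_sqrtr (ltW (pos x)); set s := Num.sqrt _ => <-.
  by have s0 : 0 < s := spos x; field; rewrite gt_eqF.
- by rewrite atan0 sin0 mulr0.
- apply: cvgMr; apply: (continuous_cvg _ _ (@cvgy_atan R)); exact: continuous_sin.
Qed.

Lemma omega_cont : continuous (@omega R).
Proof.
move=> p; apply: cvgMr; apply: cvgV; first by rewrite expf_neq0// gt_eqF// q_gt0.
rewrite (_ : (fun p => q p ^+ 2) = (fun p => q p * q p)); last by apply: funext => x; rewrite expr2.
have cq : continuous (@q R).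
  apply: contD; first exact: contC.
  by apply: contD; apply: contX; [exact: cont_1|exact: cont_2].
exact: (contM cq cq).
Qed.

Lemma omega_eintegral : (\int[mu2]_p (omega p)%:E)%E = (2 * pi)%:E.
Proof.
rewrite fubini_tonelli1; last 2 first.
- by apply/measurable_EFinP; apply: continuous_measurable2; exact: omega_cont.
- by move=> p; rewrite lee_fin ltW// omega_gt0.
rewrite -outer_integral; apply: eq_integral => x _; rewrite /fubini_F /omega /q /=.
rewrite -inner_integral ?sqrtr_gt0 ?ltr_pwDl ?sqr_ge0//; apply: eq_integral => y _.
by rewrite sqr_sqrtr ?addrA// addr_ge0 ?sqr_ge0.
Qed.

Lemma omega_integrable : mu2.-integrable setT (EFin \o @omega R).
Proof.
apply/integrableP; split.
  by apply/measurable_EFinP; apply: continuous_measurable2; exact: omega_cont.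
under eq_integral => p _ do rewrite /= ger0_norm ?(ltW (omega_gt0 p))//.
by rewrite omega_eintegral ltry.
Qed.

Lemma omega_integral : \int[mu2]_p (omega p) = 2 * pi.
Proof. by rewrite /Rintegral omega_eintegral. Qed.

End Area.

(** * The area inequality *)

Section Planar.
Variable R : realType.
Local Notation mu := (@lebesgue_measure R).
Local Notation mu2 := (mu \x mu)%E.
Local Notation T := (R * R)%type.
Local Notation Int f := (mu2.-integrable setT (EFin \o f)).

Lemma Int_le (f g : T -> R) :
  measurable_fun [set: measurableTypeR R * measurableTypeR R] f ->
  (forall p, `|f p| <= g p) -> Int g -> Int f.
Proof.
move=> mf fg; apply: le_integrable => //; first exact/measurable_EFinP.
by move=> p _ /=; rewrite lee_fin (le_trans (fg p))// ler_norm.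
Qed.

Lemma IntZ (k : R) (f : T -> R) : Int f -> Int (fun p => k * f p).
Proof. by move=> h; exact: (@integrableZl _ _ R mu2 setT measurableT k _ h). Qed.

Lemma IntD (f g : T -> R) : Int f -> Int g -> Int (fun p => f p + g p).
Proof. by move=> h k; exact: (@integrableD _ _ R mu2 setT measurableT _ _ h k). Qed.

Lemma IntB (f g : T -> R) : Int f -> Int g -> Int (fun p => f p - g p).
Proof. by move=> h k; exact: (@integrableB _ _ R mu2 setT measurableT _ _ h k). Qed.

Lemma II_le (f g : T -> R) : Int f -> Int g -> (forall p, f p <= g p) ->
  \int[mu2]_p f p <= \int[mu2]_p g p.
Proof. by move=> h k fg; apply: le_Rintegral. Qed.

(** [U_log] and [U_lap] are [lap (ln u) >= - 4 S u] and [lap u >= - 4 S u^2] for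
    [u = j0 U]; the first is multiplied by [u^2] so that it makes sense at the zeros
    of [u]. [U_bound] bounds the density of [u dx dy] with respect to the area form
    of the sphere, up to a constant factor. *)
Variables (U : jet R) (S M : R) (p0 : T).
Hypothesis UC : isC2 U.
Hypothesis U_ge0 : forall p, 0 <= j0 U p.
Hypothesis U_log : forall p, - 4 * S * j0 U p ^+ 3 <= j0 U p * lap U p - grad2 U p.
Hypothesis U_lap : forall p, - 4 * S * j0 U p ^+ 2 <= lap U p.
Hypothesis U_bound : forall p, j0 U p * q p ^+ 2 <= M.
Hypothesis U_p0 : 0 < j0 U p0.

(* Since ln (q^2) has Laplacian 4 omega, the function v = u q^2 satisfies
   lap (ln v) >= 4 kap, again in a form that makes sense at its zeros. *)
Let V := jmul U (jmul (jq R) (jq R)).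
Let u := j0 U.
Let v := j0 V.
Let kap p := omega p - S * u p.

Let u_ge0 p : 0 <= u p. Proof. exact: U_ge0. Qed.

Let vE p : v p = u p * q p ^+ 2.
Proof. by rewrite expr2 /v /V /= /q !mul1r !subr0. Qed.

Let v_ge0 p : 0 <= v p.
Proof. by rewrite vE mulr_ge0 ?U_ge0// exprn_ge0// ltW// q_gt0. Qed.

Let v_le p : v p <= M.
Proof. by rewrite vE; exact: U_bound. Qed.

Let M_ge0 : 0 <= M.
Proof. exact: le_trans (v_ge0 p0) (v_le p0). Qed.

Let VC : isC2 V.
Proof.
have jC : isC2 (jq R) := isC2_quad 1 1 0 0.
exact (isC2_mul UC (isC2_mul jC jC)).
Qed.

(* The function ln (v + e), shifted by a constant so as to be non-positive. *)
Let phi (e : R) := jcomp (fun s => ln (s + e) - ln (M + 1)) (fun s => (s + e)^-1)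
  (fun s => - ((s + e) ^+ 2)^-1) V.

Let phiC e : 0 < e -> isC2 (phi e).
Proof.
move=> e0; apply: isC2_comp => // p; have h : 0 < v p + e by rewrite ltr_wpDl.
- have h1 : is_derive (v p) 1 (fun s : R => s + e) 1.
    by apply: is_derive_eq; rewrite addr0.
  have h2 := @is_derive1_comp _ (@ln R) (fun s : R => s + e) (v p) _ _ (is_derive1_ln h) h1.
  have h3 := is_deriveB h2 (is_derive_cst (ln (M + 1) : R) (v p) (1 : R)).
  by apply: (is_derive_eq h3); rewrite mulr1 subr0.
- have h1 : is_derive (v p) 1 (fun s : R => s + e) 1.
    by apply: is_derive_eq; rewrite addr0.
  have n0 : v p + e != 0 by rewrite gt_eqF.
  have h2 := @is_deriveV _ (fun s : R => s + e) _ _ _ n0 h1.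
  by apply: (is_derive_eq h2); rewrite /GRing.scale /= mulr1.
- apply: cvgN; apply: cvgV; first by rewrite expf_neq0// gt_eqF.
  apply: (@continuous_comp _ _ _ (fun s : R => s + e) (fun z => z ^+ 2)); last exact: exprn_continuous.
  by apply: cvgD; [exact: cvg_id|exact: cvg_cst].
Qed.

(* where u vanishes, U_log reads 0 <= - grad2 U *)
Let gradU0 p : u p = 0 -> jx U p = 0 /\ jy U p = 0.
Proof.
move=> u0; have := U_log p; rewrite -/(u p) u0 expr0n mulr0 mul0r sub0r /grad2 => h.
have hx := sqr_ge0 (jx U p); have hy := sqr_ge0 (jy U p).
by split; apply/eqP; rewrite -sqrf_eq0; apply/eqP; lra.
Qed.

Let lapV p : lap V p = q p ^+ 2 * lap U p
  + 8 * q p * (p.1 * jx U p + p.2 * jy U p) + u p * (16 * q p - 8).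
Proof. by rewrite /lap /V /u /= /q; ring. Qed.

Let gradV p : v p * lap V p - grad2 V p
  = q p ^+ 4 * (u p * lap U p - grad2 U p) + 8 * u p ^+ 2 * q p ^+ 2.
Proof. by rewrite /lap /grad2 /v /V /u /= /q; ring. Qed.

Let V_log p : 4 * v p ^+ 2 * kap p <= v p * lap V p - grad2 V p.
Proof.
rewrite gradV vE /kap /omega.
have q0 := q_gt0 p; have q4 : 0 <= q p ^+ 4 by rewrite exprn_ge0// ltW.
have -> : 4 * (u p * q p ^+ 2) ^+ 2 * (2 / q p ^+ 2 - S * u p) =
   q p ^+ 4 * (- 4 * S * u p ^+ 3) + 8 * u p ^+ 2 * q p ^+ 2 by field; rewrite gt_eqF.
by rewrite lerD2r ler_wpM2l// U_log.
Qed.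

Let V_lap p : 4 * v p * kap p <= lap V p.
Proof.
have [u0|u_gt0] := eqVneq (u p) 0.
  have h : 0 <= lap U p by have := U_lap p; rewrite -/(u p) u0 expr0n mulr0.
  have [gx gy] := gradU0 u0; rewrite vE lapV gx gy u0.
  have -> : 4 * (0 * q p ^+ 2) * kap p = 0 by ring.
  rewrite (_ : _ + _ = q p ^+ 2 * lap U p); last by ring.
  by rewrite mulr_ge0// sqr_ge0.
have v0 : 0 < v p.
  by rewrite vE mulr_gt0 ?exprn_gt0 ?q_gt0// lt_def u_gt0 U_ge0.
rewrite -(ler_pM2l v0); have := V_log p.
have : 0 <= grad2 V p by rewrite addr_ge0 ?sqr_ge0.
have -> : v p * (4 * v p * kap p) = 4 * v p ^+ 2 * kap p by ring.
by move: (grad2 V p) (v p * lap V p) (4 * _ * _) => a b c; lra.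
Qed.

(* The sum of V_log and of e times V_lap. *)
Let phi_lap e p : 0 < e -> 4 * kap p * (v p / (v p + e)) <= lap (phi e) p.
Proof.
move=> e0; rewrite lap_comp -/v; set w := v p + e.
have w0 : 0 < w by rewrite ltr_wpDl.
have -> : - (w ^+ 2)^-1 * grad2 V p + w^-1 * lap V p = (w * lap V p - grad2 V p) / w ^+ 2.
  by field; rewrite gt_eqF.
rewrite ler_pdivlMr ?exprn_gt0//.
have -> : 4 * kap p * (v p / w) * w ^+ 2 = 4 * v p ^+ 2 * kap p + e * (4 * v p * kap p).
  by rewrite /w; field; rewrite gt_eqF.
have := V_log p; have := ler_wpM2l (ltW e0) (V_lap p).
have -> : w * lap V p = v p * lap V p + e * lap V p by rewrite /w; ring.
by move: (e * _) (4 * _ ^+ 2 * _) (e * lap V p) (v p * lap V p) (grad2 V p) => a b c d f; lra.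
Qed.

Let phiE e p : j0 (phi e) p = ln (v p + e) - ln (M + 1). Proof. by []. Qed.

Let phi_le0 e p : 0 < e <= 1 -> j0 (phi e) p <= 0.
Proof.
move=> /andP[e0 e1]; rewrite subr_le0; have h1 : 0 < v p + e by rewrite ltr_wpDl.
have h2 : 0 < M + 1 by rewrite ltr_wpDl.
by rewrite ler_ln ?posrE// lerD.
Qed.

Let phi_ge e c p : 0 < e -> 0 < c -> c <= v p + e -> ln c - ln (M + 1) <= j0 (phi e) p.
Proof.
move=> e0 c0 h; have h1 : 0 < v p + e by rewrite ltr_wpDl.
by rewrite lerD2r ler_ln ?posrE.
Qed.

Let ratio e p : 0 < e -> 0 <= v p / (v p + e) <= 1.
Proof.
move=> e0; have w0 : 0 < v p + e by rewrite ltr_wpDl.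
by rewrite divr_ge0 ?(ltW w0)//= ler_pdivrMr// mul1r lerDl ltW.
Qed.

Let u_cont : continuous u. Proof. exact: c0 UC. Qed.
Let v_cont : continuous v. Proof. exact: c0 VC. Qed.
Let kap_cont : continuous kap.
Proof. by apply: contB; [exact: omega_cont|apply: contM; [exact: contC|exact: u_cont]]. Qed.

Let ratio_cont e : 0 < e -> continuous (fun p => v p / (v p + e)).
Proof.
move=> e0; apply: contM; first exact: v_cont.
move=> p; apply: cvgV; first by rewrite gt_eqF// ltr_wpDl.
exact: (contD v_cont (@contC _ e)).
Qed.

Lemma U_integrable : Int u.
Proof.
apply: (@Int_le _ (fun p => M / 2 * omega p)); last by apply: IntZ; exact: omega_integrable.
  exact: continuous_measurable2.
move=> p; rewrite ger0_norm ?U_ge0// /omega.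
have -> : M / 2 * (2 / q p ^+ 2) = M / q p ^+ 2 by field; rewrite gt_eqF// q_gt0.
by rewrite ler_pdivlMr ?exprn_gt0 ?q_gt0// U_bound.
Qed.

(* Green's identity moves the Laplacian in phi_lap onto the test function. *)
Let weak_bound (A : R) (g : jet R) e : 0 < A -> isC2 g -> 0 < e ->
  jet_supported A g -> (forall p, 0 <= j0 g p) ->
  \int[mu2]_p (j0 g p * (4 * kap p * (v p / (v p + e)))) <= \int[mu2]_p (j0 (phi e) p * lap g p).
Proof.
move=> A0 G e0 gs g0; have s0 := sup0 gs.
rewrite -(@green _ A)//; last exact: phiC.
apply: II_le.
- apply: (@supported_integrable _ A); last by move=> p hp; rewrite s0// mul0r.
  apply: contM; first exact: c0.
  by apply: contM; [apply: contM; [exact: contC|exact: kap_cont]|exact: ratio_cont].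
- apply: (@supported_integrable _ A); last by move=> p hp; rewrite s0// mul0r.
  by apply: contM; [exact: c0|apply: contD; [exact: cxx (phiC e0)|exact: cyy (phiC e0)]].
- by move=> p; rewrite ler_wpM2l// phi_lap.
Qed.

Let r2 p := (p.1 - p0.1) ^+ 2 + (p.2 - p0.2) ^+ 2.

Let r2_ge0 p : 0 <= r2 p. Proof. by rewrite addr_ge0 ?sqr_ge0. Qed.

(* The power (k^2 - |p - p0|^2)^(m+3), truncated: its Laplacian is positive in the disc
   of radius k outside a disc around p0 that shrinks when m grows. *)
Let bump m (k : R) := jtpow m (jquad (k ^+ 2) (-1) p0.1 p0.2).

Let bumpC m k : isC2 (bump m k).
Proof. by apply: isC2_tpow; exact: isC2_quad. Qed.

Let bump_lap m k p : lap (bump m k) p = 4 * m.+3%:R *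
  (m.+2%:R * tpow m.+1 (k ^+ 2 - r2 p) * r2 p - tpow m.+2 (k ^+ 2 - r2 p)).
Proof.
rewrite lap_comp (_ : j0 _ p = k ^+ 2 - r2 p); last by rewrite /= mulN1r.
by rewrite /grad2 /lap /= /r2; ring.
Qed.

Let bump_lap_sign m (k d : R) p : k ^+ 2 < m.+3%:R * d -> d <= r2 p ->
  0 <= lap (bump m k) p /\ (r2 p < k ^+ 2 -> 0 < lap (bump m k) p).
Proof.
move=> hm hd; rewrite bump_lap.
have [h|h] := leP (k ^+ 2) (r2 p).
  by rewrite !tpow0 ?subr_le0// mulr0 mul0r subr0 mulr0.
set s := k ^+ 2 - r2 p; have s0 : 0 < s by rewrite subr_gt0.
suff : 0 < 4 * m.+3%:R * (m.+2%:R * tpow m.+1 s * r2 p - tpow m.+2 s) by move=> H; split => // ; exact: ltW.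
rewrite !tpow_pos ?(ltW s0)//.
have -> : m.+2%:R * s ^+ m.+1 * r2 p - s ^+ m.+2 = s ^+ m.+1 * (m.+2%:R * r2 p - s).
  by rewrite [s ^+ m.+2]exprSr; ring.
have mE : m.+3%:R = m.+2%:R + 1 :> R by rewrite -natr1.
have m3 : 0 < m.+3%:R :> R by rewrite ltr0n.
rewrite !mulr_gt0 ?exprn_gt0//.
have := ler_wpM2l (ltW m3) hd; rewrite mE in hm *; rewrite /s; lra.
Qed.

Let bump_supported m (k : R) : 0 < k ->
  let A := k + `|p0.1| + `|p0.2| in
  jet_supported A (bump m k).
Proof.
move=> k0 A; apply: tpow_supported => p hp.
rewrite (_ : j0 _ p = k ^+ 2 - r2 p); last by rewrite /= mulN1r.
have sq (x a : R) : k + `|a| <= `|x| -> k ^+ 2 <= (x - a) ^+ 2.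
  move=> h; rewrite -[leRHS]real_normK ?num_real// ler_pXn2r ?nnegrE ?(ltW k0)//.
  by have := lerB_dist x a; lra.
have a1 := normr_ge0 p0.1; have a2 := normr_ge0 p0.2.
have s1 := sqr_ge0 (p.1 - p0.1); have s2 := sqr_ge0 (p.2 - p0.2).
case: hp => hp; rewrite subr_le0 /r2.
  have := sq p.1 p0.1 (le_trans _ hp); rewrite /A => h; have : k + `|p0.1| <= k + `|p0.1| + `|p0.2| by rewrite lerDl.
  by move=> /h; lra.
have := sq p.2 p0.2 (le_trans _ hp); rewrite /A => h; have : k + `|p0.2| <= k + `|p0.1| + `|p0.2| by rewrite lerD2r lerDl.
by move=> /h; lra.
Qed.

Let lap_cont (g : jet R) : isC2 g -> continuous (lap g).
Proof. by move=> G; apply: contD; [exact: cxx|exact: cyy]. Qed.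

Let Z := [set p | u p = 0].

Let Z_measurable : measurable (Z : set (measurableTypeR R * measurableTypeR R)).
Proof.
have := @continuous_measurable2 R u u_cont measurableT [set 0].
by rewrite setTI; apply; exact: measurable_set1.
Qed.

Let ball_low : exists c d : R, [/\ 0 < c, 0 < d & forall p, r2 p < d -> c <= v p].
Proof.
have v0 : 0 < v p0 by rewrite vE mulr_gt0 ?exprn_gt0 ?q_gt0.
have : nbhs p0 [set p | v p0 / 2 < v p].
  have h : v p @[p --> p0] --> v p0 := @v_cont p0.
  by move/cvgr_gt : h; apply; rewrite ltr_pdivrMr// ltr_pMr// ltr1n.
move=> /nbhs_ballP[e /= e0 he]; exists (v p0 / 2), (e ^+ 2).
split; [by rewrite divr_gt0|by rewrite exprn_gt0|move=> p hp].
apply: ltW; apply: he.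
have sq (x a : R) : (x - a) ^+ 2 < e ^+ 2 -> `|a - x| < e.
  by rewrite distrC -[ltLHS]real_normK ?num_real// ltr_pXn2r ?nnegrE ?(ltW e0).
have s1 := sqr_ge0 (p.1 - p0.1); have s2 := sqr_ge0 (p.2 - p0.2).
split; rewrite /ball /=; apply: sq; apply: le_lt_trans hp; rewrite /r2; lra.
Qed.

(* In the disc of radius k around p0 the zeros of u form a null set. By ball_low, v is
   bounded below near p0, so m can be chosen such that the bump g has a non-negative
   Laplacian wherever this bound fails, hence on Z. Testing against g gives
     - C1 <= integral of phi e * lap g
          <= K C2 + (ln e - ln (M + 1)) * (integral of lap g over Z),
   and letting e tend to 0 shows that the last integral is zero. *)
Let Z_local (k : R) : 0 < k -> {ae mu2, forall p, u p = 0 -> k ^+ 2 <= r2 p}.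
Proof.
move=> k0; have [c [d [c_gt0 d0 hc]]] := ball_low.
have [m hm] : exists m : nat, k ^+ 2 < m.+3%:R * d.
  exists (Num.bound (k ^+ 2 / d)); rewrite -ltr_pdivrMr//.
  apply: lt_le_trans (archi_boundP _) _; first by rewrite divr_ge0 ?sqr_ge0 ?(ltW d0).
  by rewrite ler_nat; exact: leqW (leqW (leqnSn _)).
pose g := bump m k; have G : isC2 g := bumpC m k.
pose A := k + `|p0.1| + `|p0.2|.
have A0 : 0 < A by rewrite /A -addrA ltr_pwDl// addr_ge0.
have gs := bump_supported m k0; have [s0 sx sy sxx syy] := gs.
have g0 p : 0 <= j0 g p by exact: tpow_ge0.
have lc : continuous (lap g) by exact: lap_cont.
have ls : supported A (lap g) by move=> p hp; rewrite /lap sxx// syy// addr0.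
have Il : Int (lap g) by exact: (supported_integrable lc ls).
have Ial : Int (fun p => `|lap g p|) by exact: (integrable_norm Il).
pose psi p := \1_Z p * lap g p.
have psi_ge0 p : 0 <= psi p.
  rewrite /psi indicE; case: (boolP (p \in Z)); rewrite /= ?mul0r// inE => Zp; rewrite mul1r.
  have hv : v p = 0 by rewrite vE (_ : u p = 0)// mul0r.
  have hd : d <= r2 p by rewrite leNgt; apply/negP => /hc; rewrite hv; lra.
  by case: (bump_lap_sign hm hd).
have mpsi : measurable_fun [set: measurableTypeR R * measurableTypeR R] psi.
  by apply: measurable_funM; [exact: measurable_indic|exact: continuous_measurable2].
have Ipsi : Int psi.
  apply: (Int_le mpsi _ Ial) => p; rewrite /psi normrM indicE.
  by case: (p \in Z); rewrite /= ?normr1 ?mul1r// normr0 mul0r.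
have I0 : \int[mu2]_p psi p = 0.
  apply/le_anti/andP; split; last by apply: Rintegral_ge0.
  rewrite leNgt; apply/negP; set I := (\int[mu2]_p psi p) => I_gt0.
  pose K := `|ln c - ln (M + 1)|.
  have K0 : 0 <= K by exact: normr_ge0.
  have Ib : Int (fun p => j0 g p * (4 * `|S| * u p)).
    apply: (@supported_integrable _ A); last by move=> p hp; rewrite s0// mul0r.
    by apply: contM; [exact: c0 G|apply: contM; [exact: contC|exact: u_cont]].
  pose C1 := \int[mu2]_p (j0 g p * (4 * `|S| * u p)).
  pose C2 := \int[mu2]_p `|lap g p|.
  have C10 : 0 <= C1 by apply: Rintegral_ge0 => p _; apply: (mulr_ge0 (g0 p)); apply: mulr_ge0 (u_ge0 p); rewrite mulr_ge0.
  have C20 : 0 <= K * C2 by apply: mulr_ge0; [exact: normr_ge0|apply: Rintegral_ge0 => p _; exact: normr_ge0].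
  have M1 : 0 <= ln (M + 1) by apply: ln_ge0; rewrite lerDr; exact: M_ge0.
  have main e : 0 < e <= 1 -> - C1 <= K * C2 + (ln e - ln (M + 1)) * I.
    move=> /andP[e0 e1].
    have -> : - C1 = \int[mu2]_p (- 1 * (j0 g p * (4 * `|S| * u p))).
      by rewrite RintegralZl// mulN1r.
    have -> : K * C2 + (ln e - ln (M + 1)) * I =
        \int[mu2]_p (K * `|lap g p| + (ln e - ln (M + 1)) * psi p).
      rewrite RintegralD//; [|exact: IntZ|exact: IntZ].
      by rewrite !RintegralZl.
    apply: (@le_trans _ _ (\int[mu2]_p (j0 g p * (4 * kap p * (v p / (v p + e)))))).
      apply: II_le; first exact: IntZ.
        apply: (@supported_integrable _ A); last by move=> p hp; rewrite s0// mul0r.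
        apply: contM; first exact: c0 G.
        by apply: contM; [apply: contM; [exact: contC|exact: kap_cont]|exact: ratio_cont].
      move=> p; rewrite mulN1r -mulrN ler_wpM2l//.
      have /andP[x0 x1] := ratio p e0; set x := v p / _ in x0 x1 *.
      have w0 := omega_gt0 p; have u0 := U_ge0 p; rewrite -/(u p) in u0.
      have ku : - (`|S| * u p) <= kap p.
        by rewrite /kap; have := ler_wpM2r u0 (ler_norm S); lra.
      have su : 0 <= `|S| * u p by rewrite mulr_ge0.
      have h1 : `|S| * u p * x <= `|S| * u p by rewrite ler_piMr.
      have h2 : - (`|S| * u p) * x <= kap p * x by rewrite ler_wpM2r.
      have -> : 4 * kap p * x = 4 * (kap p * x) by ring.
      have -> : 4 * `|S| * u p = 4 * (`|S| * u p) by ring.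
      by rewrite -mulrN ler_wpM2l// (le_trans _ h2)// mulNr lerN2.
    apply: (le_trans (weak_bound A0 G e0 gs g0)).
    apply: II_le.
    - apply: (@supported_integrable _ A); last by move=> p hp; rewrite ls// mulr0.
      by apply: contM => //; exact: c0 (phiC e0).
    - by apply: IntD; exact: IntZ.
    - move=> p; have e01 : 0 < e <= 1 by rewrite e0.
      have f0 := phi_le0 p e01.
      have [Zp|Zp] := pselect (Z p).
        have -> : psi p = lap g p by rewrite /psi indicE mem_set//= mul1r.
        have hv : v p = 0 by rewrite vE (_ : u p = 0)// mul0r.
        rewrite (_ : j0 (phi e) p = ln e - ln (M + 1)); last by rewrite phiE hv add0r.
        by rewrite lerDr (mulr_ge0 K0).
      have -> : psi p = 0 by rewrite /psi indicE memNset//= mul0r.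
      rewrite mulr0 addr0.
      have [hd|hd] := ltP (r2 p) d.
        have h1 : c <= v p + e by apply: (le_trans (hc p hd)); rewrite lerDl ltW.
        have h2 := phi_ge e0 c_gt0 h1.
        apply: le_trans (ler_norm _) _; rewrite normrM ler_wpM2r// ler0_norm//.
        rewrite /K; have := ler_norm (- (ln c - ln (M + 1))); rewrite normrN.
        by move: (j0 (phi e) p) (ln c - ln (M + 1)) h2 f0 => x y; lra.
      have [l0 _] := bump_lap_sign hm hd.
      by apply: (@le_trans _ _ 0); [rewrite mulr_le0_ge0|rewrite (mulr_ge0 K0)].
  (* e is taken so small that the estimate main is violated by 1 *)
  have tpos : 0 <= (C1 + K * C2 + 1) / I by apply: divr_ge0; [lra|exact: ltW].
  have e01 : 0 < expR (- ((C1 + K * C2 + 1) / I)) <= 1.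
    by rewrite expR_gt0 /= -[leRHS]expR0 ler_expR oppr_le0.
  have := main _ e01; rewrite expRK mulrBl mulNr divfK ?gt_eqF//.
  by have := mulr_ge0 M1 (ltW I_gt0); move: (ln (M + 1) * I) => x; lra.
have : ae_eq mu2 setT (EFin \o psi) (cst 0%E).
  have mE : measurable_fun [set: measurableTypeR R * measurableTypeR R] (EFin \o psi).
    exact/measurable_EFinP.
  apply: (ae_eq_integral_abs mu2 measurableT mE).1.
  transitivity (\int[mu2]_p (psi p)%:E)%E.
    by apply: eq_integral => p _; rewrite /= ger0_norm.
  rewrite -[LHS]fineK; last exact: (integrable_fin_num measurableT Ipsi).
  by congr EFin.
apply: filterS => p /= /(_ I) [] h up.
rewrite leNgt; apply/negP => hk.
have hv : v p = 0 by rewrite vE up mul0r.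
have hd : d <= r2 p by rewrite leNgt; apply/negP => /hc; rewrite hv; lra.
have [_ /(_ hk)] := bump_lap_sign hm hd; move: h; rewrite /psi indicE mem_set//= mul1r => ->.
by rewrite ltxx.
Qed.

Lemma U_ae_gt0 : {ae mu2, forall p, 0 < u p}.
Proof.
have H (n : nat) : {ae mu2, forall p, u p = 0 -> n.+1%:R ^+ 2 <= r2 p} by exact: Z_local.
apply: filterS (ae_foralln H) => p hp; rewrite lt_def u_ge0 andbT; apply/eqP => up.
have := hp (Num.bound (r2 p)) up; apply/negP; rewrite -ltNge.
apply: lt_le_trans (archi_boundP (r2_ge0 p)) _.
by rewrite -natrX ler_nat; apply: (leq_trans (leqnSn _)); rewrite -{1}[_.+1]expn1 leq_exp2l.
Qed.

(** The functions [chi (L n) * kap * v / (v + e n)] converge almost everywhere to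
    [kap], under the integrable bound [omega + |S| u]. Their integrals are at most
    [O(e n)], because [phi (e n)] is bounded by [K n] and the Laplacian of [chi (L n)]
    is at least [- 6 omega / L n]. Hence the integral of [kap = omega - S u] is
    non-positive. *)
Theorem area_inequality : 2 * pi <= S * \int[mu2]_p u p.
Proof.
pose e (n : nat) : R := n.+1%:R^-1.
have e0 n : 0 < e n by rewrite invr_gt0.
have e1 n : 0 < e n <= 1 by rewrite e0 invf_le1// ler1n.
pose K n : R := ln (M + 1) - ln (e n).
have K0 n : 0 <= K n.
  rewrite subr_ge0 ler_ln ?posrE//; last by rewrite ltr_wpDl.
  by have /andP[_ h] := e1 n; apply: (le_trans h); rewrite lerDr.
(* the size of the cut-off is chosen after the bound K n, so that K n / L n <= e n *)
pose L n : R := n.+1%:R * (1 + K n).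
have L_ge n : n.+1%:R <= L n by rewrite /L ler_peMr// lerDl.
have L0 n : 0 < L n by apply: lt_le_trans (L_ge n).
pose f n p := j0 (chi (L n)) p * (kap p * (v p / (v p + e n))).
have f_cont n : continuous (f n).
  apply: contM; first exact: c0 (isC2_chi (L0 n)).
  by apply: contM; [exact: kap_cont|exact: ratio_cont].
have Iom : Int (@omega R) := @omega_integrable R.
have Iu : Int u := U_integrable.
have Ikap : Int kap by apply: IntB => //; exact: IntZ.
pose G p := omega p + `|S| * u p.
have IG : Int G by apply: IntD => //; exact: IntZ.
have kapG p : `|kap p| <= G p.
  have w0 := omega_gt0 p; rewrite /kap /G; apply: le_trans (ler_normB _ _) _.
  by rewrite gtr0_norm// normrM (ger0_norm (u_ge0 p)).
have fG n p : `|f n p| <= G p.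
  have /andP[x0 x1] := chi_range p (L0 n).
  have /andP[y0 y1] := ratio p (e0 n).
  rewrite /f normrM (ger0_norm x0) normrM (ger0_norm y0); apply: le_trans (kapG p).
  have h : `|kap p| * (v p / (v p + e n)) <= `|kap p| by rewrite ler_piMr.
  by apply: le_trans h; rewrite ler_piMl// mulr_ge0.
have If n : Int (f n).
  by apply: (Int_le _ (fG n) IG); apply: continuous_measurable2.
have bound n : \int[mu2]_p f n p <= 3 * pi * e n.
  have gs := chi_supported (L0 n); have [s0 sx sy sxx syy] := gs.
  have A0 : 0 < expR (L n) by exact: expR_gt0.
  have chi0 p : 0 <= j0 (chi (L n)) p by have /andP[] := chi_range p (L0 n).
  have h := weak_bound A0 (isC2_chi (L0 n)) (e0 n) gs chi0.
  have : 4 * (\int[mu2]_p f n p) <= 4 * (3 * pi * e n); last by rewrite ler_pM2l.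
  rewrite -RintegralZl//.
  have -> : \int[mu2]_p (4 * f n p) = \int[mu2]_p (j0 (chi (L n)) p * (4 * kap p * (v p / (v p + e n)))).
    by apply: eq_Rintegral => p _; rewrite /f; ring.
  apply: (le_trans h).
  have h2 : K n * 6 / L n * (2 * pi) <= 4 * (3 * pi * e n).
    have -> : K n * 6 / L n * (2 * pi) = (K n / (1 + K n)) * (4 * (3 * pi * e n)).
      rewrite /L /e; have : 0 < n.+1%:R :> R by rewrite ltr0n.
      move: (n.+1%:R : R) (K0 n); move: (K n) => k N k0 N0.
      by field; rewrite !gt_eqF// ltr_pwDl.
    apply: ler_piMl; first by rewrite !mulr_ge0 ?pi_ge0// ltW.
    by rewrite ler_pdivrMr ?ltr_pwDl// mul1r lerDr.
  apply: le_trans h2; rewrite -(@omega_integral R) -RintegralZl//.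
  apply: II_le; [|exact: IntZ|].
    apply: (@supported_integrable _ (expR (L n))); last by move=> p hp; rewrite /lap sxx// syy// addr0 mulr0.
    apply: contM; first exact: c0 (phiC (e0 n)).
    exact: lap_cont (isC2_chi (L0 n)).
  move=> p; have f0 := phi_le0 p (e1 n).
  have fK : - j0 (phi (e n)) p <= K n.
    have he : e n <= v p + e n by rewrite lerDr.
    by have := phi_ge (e0 n) (e0 n) he; rewrite /K; move: (j0 _ _) (ln _) (ln _) => a b c; lra.
  have cl := chi_lap p (L0 n).
  have -> : K n * 6 / L n * omega p = K n * (6 * omega p / L n) by ring.
  have w0 : 0 <= 6 * omega p / L n by rewrite divr_ge0 ?(ltW (L0 n))// mulr_ge0// ltW// omega_gt0.
  have [l0|l0] := leP 0 (lap (chi (L n)) p).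
    by apply: (@le_trans _ _ 0); [rewrite mulr_le0_ge0|rewrite mulr_ge0].
  rewrite -mulrNN; apply: ler_pM => //; first by rewrite oppr_ge0.
    by rewrite oppr_ge0 ltW.
  by rewrite lerNl.
have cvf : {ae mu2, forall p, setT p -> (f n p)%:E @[n --> \oo] --> (kap p)%:E}.
  apply: (@filterS _ _ (ae_filter_ringOfSetsType mu2) _ _ _ U_ae_gt0) => p up _; apply: cvg_EFin; first exact: nearW.
  have v0 : 0 < v p by rewrite vE mulr_gt0 ?exprn_gt0 ?q_gt0.
  have -> : kap p = 1 * (kap p * (v p / (v p + 0))).
    by rewrite addr0 divff ?gt_eqF// mulr1 mul1r.
  apply: cvgM; first exact: chi_cvg.
  apply: cvgMr; apply: cvgMr; apply: cvgV; first by rewrite addr0 gt_eqF.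
  by apply: cvgD; [exact: cvg_cst|exact: cvg_harmonic].
have [_ _ cvI] : [/\ Int kap, [sequence (\int[mu2]_p `|(f n p)%:E - (kap p)%:E|)%E]_n @ \oo --> 0%E &
    [sequence (\int[mu2]_p (f n p)%:E)%E]_n @ \oo --> (\int[mu2]_p (kap p)%:E)%E].
  apply: (@dominated_convergence _ _ R mu2 setT measurableT (fun n p => (f n p)%:E) (EFin \o kap) (EFin \o G)) => //.
  - by move=> n; exact: measurable_int (If n).
  - exact: measurable_int Ikap.
  - by apply: aeW => p n _; rewrite lee_fin; exact: fG.
have finI (g : T -> R) : Int g -> (\int[mu2]_p (g p)%:E = (\int[mu2]_p g p)%:E)%E.
  by move=> Ig; rewrite /Rintegral fineK//; exact: (integrable_fin_num measurableT Ig).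
have cvR : \int[mu2]_p f n p @[n --> \oo] --> \int[mu2]_p kap p.
  have := cvI; rewrite finI// => /fine_cvgP[_]; exact.
have k0 : \int[mu2]_p kap p <= 0.
  have c3 : 3 * pi * e n @[n --> \oo] --> 3 * pi * 0.
    by apply: cvgMr; exact: cvg_harmonic.
  rewrite -(mulr0 (3 * pi)); apply: (ler_cvg_to cvR c3).
  by apply: nearW => n; exact: bound.
move: k0; rewrite RintegralB//; last exact: IntZ.
by rewrite RintegralZl// omega_integral subr_le0.
Qed.

End Planar.

(** * Functions of several variables with continuous directional derivatives *)

Section ChainRule.
Variables (R : realType) (n : nat).
Local Notation V := 'rV[C R]_n.
Implicit Types (p q v w : V) (t h : R) (A : set V).

Lemma nbhs_row p A : nbhs p A <->
  exists2 r : R, 0 < r & forall w, (forall b, cmod (w 0 b - p 0 b) < r) -> A w.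
Proof.
split=> [/nbhs_ballP[e /= e0 he]|[r r0 hr]].
  have [ere eim] : 0 < re e /\ im e = 0 by move: e0; rewrite ltcE /= => /andP[/eqP -> ->].
  exists (re e) => // w hw; apply: he; split => // i j; rewrite /ball /=.
  have := hw j; rewrite !ord1 cmodB => h.
  have -> : e = cr (re e) by apply: ceq; rewrite ?eim.
  by rewrite normE (_ : (_ < _) = ((cr (cmod (p 0 j - w 0 j)) : R[i]) < cr (re e)))// ltcR.
apply/nbhs_ballP; exists (cr r) => /=; first by rewrite (_ : (_ < _) = ((cr 0 : R[i]) < cr r))// ltcR.
move=> w hw; apply: hr => b; have := hw.2 0 b; rewrite /ball /= normE cmodB.
by rewrite (_ : (_ < _) = ((cr (cmod (p 0 b - w 0 b)) : R[i]) < cr r))// ltcR cmodB.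
Qed.

(** Continuity of the directional derivatives makes them linear in the direction and
    yields the chain rule: increments of [G] along a perturbed direction are
    controlled by the mean value theorem on segments. [G] stands for the real or the
    imaginary part of a smooth function. *)
Variables (U : set V) (G : V -> R) (dG : V -> V -> R).
Hypothesis U_open : open U.
Hypothesis G_der : forall p v, U p -> is_derive (0 : R) 1 (fun t => G (p + cr t *: v)) (dG v p).
Hypothesis G_cont : forall p v, U p -> continuous_at p (dG v).

Let line_der p v t : U (p + cr t *: v) ->
  is_derive t 1 (fun s => G (p + cr s *: v)) (dG v (p + cr t *: v)).
Proof.
move=> hU; have /is_derive_epsP h := G_der v hU; apply/is_derive_epsP => e e0.
have [r r0 hr] := h e e0; exists r; first exact: r0.
move=> s hs; move: (hr s hs); rewrite add0r cr0 scale0r addr0.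
by rewrite [cr (t + s)]crD scalerDl addrA; exact: id.
Qed.

Let MVT_line p v : (forall t, 0 <= t <= 1 -> U (p + cr t *: v)) ->
  exists2 t, 0 <= t <= 1 & G (p + v) - G p = dG v (p + cr t *: v).
Proof.
move=> hU; have hd t : 0 <= t <= 1 -> is_derive t 1 (fun s => G (p + cr s *: v)) (dG v (p + cr t *: v)).
  by move=> /hU; exact: line_der.
have := @MVT_segment R (fun s => G (p + cr s *: v)) (fun t => dG v (p + cr t *: v)) 0 1 ler01.
case.
- by move=> t; rewrite in_itv /= => /andP[t0 t1]; apply: hd; rewrite !ltW.
- by apply: within_segment_continuous => t /hd ht; exact: is_derive_continuous ht.
- move=> t; rewrite in_itv /= subr0 mulr1 cr0 cr1 scale0r addr0 scale1r => ht ->.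
  by exists t.
Qed.

Lemma dG_scale p v (k : R) : U p -> dG (cr k *: v) p = k * dG v p.
Proof.
move=> Up; have h := G_der (cr k *: v) Up.
have hk : is_derive (0 : R) 1 (fun t : R => t * k) k.
  by apply: is_derive_eq; rewrite /GRing.scale /=; ring.
have hz : is_derive (0 * k : R) 1 (fun t => G (p + cr t *: v)) (dG v p) by rewrite mul0r; exact: G_der.
have := @is_derive1_comp _ (fun t => G (p + cr t *: v)) (fun t => t * k) 0 _ _ hz hk.
have -> : (fun t => G (p + cr t *: v)) \o (fun t => t * k) = (fun t => G (p + cr t *: (cr k *: v))).
  by apply: funext => t /=; rewrite scalerA crM.
move=> h'; rewrite -(@derive_val _ _ _ _ _ _ _ h) (@derive_val _ _ _ _ _ _ _ h').
by rewrite mulrC.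
Qed.

Let coord_bound w : exists2 B : R, 0 < B & forall b, cmod (w 0 b) <= B.
Proof.
have s0 (P : pred 'I_n) : 0 <= \sum_(b | P b) cmod (w 0 b) by apply: sumr_ge0 => b _; exact: cmod_ge0.
exists (1 + \sum_b cmod (w 0 b)); first by rewrite ltr_pwDl.
by move=> b; rewrite (bigD1 b)//= addrCA lerDl addr_ge0.
Qed.

Lemma dG_add p v w : U p -> dG (v + w) p = dG v p + dG w p.
Proof.
move=> Up; have h := G_der (v + w) Up.
rewrite -(@derive_val _ _ _ _ _ _ _ h).
suff h' : is_derive (0 : R) 1 (fun t => G (p + cr t *: (v + w))) (dG v p + dG w p).
  exact: (@derive_val _ _ _ _ _ _ _ h').
apply/is_derive_epsP => e e0.
have e20 : 0 < e / 2 by rewrite divr_gt0.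
have [r1 r10 H1] := (is_derive_epsP _ _ _).1 (G_der v Up) _ e20.
have [r2 r20 H2] : exists2 r : R, 0 < r & forall q, (forall b, cmod (q 0 b - p 0 b) < r) ->
    U q /\ `|dG w q - dG w p| <= e / 2.
  apply/nbhs_row; apply: filterI; first by move: U_open; rewrite openE => /(_ _ Up).
  by have /cvgrPdist_le/(_ _ e20) := @G_cont p w Up; apply: filterS => q; rewrite distrC.
have [Bv Bv0 hBv] := coord_bound v; have [Bw Bw0 hBw] := coord_bound w.
exists (Num.min r1 (r2 / (Bv + Bw))); first by rewrite lt_min r10 divr_gt0// addr_gt0.
move=> t; rewrite lt_min => /andP[t1]; rewrite ltr_pdivlMr ?addr_gt0// => t2.
have near s b : 0 <= s <= 1 -> cmod ((p + cr t *: v + cr s *: (cr t *: w)) 0 b - p 0 b) < r2.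
  move=> /andP[s0 s1]; rewrite !mxE.
  have -> : p 0 b + cr t * v 0 b + cr s * (cr t * w 0 b) - p 0 b = cr t * v 0 b + cr s * (cr t * w 0 b) by ring.
  apply: le_lt_trans (cmodD _ _) _; rewrite !cmodM !cmod_cr (ger0_norm s0).
  apply: le_lt_trans t2; rewrite mulrDr lerD ?ler_wpM2l//.
  apply: (@le_trans _ _ (`|t| * cmod (w 0 b))); last by apply: ler_wpM2l.
  by apply: ler_piMl => //; rewrite mulr_ge0 ?cmod_ge0.
have [s hs] := @MVT_line (p + cr t *: v) (cr t *: w) (fun s hs => (H2 _ (near s ^~ hs)).1).
have [Uq hq] := H2 _ (near s ^~ hs); rewrite dG_scale// => E.
have := H1 t t1; rewrite !add0r cr0 !scale0r !addr0 => h3.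
have -> : G (p + cr t *: (v + w)) - G p - (dG v p + dG w p) * t =
   (G (p + cr t *: v) - G p - dG v p * t) + (G (p + cr t *: v + cr t *: w) - G (p + cr t *: v) - dG w p * t).
  by rewrite scalerDr addrA; ring.
rewrite E; apply: le_trans (ler_normD _ _) _.
have h4 : `|t * dG w (p + cr t *: v + cr s *: (cr t *: w)) - dG w p * t| <= e / 2 * `|t|.
  by rewrite mulrC -mulrBl normrM ler_wpM2r.
by apply: (le_trans (lerD h3 h4)); lra.
Qed.

Lemma dG0 p : U p -> dG 0 p = 0.
Proof. by move=> Up; rewrite -(scale0r 0) (_ : (0 : C R) = cr 0)// dG_scale// mul0r. Qed.

Lemma dG_basis p v : U p -> dG v p =
  \sum_b (re (v 0 b) * dG (basis_vec R b) p + im (v 0 b) * dG ('i *: basis_vec R b) p).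
Proof.
move=> Up; rewrite [v in LHS]row_sum_delta.
rewrite (big_morph (fun x => dG x p) (fun x y => dG_add x y Up) (dG0 Up)).
apply: eq_bigr => b _; rewrite -!dG_scale// -dG_add//; congr (dG _ p).
rewrite scalerA -scalerDl; congr (_ *: _).
by apply: ceq; rewrite ?cE /=; ring.
Qed.

Lemma G_chain (c : R -> V) t (d : V) : U (c t) ->
  (forall b, cder (fun s => c s 0 b) t (d 0 b)) ->
  is_derive t 1 (fun s => G (c s)) (dG d (c t)).
Proof.
move=> Up hc; set p := c t.
have [M [r [M0 r0 hr]]] : exists M r : R, [/\ 0 < M, 0 < r & forall q, (forall b, cmod (q 0 b - p 0 b) < r) ->
    U q /\ forall w, (`|dG w q| <= \sum_b cmod (w 0 b) * M)].
  have fb b : exists2 M : R, 0 < M & \forall q \near p, `|dG (basis_vec R b) q| + `|dG ('i *: basis_vec R b) q| <= M.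
    pose M1 := `|dG (basis_vec R b) p| + `|dG ('i *: basis_vec R b) p|.
    exists (M1 + 2); first by rewrite ltr_wpDl// addr_ge0.
    have /cvgrPdist_le/(_ _ ltr01) k1 := @G_cont p (basis_vec R b) Up.
    have /cvgrPdist_le/(_ _ ltr01) k2 := @G_cont p ('i *: basis_vec R b) Up.
    near=> q.
    have a1 : `|dG (basis_vec R b) q| <= `|dG (basis_vec R b) p| + 1.
      rewrite -lerBlDl; apply: le_trans (lerB_dist _ _) _; rewrite distrC; near: q; exact: k1.
    have a2 : `|dG ('i *: basis_vec R b) q| <= `|dG ('i *: basis_vec R b) p| + 1.
      rewrite -lerBlDl; apply: le_trans (lerB_dist _ _) _; rewrite distrC; near: q; exact: k2.
    by rewrite /M1; lra.
  have [Mb hMb] := choice (fun b => let: ex_intro2 M h1 h2 := fb b in ex_intro (fun M => 0 < M /\ _) M (conj h1 h2)).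
  pose M := 1 + \sum_b Mb b.
  have Mb0 b : 0 <= Mb b by have [/ltW] := hMb b.
  have hall : \forall q \near p, forall b, `|dG (basis_vec R b) q| + `|dG ('i *: basis_vec R b) q| <= Mb b.
    exact: (@filter_forall _ _ (fun b q => `|dG (basis_vec R b) q| + `|dG ('i *: basis_vec R b) q| <= Mb b) (nbhs p) _ (fun b => (hMb b).2)).
  have /nbhs_row[r r0 hr] : nbhs p (U `&` [set q | forall b, `|dG (basis_vec R b) q| + `|dG ('i *: basis_vec R b) q| <= Mb b]).
    by apply: filterI => //; move: U_open; rewrite openE => /(_ _ Up).
  exists M, r; split => //; first by rewrite ltr_pwDl// sumr_ge0.
  move=> q /hr[Uq hq]; split => // w; rewrite dG_basis//.
  apply: le_trans (ler_norm_sum _ _ _) _; apply: ler_sum => b _.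
  apply: le_trans (ler_normD _ _) _; rewrite !normrM.
  have hM : Mb b <= M by rewrite /M (bigD1 b)//= addrCA lerDl addr_ge0// sumr_ge0.
  have h1 := hq b; have h2 := le_re (w 0 b); have h3 := le_im (w 0 b).
  apply: (@le_trans _ _ (cmod (w 0 b) * `|dG (basis_vec R b) q| + cmod (w 0 b) * `|dG ('i *: basis_vec R b) q|)).
    by apply: lerD; apply: ler_wpM2r.
  by rewrite -mulrDr; apply: ler_wpM2l; [exact: cmod_ge0|exact: le_trans h1 hM].
apply/is_derive_epsP => e e0.
have e20 : 0 < e / 2 by rewrite divr_gt0.
have [r1 r10 H1] := (is_derive_epsP _ _ _).1 (G_der d Up) _ e20.
pose N : R := n%:R + 1; have N0 : 0 < N by rewrite /N ltr_wpDl.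
pose e' := Num.min 1 (e / 2 / (N * M)).
have e'0 : 0 < e' by rewrite lt_min ltr01 divr_gt0// mulr_gt0.
have [r2 r20 H2] : exists2 r : R, 0 < r & forall h, `|h| < r ->
    forall b, cmod (c (t + h) 0 b - c t 0 b - d 0 b * cr h) <= e' * `|h|.
  have : \forall h \near (0 : R), forall b, cmod (c (t + h) 0 b - c t 0 b - d 0 b * cr h) <= e' * `|h|.
    have hb b : \forall h \near (0 : R), cmod (c (t + h) 0 b - c t 0 b - d 0 b * cr h) <= e' * `|h|.
      have /cder_epsP/(_ _ e'0)[x x0 hx] := hc b.
      by apply/nbhs_normP; exists x => // h /=; rewrite sub0r normrN => /hx.
    exact: (@filter_forall _ _ (fun b h => cmod (c (t + h) 0 b - c t 0 b - d 0 b * cr h) <= e' * `|h|) (nbhs (0 : R)) _ hb).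
  move=> /nbhs_normP[x /= x0 hx]; exists x => // h hh; apply: hx.
  by rewrite /= sub0r normrN.
have [B B0 hB] := coord_bound d.
exists (Num.min r1 (Num.min r2 (r / (B + 1)))).
  by rewrite !lt_min r10 r20 divr_gt0// addr_gt0.
move=> h; rewrite !lt_min => /and3P[h1 h2]; rewrite ltr_pdivlMr ?addr_gt0// => h3.
pose w := c (t + h) - c t - cr h *: d.
have wb b : cmod (w 0 b) <= e' * `|h| by have := H2 h h2 b; rewrite /w !mxE [cr h * _]mulrC.
have near s b : 0 <= s <= 1 -> cmod ((p + cr h *: d + cr s *: w) 0 b - p 0 b) < r.
  move=> /andP[s0 s1].
  have -> : (p + cr h *: d + cr s *: w) 0 b - p 0 b = cr h * d 0 b + cr s * w 0 b.
    by rewrite mxE [(p + _) 0 b]mxE [(cr h *: d) 0 b]mxE [(cr s *: w) 0 b]mxE; ring.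
  apply: le_lt_trans (cmodD _ _) _; rewrite !cmodM !cmod_cr (ger0_norm s0).
  apply: le_lt_trans h3; rewrite mulrDr lerD ?ler_wpM2l//.
  apply: (@le_trans _ _ (cmod (w 0 b))); first by apply: ler_piMl => //; exact: cmod_ge0.
  apply: le_trans (wb b) _; rewrite mulrC ler_wpM2l//.
  by rewrite /e' ge_min lexx.
have [s hs E] := @MVT_line (p + cr h *: d) w (fun s hs => (hr _ (near s ^~ hs)).1).
have [Uq hq] := hr _ (near s ^~ hs).
have := H1 h h1; rewrite add0r cr0 scale0r addr0 => h4.
have -> : G (c (t + h)) = G (p + cr h *: d + w).
  by congr G; rewrite /w -/p -[c (t + h) - p - _]addrA -opprD [RHS]addrC subrK.
have -> : G (p + cr h *: d + w) - G p - dG d p * h =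
   (G (p + cr h *: d) - G p - dG d p * h) + (G (p + cr h *: d + w) - G (p + cr h *: d)) by ring.
rewrite E; apply: le_trans (ler_normD _ _) _.
have h5 : `|dG w (p + cr h *: d + cr s *: w)| <= e / 2 * `|h|.
  apply: le_trans (hq w) _; apply: (@le_trans _ _ (\sum_(b < n) (e' * `|h| * M))).
    by apply: ler_sum => b _; rewrite ler_wpM2r// ltW.
  rewrite sumr_const card_ord -[leLHS]mulr_natl.
  have e'E : e' * (N * M) <= e / 2 by rewrite -ler_pdivlMr ?mulr_gt0// /e' ge_min lexx orbT.
  apply: (@le_trans _ _ (e' * (N * M) * `|h|)); last by apply: ler_wpM2r; [exact: normr_ge0|exact: e'E].
  have -> : e' * (N * M) * `|h| = N * (e' * `|h| * M) by ring.
  apply: ler_wpM2r; last by rewrite /N lerDl.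
  by apply: mulr_ge0 (ltW M0); apply: mulr_ge0 (ltW e'0) (normr_ge0 _).
by apply: (le_trans (lerD h4 h5)); lra.
Unshelve. all: by end_near. Qed.

End ChainRule.

(** * Smooth functions on open sets *)

Section Smooth.
Variables (R : realType) (n : nat).
Local Notation V := 'rV[C R]_n.
Implicit Types (p q v w : V) (t : R) (U : set V) (g : V -> C R).

Lemma cont_re_at (T : topologicalType) (f : T -> C R) (x : T) :
  continuous_at x f -> continuous_at x (fun y => re (f y)).
Proof.
move=> cf; apply: (@cvgrPdist_lt _ R _ (nbhs x) _ (fun y => re (f y)) (re (f x))).2 => e e0.
have /cf : nbhs (f x) [set w | cmod (w - f x) < e] by apply/nbhs_cmod; exists e.
move=> H; apply: (@filterS _ (nbhs x) _ _ _ _ H) => y /= h; rewrite distrC; apply: le_lt_trans h.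
by have := le_re (f y - f x); rewrite !cE.
Qed.

Lemma cont_im_at (T : topologicalType) (f : T -> C R) (x : T) :
  continuous_at x f -> continuous_at x (fun y => im (f y)).
Proof.
move=> cf; apply: (@cvgrPdist_lt _ R _ (nbhs x) _ (fun y => im (f y)) (im (f x))).2 => e e0.
have /cf : nbhs (f x) [set w | cmod (w - f x) < e] by apply/nbhs_cmod; exists e.
move=> H; apply: (@filterS _ (nbhs x) _ _ _ _ H) => y /= h; rewrite distrC; apply: le_lt_trans h.
by have := le_im (f y - f x); rewrite !cE.
Qed.

Lemma re_lin (x y : R) (A B : C R) : re (cr x * A + cr y * B) = x * re A + y * re B.
Proof. by rewrite !cE /=; ring. Qed.

Lemma im_lin (x y : R) (A B : C R) : im (cr x * A + cr y * B) = x * im A + y * im B.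
Proof. by rewrite !cE /=; ring. Qed.

Lemma real_derivableP g p v : real_derivable g p v ->
  cder (fun t => g (p + cr t *: v)) 0 (real_derive v g p).
Proof.
move=> [h1 h2]; split.
  by split; [exact: h1|apply: esym; exact: derive1E].
by split; [exact: h2|apply: esym; exact: derive1E].
Qed.

Lemma cder_real_derive g p v (d : C R) : cder (fun t => g (p + cr t *: v)) 0 d ->
  real_derivable g p v /\ real_derive v g p = d.
Proof.
move=> [h1 h2]; split.
  by split; [exact: (@ex_derive _ _ _ _ _ _ _ h1)|exact: (@ex_derive _ _ _ _ _ _ _ h2)].
apply: ceq.
  by apply: etrans (@derive_val _ _ _ _ _ _ _ h1); exact: derive1E.
by apply: etrans (@derive_val _ _ _ _ _ _ _ h2); exact: derive1E.
Qed.

Lemma line_near (A : set V) p v : open A -> A p -> \forall t \near (0 : R), A (p + cr t *: v).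
Proof.
move=> oA Ap; have /nbhs_row[r r0 hr] : nbhs p A by move: oA; rewrite openE => /(_ _ Ap).
pose B := 1 + \sum_b cmod (v 0 b).
have B0 : 0 < B by rewrite ltr_pwDl// sumr_ge0// => b _; exact: cmod_ge0.
apply/nbhs_normP; exists (r / B); first by rewrite /= divr_gt0.
move=> t /=; rewrite sub0r normrN ltr_pdivlMr// => ht; apply: hr => b; rewrite !mxE.
rewrite [p 0 b + _]addrC addrK cmodM cmod_cr; apply: le_lt_trans ht.
apply: ler_wpM2l => //; rewrite /B (bigD1 b)//= addrCA lerDl addr_ge0// sumr_ge0// => i _; exact: cmod_ge0.
Qed.

(** The derivatives in [Ck_on] are those of the total function; openness of [U] makes
    them depend only on its values on [U]. *)
Lemma Ck_ext k U g1 g2 : open U -> (forall p, U p -> g1 p = g2 p) -> Ck_on k U g1 -> Ck_on k U g2.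
Proof.
move=> oU; elim: k g1 g2 => [|k ih] g1 g2 h.
  move=> H p Up; have nU : nbhs p U by move: oU; rewrite openE => /(_ _ Up).
  have H' : g1 q @[q --> p] --> g1 p := H p Up.
  suff : g2 q @[q --> p] --> g2 p by [].
  have E : {near nbhs p, g1 =1 g2} by apply: (@filterS _ (nbhs p) _ U _ _ nU) => q Uq; exact: h.
  rewrite -(h _ Up); exact: cvg_trans (near_eq_cvg E) H'.
move=> H v; have [H1 H2] := H v.
have E p : U p -> real_derivable g2 p v /\ real_derive v g2 p = real_derive v g1 p.
  move=> Up; apply: cder_real_derive; apply: cder_near (real_derivableP (H1 p Up)).
  by apply: filterS (line_near v oU Up) => t; exact: h.
split; first by move=> p /E[].
by apply: ih H2 => p /E[].
Qed.

Lemma Ck_lin k U g1 g2 (x y : C R) : open U -> Ck_on k U g1 -> Ck_on k U g2 ->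
  Ck_on k U (fun p => x * g1 p + y * g2 p).
Proof.
move=> oU; elim: k g1 g2 => [|k ih] g1 g2 H1 H2.
  move=> p Up; have h1 : g1 q @[q --> p] --> g1 p := H1 p Up; have h2 : g2 q @[q --> p] --> g2 p := H2 p Up.
  exact: (cvgD (cvgM (cvg_cst x) h1) (cvgM (cvg_cst y) h2)).
move=> v; have [A1 A2] := H1 v; have [B1 B2] := H2 v.
have E p : U p -> real_derivable (fun p => x * g1 p + y * g2 p) p v /\
   real_derive v (fun p => x * g1 p + y * g2 p) p = x * real_derive v g1 p + y * real_derive v g2 p.
  move=> Up; apply: cder_real_derive.
  have h1 := cderM (cder_cst x 0) (real_derivableP (A1 p Up)).
  have h2 := cderM (cder_cst y 0) (real_derivableP (B1 p Up)).
  by apply: cder_eq (cderD h1 h2) _; rewrite !mul0r !add0r.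
split; first by move=> p /E[].
by apply: (@Ck_ext _ _ (fun p => x * real_derive v g1 p + y * real_derive v g2 p)) => // [p /E[]|]; [|exact: ih].
Qed.

Lemma Ck_dw k U g b : open U -> Ck_on k.+1 U g -> Ck_on k U (dw b g).
Proof.
move=> oU H; have [_ H1] := H (basis_vec R b); have [_ H2] := H ('i *: basis_vec R b).
have := Ck_lin (2^-1) (- 'i / 2) oU H1 H2; congr (Ck_on _ _ _); apply: funext => p.
rewrite /dw; move: (real_derive (basis_vec R b) g p) (real_derive ('i *: basis_vec R b) g p) => A B.
by move: ('i : C R) => I; field.
Qed.

Lemma Ck_dwbar k U g b : open U -> Ck_on k.+1 U g -> Ck_on k U (dwbar b g).
Proof.
move=> oU H; have [_ H1] := H (basis_vec R b); have [_ H2] := H ('i *: basis_vec R b).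
have := Ck_lin (2^-1) ('i / 2) oU H1 H2; congr (Ck_on _ _ _); apply: funext => p.
rewrite /dwbar; move: (real_derive (basis_vec R b) g p) (real_derive ('i *: basis_vec R b) g p) => A B.
by move: ('i : C R) => I; field.
Qed.

(** As a real direction [d] is the sum over [b] of [re d_b] times [e_b] and [im d_b] times
    [i e_b]; regrouping the terms gives the derivatives [dw] and [dwbar]. *)
Lemma Ck_chain U g (c : R -> V) t (d : V) : open U -> Ck_on 1 U g -> U (c t) ->
  (forall b, cder (fun s => c s 0 b) t (d 0 b)) ->
  cder (fun s => g (c s)) t
    (\sum_b (dw b g (c t) * d 0 b + dwbar b g (c t) * (d 0 b)^*)).
Proof.
move=> oU H Uc hc.
have Hd p v : U p -> cder (fun t => g (p + cr t *: v)) 0 (real_derive v g p).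
  by move=> Up; apply: real_derivableP; apply: (H v).1.
have Hcont p v : U p -> continuous_at p (real_derive v g) by exact: (H v).2.
have r1 p v : U p -> is_derive (0 : R) 1 (fun t => re (g (p + cr t *: v))) (re (real_derive v g p)).
  by move=> Up; have [] := Hd p v Up.
have r2 p v : U p -> is_derive (0 : R) 1 (fun t => im (g (p + cr t *: v))) (im (real_derive v g p)).
  by move=> Up; have [] := Hd p v Up.
have r3 p v : U p -> continuous_at p (fun q => re (real_derive v g q)) by move=> Up; apply: cont_re_at; exact: Hcont.
have r4 p v : U p -> continuous_at p (fun q => im (real_derive v g q)) by move=> Up; apply: cont_im_at; exact: Hcont.
have -> : \sum_b (dw b g (c t) * d 0 b + dwbar b g (c t) * (d 0 b)^*) = real_derive d g (c t).
  have E b : dw b g (c t) * d 0 b + dwbar b g (c t) * (d 0 b)^* =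
     cr (re (d 0 b)) * real_derive (basis_vec R b) g (c t) + cr (im (d 0 b)) * real_derive ('i *: basis_vec R b) g (c t).
    rewrite /dw /dwbar.
    move: (real_derive (basis_vec R b) g (c t)) (real_derive ('i *: basis_vec R b) g (c t)) (d 0 b) => A B z.
    have zE : z = cr (re z) + 'i * cr (im z) by apply: ceq; rewrite ?cE /=; ring.
    have zc : z^* = cr (re z) - 'i * cr (im z) by apply: ceq; rewrite ?cE /=; ring.
    transitivity ((A - 'i * B) / 2 * (cr (re z) + 'i * cr (im z)) + (A + 'i * B) / 2 * (cr (re z) - 'i * cr (im z))).
      by rewrite -zE -zc.
    have i2 : 'i * 'i = -1 :> C R by rewrite -expr2 sqrCi.
    move: (cr (re z)) (cr (im z)) ('i : C R) i2 => x y I i2.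
    by transitivity (x * A - (I * I) * y * B); [field|rewrite i2; ring].
  under eq_bigr do rewrite E.
  apply: ceq.
    rewrite re_sum (@dG_basis R n U (fun p => re (g p)) (fun v p => re (real_derive v g p)) oU r1 r3 (c t) d Uc)//; apply: eq_bigr => b _.
    exact: re_lin.
  rewrite im_sum (@dG_basis R n U (fun p => im (g p)) (fun v p => im (real_derive v g p)) oU r2 r4 (c t) d Uc)//; apply: eq_bigr => b _.
  exact: im_lin.
split.
  exact: (@G_chain R n U (fun p => re (g p)) (fun v p => re (real_derive v g p)) oU r1 r3 c t d Uc hc).
exact: (@G_chain R n U (fun p => im (g p)) (fun v p => im (real_derive v g p)) oU r2 r4 c t d Uc hc).
Qed.

End Smooth.

(** * The curvature inequalities at a point *)

Section Hermitian.
Local Open Scope sesquilinear_scope.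
Variables (R : realType) (n : nat) (g : 'M[C R]_n).
Implicit Types x y z : 'rV[C R]_n.
Hypothesis g_herm : g ^t* = g.
Hypothesis g_pos : forall W, W != 0 -> 0 < sqnorm g W.

Definition hform x y : C R := \sum_a \sum_b g a b * x 0 a * (y 0 b)^*.

Lemma g_conj a b : (g a b)^* = g b a.
Proof. by rewrite -[in RHS]g_herm !mxE. Qed.

Lemma hform_conj x y : (hform x y)^* = hform y x.
Proof.
rewrite /hform exchange_big /= rmorph_sum; apply: eq_bigr => a _.
rewrite rmorph_sum; apply: eq_bigr => b _.
by rewrite !rmorphM /= g_conj conjCK; ring.
Qed.

Lemma hformDl x y z : hform (x + y) z = hform x z + hform y z.
Proof.
rewrite /hform -big_split; apply: eq_bigr => a _; rewrite -big_split; apply: eq_bigr => b _.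
by rewrite mxE /=; ring.
Qed.

Lemma hformZl (k : C R) x z : hform (k *: x) z = k * hform x z.
Proof.
rewrite /hform mulr_sumr; apply: eq_bigr => a _; rewrite mulr_sumr; apply: eq_bigr => b _.
by rewrite mxE; ring.
Qed.

Lemma hformDr x y z : hform z (x + y) = hform z x + hform z y.
Proof. by rewrite -hform_conj hformDl rmorphD /= !hform_conj. Qed.

Lemma hformZr (k : C R) x z : hform z (k *: x) = k^* * hform z x.
Proof. by rewrite -hform_conj hformZl rmorphM /= hform_conj. Qed.

Lemma hform_ge0 x : 0 <= hform x x.
Proof.
have [->|x0] := eqVneq x 0; last exact: ltW (g_pos x0).
rewrite /hform big1// => a _; rewrite big1// => b _; rewrite !mxE; ring.
Qed.

Lemma hform_real x : hform x x = cr (re (hform x x)).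
Proof.
have := hform_ge0 x; case: (hform x x) => a b; rewrite lecE /= => /andP[/eqP -> _].
by [].
Qed.

Lemma hform_re_ge0 x : 0 <= re (hform x x).
Proof. by have := hform_ge0 x; rewrite lecE /= => /andP[]. Qed.

Lemma hform_CS x y : cmod (hform x y) ^+ 2 <= re (hform x x) * re (hform y y).
Proof.
have [->|y0] := eqVneq y 0.
  rewrite (_ : hform x 0 = 0) ?cmod0 ?expr0n ?mulr_ge0 ?hform_re_ge0//.
  by rewrite -(scale0r y) hformZr rmorph0 mul0r.
set s := re (hform y y); set h := hform x y.
have sE : hform y y = cr s := hform_real y.
have s0 : 0 < s.
  have : 0 < hform y y := g_pos y0.
  by rewrite sE ltcE /= => /andP[].
have := hform_re_ge0 (cr s *: x - h *: y).
have -> : hform (cr s *: x - h *: y) (cr s *: x - h *: y) = cr s * (cr s * hform x x - h * h^*).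
  rewrite -scaleNr !hformDl !hformDr !hformZl !hformZr -[hform y x]hform_conj -/h sE.
  have -> : (cr s)^* = cr s by apply: ceq; rewrite ?cE /= ?oppr0.
  by rewrite rmorphN /=; ring.
have -> : h * h^* = cr (cmod h ^+ 2).
  by rewrite cmod_sqr; apply: ceq; rewrite ?cE /=; ring.
rewrite hform_real -crM -crN -crD -crM /= pmulr_rge0// subr_ge0.
by rewrite mulrC.
Qed.

Lemma g_unit : g \in unitmx.
Proof.
rewrite -row_free_unit -kermx_eq0; apply/eqP/row_matrixP => i; rewrite row0.
apply/eqP; apply: contraT => k0; have := g_pos k0.
suff -> : sqnorm g (row i (kermx g)) = 0 by rewrite ltxx.
rewrite /sqnorm exchange_big big1// => b _; rewrite -mulr_suml.
have -> : \sum_i0 g i0 b * row i (kermx g) 0 i0 = (row i (kermx g) *m g) 0 b.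
  by rewrite mxE; apply: eq_bigr => a _; rewrite mulrC.
by rewrite -row_mul mulmx_ker row0 mxE mul0r.
Qed.

Lemma ginv_conj a b : (invmx g a b)^* = invmx g b a.
Proof.
have : (invmx g) ^t* = invmx g by rewrite trmx_inv map_invmx; congr invmx; exact: g_herm.
by move=> h; rewrite -[in RHS]h !mxE.
Qed.

Lemma sum_rot (A B D : finType) (F : A -> B -> D -> C R) :
  \sum_a \sum_b \sum_d F a b d = \sum_b \sum_d \sum_a F a b d.
Proof. by rewrite exchange_big; apply: eq_bigr => b _; rewrite exchange_big. Qed.

(** [D], [Db] and [H] stand for the derivatives of the metric [g] along [w], along
    the conjugate of [w], and along both, at the point [F z] of a holomorphic curve
    with [F' z = xi] and [F'' z = ze]. Then [deriv_P] and [mixed_X] are the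
    derivatives along [z], and along [z] and its conjugate, of the squared length of
    [F']. *)
Variables (D Db : 'I_n -> 'I_n -> 'I_n -> C R) (H : 'I_n -> 'I_n -> 'I_n -> 'I_n -> C R).
Hypothesis Db_conj : forall b m d, Db b m d = (D b d m)^*.
Variables xi ze : 'rV[C R]_n.
Local Notation "x `_ a" := (x 0 a).

Definition curv_xi : C R := \sum_a \sum_b \sum_c \sum_d
  (- H a b c d + \sum_nu \sum_m invmx g nu m * D a c nu * Db b m d) * xi 0 a * (xi 0 b)^* * xi 0 c * (xi 0 d)^*.

Definition mixed_X : C R := \sum_a \sum_b
  ((\sum_c (\sum_d H d c a b * xi 0 d) * (xi 0 c)^*) * xi 0 a * (xi 0 b)^*
   + (\sum_c Db c a b * (xi 0 c)^*) * ze 0 a * (xi 0 b)^*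
   + (\sum_c D c a b * xi 0 c) * xi 0 a * (ze 0 b)^* + g a b * ze 0 a * (ze 0 b)^*).

Definition deriv_P : C R := \sum_a \sum_b
  ((\sum_c D c a b * xi 0 c) * xi 0 a * (xi 0 b)^* + g a b * ze 0 a * (xi 0 b)^*).

(* the connection term of the covariant derivative, with its index lowered *)
Let beta : 'rV[C R]_n := \row_nu \sum_a \sum_c D a c nu * xi 0 a * xi 0 c.
(* the covariant derivative of F' *)
Let eta := beta *m invmx g + ze.

Let hform_mul x y : hform x y = \sum_b (x *m g) 0 b * (y 0 b)^*.
Proof.
rewrite /hform exchange_big; apply: eq_bigr => b _; rewrite mxE mulr_suml.
by apply: eq_bigr => a _; rewrite [x 0 a * _]mulrC.
Qed.

Let eta_g : eta *m g = beta + ze *m g.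
Proof. by rewrite /eta mulmxDl -mulmxA mulVmx ?mulmx1// g_unit. Qed.

Let beta_sum (y : 'rV[C R]_n) :
  \sum_a \sum_b (\sum_c D c a b * xi 0 c) * xi 0 a * (y 0 b)^* = \sum_b beta 0 b * (y 0 b)^*.
Proof.
rewrite exchange_big; apply: eq_bigr => b _; rewrite -mulr_suml; congr (_ * _).
rewrite mxE exchange_big; apply: eq_bigr => a _; rewrite mulr_suml; apply: eq_bigr => c _; ring.
Qed.

Let betab m : (beta 0 m)^* = \sum_b \sum_d Db b m d * (xi 0 b)^* * (xi 0 d)^*.
Proof.
rewrite mxE rmorph_sum; apply: eq_bigr => b _; rewrite rmorph_sum; apply: eq_bigr => d _.
by rewrite !rmorphM /= Db_conj.
Qed.

Lemma deriv_PE : deriv_P = hform eta xi.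
Proof.
rewrite hform_mul eta_g /deriv_P.
under eq_bigr do rewrite big_split.
rewrite big_split /= beta_sum -/(hform ze xi) hform_mul -big_split; apply: eq_bigr => b _.
by rewrite [(beta + _) 0 b]mxE mulrDl.
Qed.

(** The connection terms of [mixed_X] and of the curvature combine into the square of
    the covariant derivative, as in the Gauss equation. *)
Lemma mixed_XE : mixed_X + curv_xi = hform eta eta.
Proof.
have -> : mixed_X = \sum_a \sum_b \sum_c \sum_d H a b c d * xi 0 a * (xi 0 b)^* * xi 0 c * (xi 0 d)^*
   + \sum_b ze 0 b * (beta 0 b)^* + \sum_b beta 0 b * (ze 0 b)^* + hform ze ze.
  rewrite /mixed_X; under eq_bigr do rewrite !big_split.
  rewrite !big_split /= beta_sum; congr (_ + _ + _ + _).
    pose t a b c d := H a b c d * xi 0 a * (xi 0 b)^* * xi 0 c * (xi 0 d)^*.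
    transitivity (\sum_a \sum_b \sum_c \sum_d t d c a b).
      apply: eq_bigr => a _; apply: eq_bigr => b _; rewrite !mulr_suml; apply: eq_bigr => c _.
      by rewrite !mulr_suml; apply: eq_bigr => d _; rewrite /t; ring.
    transitivity (\sum_c \sum_d \sum_a \sum_b t d c a b); last by rewrite exchange_big.
    by rewrite -[RHS]sum_rot; apply: eq_bigr => a _; rewrite -[RHS]sum_rot.
  apply: eq_bigr => a _; rewrite betab exchange_big mulr_sumr; apply: eq_bigr => b _.
  by rewrite !mulr_suml mulr_sumr; apply: eq_bigr => c _; ring.
have -> : curv_xi = \sum_nu \sum_m beta 0 nu * invmx g nu m * (beta 0 m)^*
   - \sum_a \sum_b \sum_c \sum_d H a b c d * xi 0 a * (xi 0 b)^* * xi 0 c * (xi 0 d)^*.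
  rewrite /curv_xi.
  pose T a b c d nu m := invmx g nu m * D a c nu * Db b m d * xi 0 a * (xi 0 b)^* * xi 0 c * (xi 0 d)^*.
  transitivity (\sum_a \sum_b \sum_c \sum_d (\sum_nu \sum_m T a b c d nu m
      - H a b c d * xi 0 a * (xi 0 b)^* * xi 0 c * (xi 0 d)^*)).
    apply: eq_bigr => a _; apply: eq_bigr => b _; apply: eq_bigr => c _; apply: eq_bigr => d _.
    rewrite [- _ + _]addrC !mulrBl; congr (_ - _).
    do 4 rewrite mulr_suml; apply: eq_bigr => nu _.
    by do 4 rewrite mulr_suml; apply: eq_bigr.
  transitivity (\sum_a \sum_b \sum_c \sum_d \sum_nu \sum_m T a b c d nu m
      - \sum_a \sum_b \sum_c \sum_d H a b c d * xi 0 a * (xi 0 b)^* * xi 0 c * (xi 0 d)^*).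
    rewrite -sumrB; apply: eq_bigr => a _; rewrite -sumrB; apply: eq_bigr => b _.
    by rewrite -sumrB; apply: eq_bigr => c _; rewrite -sumrB; apply: eq_bigr.
  congr (_ - _).
  transitivity (\sum_nu \sum_m \sum_a \sum_b \sum_c \sum_d T a b c d nu m).
    rewrite -[RHS]sum_rot; apply: eq_bigr => a _; rewrite -[RHS]sum_rot; apply: eq_bigr => b _.
    by rewrite -[RHS]sum_rot; apply: eq_bigr => c _; rewrite -[RHS]sum_rot.
  apply: eq_bigr => nu _; apply: eq_bigr => m _; rewrite betab mxE.
  rewrite mulr_suml mulr_suml; apply: eq_bigr => a _.
  rewrite exchange_big /= mulr_suml mulr_suml; apply: eq_bigr => c _.
  rewrite mulr_sumr; apply: eq_bigr => b _; rewrite mulr_sumr; apply: eq_bigr => d _.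
  by rewrite /T; ring.
rewrite [hform eta eta]hform_mul eta_g.
have eb b : (eta 0 b)^* = \sum_m invmx g b m * (beta 0 m)^* + (ze 0 b)^*.
  rewrite mxE rmorphD /=; congr (_ + _); rewrite mxE rmorph_sum; apply: eq_bigr => m _.
  by rewrite rmorphM /= ginv_conj mulrC.
have -> : \sum_b (beta + ze *m g) 0 b * (eta 0 b)^* =
   \sum_b (beta 0 b * (\sum_m invmx g b m * (beta 0 m)^*)) + \sum_b beta 0 b * (ze 0 b)^*
   + \sum_b (ze *m g) 0 b * (\sum_m invmx g b m * (beta 0 m)^*) + \sum_b (ze *m g) 0 b * (ze 0 b)^*.
  by rewrite -!big_split; apply: eq_bigr => b _; rewrite eb [(beta + _) 0 b]mxE /=; ring.
rewrite -hform_mul.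
have -> : \sum_b (ze *m g) 0 b * (\sum_m invmx g b m * (beta 0 m)^*) = \sum_b ze 0 b * (beta 0 b)^*.
  under eq_bigr do rewrite mulr_sumr.
  rewrite exchange_big; apply: eq_bigr => m _.
  have -> : ze 0 m = (ze *m g *m invmx g) 0 m by rewrite -mulmxA mulmxV ?mulmx1// g_unit.
  by rewrite [(_ *m invmx g) 0 m]mxE mulr_suml; apply: eq_bigr => b _; rewrite mulrA.
have -> : \sum_b beta 0 b * (\sum_m invmx g b m * (beta 0 m)^*) = \sum_nu \sum_m beta 0 nu * invmx g nu m * (beta 0 m)^*.
  by apply: eq_bigr => b _; rewrite mulr_sumr; apply: eq_bigr => m _; rewrite mulrA.
ring.
Qed.

(** [deriv_P] is the product of [eta] and [xi], so this is the Cauchy-Schwarz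
    inequality. *)
Lemma curv_log : - (re (hform xi xi) * re curv_xi) <=
  re (hform xi xi) * re mixed_X - cmod deriv_P ^+ 2.
Proof.
have := hform_CS eta xi; rewrite -deriv_PE -mixed_XE reD.
by move: (cmod _ ^+ 2) (re (hform xi xi)) => a b; lra.
Qed.

Lemma curv_lap : - re curv_xi <= re mixed_X.
Proof. by have := hform_re_ge0 eta; rewrite -mixed_XE reD; lra. Qed.

End Hermitian.

(** * The squared length of a holomorphic curve *)

Section Wirtinger.
Variable R : realType.
Implicit Types (phi psi : C R -> C R) (z v : C R).

(** [P] and [Q] are the derivatives of [phi] along [z] and along its conjugate, tested
    on all real lines through [z]. *)
Definition wirt phi z (P Q : C R) :=
  forall v, cder (fun t => phi (z + cr t * v)) 0 (P * v + Q * v^*).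

Lemma wirt_eq phi z P Q P' Q' : wirt phi z P Q -> P = P' -> Q = Q' -> wirt phi z P' Q'.
Proof. by move=> h <- <-. Qed.

Let z0 z v : z + cr 0 * v = z. Proof. by rewrite cr0 mul0r addr0. Qed.

Lemma wirtD phi psi z P Q P' Q' : wirt phi z P Q -> wirt psi z P' Q' ->
  wirt (fun z => phi z + psi z) z (P + P') (Q + Q').
Proof. by move=> h1 h2 v; apply: cder_eq (cderD (h1 v) (h2 v)) _; ring. Qed.

Lemma wirtM phi psi z P Q P' Q' : wirt phi z P Q -> wirt psi z P' Q' ->
  wirt (fun z => phi z * psi z) z (P * psi z + phi z * P') (Q * psi z + phi z * Q').
Proof.
move=> h1 h2 v; apply: cder_eq (cderM (h1 v) (h2 v)) _.
by rewrite !z0; ring.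
Qed.

Lemma wirt_conj phi z P Q : wirt phi z P Q -> wirt (fun z => (phi z)^*) z Q^* P^*.
Proof.
move=> h v; apply: cder_eq (cder_conj (h v)) _.
by rewrite rmorphD !rmorphM /= conjCK addrC.
Qed.

Lemma wirt_cst (a : C R) z : wirt (fun=> a) z 0 0.
Proof. by move=> v; apply: cder_eq (cder_cst _ _) _; ring. Qed.

Lemma wirt_sum (I : Type) (r : seq I) (phi : I -> C R -> C R) z (P Q : I -> C R) :
  (forall i, wirt (phi i) z (P i) (Q i)) ->
  wirt (fun z => \sum_(i <- r) phi i z) z (\sum_(i <- r) P i) (\sum_(i <- r) Q i).
Proof.
move=> h; elim: r => [|i r ih].
  rewrite !big_nil; have -> : (fun z => \sum_(i <- [::]) phi i z) = (fun=> 0) by apply: funext => y; rewrite big_nil.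
  exact: wirt_cst.
rewrite !big_cons; have -> : (fun z => \sum_(i <- i :: r) phi i z) = (fun z => phi i z + \sum_(i <- r) phi i z).
  by apply: funext => y; rewrite big_cons.
exact: wirtD.
Qed.

Lemma wirt_holo phi z l : cdiff phi z l -> wirt phi z l 0.
Proof.
move=> h v; have hc : cder (fun t => z + cr t * v) 0 (0 + (1 * v + cr 0 * 0)).
  by apply: cderD; [exact: cder_cst|apply: cderM; [exact: cder_cr|exact: cder_cst]].
have h' : cdiff phi ((fun t => z + cr t * v) 0) l by rewrite /= z0.
by apply: cder_eq (cdiff_cder h' hc) _; ring.
Qed.

Lemma wirt_antiholo phi z l : cdiff phi z l -> wirt (fun z => (phi z)^*) z 0 l^*.
Proof. by move=> /wirt_holo/wirt_conj; rewrite rmorph0. Qed.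

Lemma wirt_comp n (V : set 'rV[C R]_n) (g : 'rV[C R]_n -> C R) (F : 'I_n -> C R -> C R) z (l : 'I_n -> C R) :
  open V -> Ck_on 1 V g -> V (\row_b F b z) -> (forall b, cdiff (F b) z (l b)) ->
  wirt (fun z => g (\row_b F b z)) z (\sum_b dw b g (\row_b F b z) * l b)
    (\sum_b dwbar b g (\row_b F b z) * (l b)^*).
Proof.
move=> oV H Vz hF v.
pose c t : 'rV[C R]_n := \row_b F b (z + cr t * v).
have c0E : c 0 = \row_b F b z by rewrite /c z0.
have Vc : V (c 0) by rewrite c0E.
have hc b : cder (fun s => c s 0 b) 0 ((\row_b (l b * v)) 0 b).
  have -> : (fun s => c s 0 b) = (fun s => F b (z + cr s * v)) by apply: funext => s; rewrite mxE.
  rewrite mxE; have := wirt_holo (hF b) v; rewrite mul0r addr0; exact.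
have := Ck_chain oV H Vc hc; rewrite c0E => h; apply: cder_eq h _.
rewrite !mulr_suml -big_split; apply: eq_bigr => b _ /=.
by rewrite mxE rmorphM /=; ring.
Qed.

Lemma ctM (T : topologicalType) (f g : T -> C R) x : continuous_at x f -> continuous_at x g ->
  continuous_at x (fun y => f y * g y).
Proof. by move=> h1 h2; exact: (cvgM h1 h2). Qed.

Lemma ctD (T : topologicalType) (f g : T -> C R) x : continuous_at x f -> continuous_at x g ->
  continuous_at x (fun y => f y + g y).
Proof. by move=> h1 h2; exact: (cvgD h1 h2). Qed.

Lemma ctJ (T : topologicalType) (f : T -> C R) x : continuous_at x f ->
  continuous_at x (fun y => (f y)^*).
Proof.
move=> cf A /nbhs_cmod[d d0 hd].
have H : nbhs (f x) [set w | cmod (w - f x) < d] by apply/nbhs_cmod; exists d.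
have {}H : nbhs x [set y | cmod (f y - f x) < d] := cf _ H.
apply: (@filterS _ (nbhs x) _ _ _ _ H) => y /= h; apply: hd.
by rewrite -rmorphB cmod_conj.
Qed.

Lemma ctS (T : topologicalType) (I : Type) (r : seq I) (f : I -> T -> C R) x :
  (forall i, continuous_at x (f i)) -> continuous_at x (fun y => \sum_(i <- r) f i y).
Proof.
move=> h; elim: r => [|i r ih].
  have -> : (fun y => \sum_(i <- [::]) f i y) = (fun=> 0) by apply: funext => y; rewrite big_nil.
  exact: cvg_cst.
have -> : (fun y => \sum_(i <- i :: r) f i y) = (fun y => f i y + \sum_(i <- r) f i y).
  by apply: funext => y; rewrite big_cons.
exact: (ctD (h i) ih).
Qed.

Lemma ct_row n (F : 'I_n -> C R -> C R) z : (forall b, continuous_at z (F b)) ->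
  continuous_at z (fun y => \row_b F b y : 'rV[C R]_n).
Proof.
move=> h A /nbhs_row[r r0 hr].
have H b : nbhs z [set y | cmod (F b y - F b z) < r].
  have hb : F b y @[y --> z] --> F b z := h b.
  by apply: (hb [set w | cmod (w - F b z) < r]); apply/nbhs_cmod; exists r.
have {}H := @filter_forall _ _ (fun b y => cmod (F b y - F b z) < r) (nbhs z) (nbhs_filter z) H.
have [d d0 hd] := (nbhs_cmod z _).1 H.
have : nbhs z [set y | A (\row_b F b y)].
  apply/nbhs_cmod; exists d => // w hw /=; apply: hr => b; rewrite !mxE.
  exact: (hd w hw b).
exact: id.
Qed.

Lemma wirt_real (O : set (C R)) phi z P Q : open O -> O z -> (forall w, O w -> im (phi w) = 0) ->
  wirt phi z P Q -> P = Q^*.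
Proof.
move=> oO Oz hr h.
have /nbhs_cmod[d d0 hd] : nbhs z O by move: oO; rewrite openE => /(_ _ Oz).
have key v : im (P * v + Q * v^*) = 0.
  have [_ h2] := h v.
  have near0 : \forall t \near (0 : R), im (phi (z + cr t * v)) = 0.
    apply/nbhs_normP; exists (d / (cmod v + 1)); first by rewrite /= divr_gt0// cmod1_gt0.
    move=> t /=; rewrite sub0r normrN ltr_pdivlMr ?cmod1_gt0// => ht; apply: hr; apply: hd.
    rewrite [z + _]addrC addrK cmodM cmod_cr; apply: le_lt_trans ht.
    by apply: ler_wpM2l => //; rewrite lerDl.
  have h0 : is_derive (0 : R) 1 (fun t => im (phi (z + cr t * v))) 0.
    have /is_derive_epsP h3 := is_derive_cst (0 : R) (0 : R) (1 : R).
    apply/is_derive_epsP => e e0; have [r r0 h4] := h3 e e0.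
    move: near0 => /nbhs_normP[r1 /= r10 h5]; exists (Num.min r r1); first by rewrite lt_min r0.
    move=> t; rewrite lt_min => /andP[t1 t2]; have := h4 t t1; rewrite [im (phi (z + cr (0 + t) * v))]h5 ?[im (phi (z + cr 0 * v))]h5 //=.
      by rewrite subrr normr0.
    by rewrite add0r opprD oppr0 add0r normrN.
  by rewrite -(@derive_val _ _ _ _ _ _ _ h2) (@derive_val _ _ _ _ _ _ _ h0).
have k1 := key 1; have k2 := key (Complex 0 1); move: k1 k2; rewrite !cE /= => k1 k2.
apply: ceq; rewrite cE; lra.
Qed.

Lemma slice_x phi (x y : R) P Q : wirt phi (Complex x y) P Q ->
  is_derive x 1 (fun s => re (phi (Complex s y))) (re (P + Q)) /\
  is_derive x 1 (fun s => im (phi (Complex s y))) (im (P + Q)).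
Proof.
move=> /(_ 1); rewrite rmorph1 !mulr1 => -[h1 h2].
have E (h : R) : Complex x y + cr h * 1 = Complex (x + h) y :> C R.
  by apply: ceq; rewrite ?cE /=; ring.
have E0 : Complex x y + cr 0 * 1 = Complex x y :> C R by apply: ceq; rewrite ?cE /=; ring.
split; apply/is_derive_epsP => e e0.
  have [r r0 hr] := (is_derive_epsP _ _ _).1 h1 e e0; exists r => // h hh.
  by have := hr h hh; rewrite add0r E E0.
have [r r0 hr] := (is_derive_epsP _ _ _).1 h2 e e0; exists r => // h hh.
by have := hr h hh; rewrite add0r E E0.
Qed.

(** The derivative along [y] is [i (P - Q)]. *)
Lemma slice_y phi (x y : R) P Q : wirt phi (Complex x y) P Q ->
  is_derive y 1 (fun s => re (phi (Complex x s))) (im (Q - P)) /\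
  is_derive y 1 (fun s => im (phi (Complex x s))) (re (P - Q)).
Proof.
move=> /(_ (Complex 0 1)) [h1 h2].
have E (h : R) : Complex x y + cr h * Complex 0 1 = Complex x (y + h) :> C R.
  by apply: ceq; rewrite ?cE /=; ring.
have E0 : Complex x y + cr 0 * Complex 0 1 = Complex x y :> C R by apply: ceq; rewrite ?cE /=; ring.
have r1 : re (P * Complex 0 1 + Q * (Complex 0 1)^*) = im (Q - P) by rewrite !cE /=; ring.
have r2 : im (P * Complex 0 1 + Q * (Complex 0 1)^*) = re (P - Q) by rewrite !cE /=; ring.
rewrite r1 in h1; rewrite r2 in h2.
split; apply/is_derive_epsP => e e0.
  have [r r0 hr] := (is_derive_epsP _ _ _).1 h1 e e0; exists r => // h hh.
  by have := hr h hh; rewrite add0r E E0.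
have [r r0 hr] := (is_derive_epsP _ _ _).1 h2 e e0; exists r => // h hh.
by have := hr h hh; rewrite add0r E E0.
Qed.

Definition zc (p : R * R) : C R := Complex p.1 p.2.

Lemma zc_cont : continuous zc.
Proof.
move=> p A /nbhs_cmod[d d0 hd].
have : nbhs p [set q | `|p.1 - q.1| < d / 2 /\ `|p.2 - q.2| < d / 2].
  have d2 : 0 < d / 2 by rewrite divr_gt0.
  exists (ball p.1 (d / 2), ball p.2 (d / 2)) => /=; last by move=> [x y] /= [].
  by split; exact: nbhsx_ballx.
have hh : [set q | `|p.1 - q.1| < d / 2 /\ `|p.2 - q.2| < d / 2] `<=` [set q | A (zc q)].
  move=> q /= [h1 h2]; apply: hd; apply: le_lt_trans (cmod_le _) _; rewrite !cE /=.
  by rewrite distrC [`|q.2 - _|]distrC; lra.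
by move=> /(filterS hh).
Qed.

Record C2_at (f : jet R) (p : R * R) : Prop := {
  c0_at : continuous_at p (j0 f) ; cx_at : continuous_at p (jx f) ; cy_at : continuous_at p (jy f) ;
  cxx_at : continuous_at p (jxx f) ; cyy_at : continuous_at p (jyy f) ;
  dx_at : is_derive p.1 1 (fun s : R => j0 f (s, p.2)) (jx f p) ;
  dy_at : is_derive p.2 1 (fun s : R => j0 f (p.1, s)) (jy f p) ;
  dxx_at : is_derive p.1 1 (fun s : R => jx f (s, p.2)) (jxx f p) ;
  dyy_at : is_derive p.2 1 (fun s : R => jy f (p.1, s)) (jyy f p) }.

End Wirtinger.

Section LocalDensity.
Local Open Scope sesquilinear_scope.
Variables (R : realType) (n : nat) (V : set 'rV[C R]_n) (g : 'rV[C R]_n -> 'M[C R]_n).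
Hypothesis V_open : open V.
Hypothesis g_smooth : forall a b, smooth_on V (fun w => g w a b).
Hypothesis g_herm : forall w, V w -> (g w) ^t* = g w.
Hypothesis g_pos : forall w, V w -> forall W, W != 0 -> 0 < sqnorm (g w) W.
(** [F] is a holomorphic curve in the domain [V] of a chart. *)
Variables (O : set (C R)) (F F1 F2 F3 : 'I_n -> C R -> C R).
Hypothesis O_open : open O.
Hypothesis F_V : forall z, O z -> V (\row_b F b z).
Hypothesis dF : forall z b, O z -> cdiff (F b) z (F1 b z).
Hypothesis dF1 : forall z b, O z -> cdiff (F1 b) z (F2 b z).
Hypothesis dF2 : forall z b, O z -> cdiff (F2 b) z (F3 b z).
Hypothesis F3_cont : forall z b, O z -> continuous_at z (F3 b).

Let FF z : 'rV[C R]_n := \row_b F b z.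
(* FF, xi and ze are the curve and its two derivatives; dens, P, Q, X and Y are
   the squared length of F' and its derivatives along z, along the conjugate of z,
   along both, and twice along the conjugate. *)
Let G a b z := g (FF z) a b.
Let D c a b z := dw c (fun w => g w a b) (FF z).
Let Db c a b z := dwbar c (fun w => g w a b) (FF z).
Let H d c a b z := dw d (dwbar c (fun w => g w a b)) (FF z).
Let K d c a b z := dwbar d (dwbar c (fun w => g w a b)) (FF z).
Let xi z : 'rV[C R]_n := \row_b F1 b z.
Let ze z : 'rV[C R]_n := \row_b F2 b z.

Let dens z := hform (g (FF z)) (xi z) (xi z).
Let P z := deriv_P (g (FF z)) (fun a b c => D a b c z) (xi z) (ze z).
Let X z := mixed_X (g (FF z)) (fun a b c => D a b c z) (fun a b c => Db a b c z)
   (fun a b c d => H a b c d z) (xi z) (ze z).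
Let Q z := \sum_a \sum_b ((\sum_c Db c a b z * (F1 c z)^*) * F1 a z * (F1 b z)^*
   + G a b z * F1 a z * (F2 b z)^*).
Let Y z := \sum_a \sum_b (
   ((\sum_c ((\sum_d K d c a b z * (F1 d z)^*) * (F1 c z)^* + Db c a b z * (F2 c z)^*)) * F1 a z * (F1 b z)^*
    + (\sum_c Db c a b z * (F1 c z)^*) * F1 a z * (F2 b z)^*)
   + ((\sum_c Db c a b z * (F1 c z)^*) * F1 a z * (F2 b z)^* + G a b z * F1 a z * (F3 b z)^*)).

Let wG a b z : O z -> wirt (G a b) z (\sum_c D c a b z * F1 c z) (\sum_c Db c a b z * (F1 c z)^*).
Proof.
move=> Oz; have h : Ck_on 1 V (fun w => g w a b) by exact: g_smooth.
exact: (wirt_comp V_open h (F_V Oz) (fun b => dF b Oz)).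
Qed.

Let wDb c a b z : O z -> wirt (Db c a b) z (\sum_d H d c a b z * F1 d z) (\sum_d K d c a b z * (F1 d z)^*).
Proof.
move=> Oz; have h : Ck_on 1 V (dwbar c (fun w => g w a b)) by apply: Ck_dwbar => //; exact: g_smooth.
exact: (wirt_comp V_open h (F_V Oz) (fun b => dF b Oz)).
Qed.

Let w_dens z : O z -> wirt dens z (P z) (Q z).
Proof.
move=> Oz.
have -> : dens = (fun z => \sum_a \sum_b G a b z * F1 a z * (F1 b z)^*).
  by apply: funext => y; apply: eq_bigr => a _; apply: eq_bigr => b _; rewrite !mxE.
have h := wirt_sum (index_enum _) (fun a => wirt_sum (index_enum _) (fun b =>
  wirtM (wirtM (wG a b Oz) (wirt_holo (dF1 a Oz))) (wirt_antiholo (dF1 b Oz)))).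
apply: (wirt_eq h); apply: eq_bigr => a _; apply: eq_bigr => b _.
  rewrite !mxE.
  have -> : \sum_c D c a b z * xi z 0 c = \sum_c D c a b z * F1 c z.
    by apply: eq_bigr => c _; rewrite mxE.
  rewrite -/(G a b z); ring.
ring.
Qed.

Let w_Q z : O z -> wirt Q z (X z) (Y z).
Proof.
move=> Oz.
have wS a b := wirt_sum (index_enum _) (fun c => wirtM (wDb c a b Oz) (wirt_antiholo (dF1 c Oz))).
have h := wirt_sum (index_enum _) (fun a => wirt_sum (index_enum _) (fun b => wirtD
  (wirtM (wirtM (wS a b) (wirt_holo (dF1 a Oz))) (wirt_antiholo (dF1 b Oz)))
  (wirtM (wirtM (wG a b Oz) (wirt_holo (dF1 a Oz))) (wirt_antiholo (dF2 b Oz))))).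
apply: (wirt_eq h); apply: eq_bigr => a _; apply: eq_bigr => b _.
  rewrite !mxE.
  have -> : \sum_c (\sum_d H d c a b z * xi z 0 d) * (xi z 0 c)^* =
     \sum_c ((\sum_d H d c a b z * F1 d z) * (F1 c z)^* + Db c a b z * 0).
    apply: eq_bigr => c _; rewrite mulr0 addr0 mxE; congr (_ * _).
    by apply: eq_bigr => d _; rewrite mxE.
  have -> : \sum_c Db c a b z * (xi z 0 c)^* = \sum_c Db c a b z * (F1 c z)^*.
    by apply: eq_bigr => c _; rewrite mxE.
  have -> : \sum_c D c a b z * xi z 0 c = \sum_c D c a b z * F1 c z.
    by apply: eq_bigr => c _; rewrite mxE.
  rewrite -/(G a b z); ring.
ring.
Qed.

Let dens_real z : O z -> dens z = cr (re (dens z)).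
Proof. by move=> Oz; apply: hform_real; exact: g_pos (F_V Oz). Qed.

Let PQ z : O z -> P z = (Q z)^*.
Proof.
move=> Oz; apply: (wirt_real O_open Oz _ (w_dens Oz)).
by move=> w /dens_real ->.
Qed.

Let F_cont z b : O z -> continuous_at z (F b). Proof. by move=> Oz; exact: cdiff_continuous (dF b Oz). Qed.
Let F1_cont z b : O z -> continuous_at z (F1 b). Proof. by move=> Oz; exact: cdiff_continuous (dF1 b Oz). Qed.
Let F2_cont z b : O z -> continuous_at z (F2 b). Proof. by move=> Oz; exact: cdiff_continuous (dF2 b Oz). Qed.
Let FF_cont z : O z -> continuous_at z FF. Proof. by move=> Oz; apply: ct_row => b; exact: F_cont. Qed.

Let comp_cont (h : 'rV[C R]_n -> C R) z : O z -> Ck_on 0 V h -> continuous_at z (fun z => h (FF z)).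
Proof. by move=> Oz h0; apply: continuous_comp; [exact: FF_cont|exact: (h0 _ (F_V Oz))]. Qed.

Let G_cont a b z : O z -> continuous_at z (G a b).
Proof. by move=> Oz; apply: (comp_cont (h := fun w => g w a b)) => //; exact: g_smooth. Qed.
Let D_cont c a b z : O z -> continuous_at z (D c a b).
Proof.
move=> Oz; apply: (comp_cont (h := dw c (fun w => g w a b))) => //.
by apply: Ck_dw => //; exact: g_smooth.
Qed.
Let Db_cont c a b z : O z -> continuous_at z (Db c a b).
Proof.
move=> Oz; apply: (comp_cont (h := dwbar c (fun w => g w a b))) => //.
by apply: Ck_dwbar => //; exact: g_smooth.
Qed.
Let H_cont d c a b z : O z -> continuous_at z (H d c a b).
Proof.
move=> Oz; apply: (comp_cont (h := dw d (dwbar c (fun w => g w a b)))) => //.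
by apply: Ck_dw => //; apply: Ck_dwbar => //; exact: g_smooth.
Qed.
Let K_cont d c a b z : O z -> continuous_at z (K d c a b).
Proof.
move=> Oz; apply: (comp_cont (h := dwbar d (dwbar c (fun w => g w a b)))) => //.
by apply: Ck_dwbar => //; apply: Ck_dwbar => //; exact: g_smooth.
Qed.

Let dens_cont z : O z -> continuous_at z dens.
Proof.
move=> Oz; have -> : dens = (fun z => \sum_a \sum_b G a b z * F1 a z * (F1 b z)^*).
  by apply: funext => y; apply: eq_bigr => a _; apply: eq_bigr => b _; rewrite !mxE.
apply: ctS => a; apply: ctS => b; apply: ctM; last by apply: ctJ; exact: F1_cont.
by apply: ctM; [exact: G_cont|exact: F1_cont].
Qed.

Let SDb_cont a b z : O z -> continuous_at z (fun z => \sum_c Db c a b z * (F1 c z)^*).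
Proof. by move=> Oz; apply: ctS => c; apply: ctM; [exact: Db_cont|apply: ctJ; exact: F1_cont]. Qed.

Let Q_cont z : O z -> continuous_at z Q.
Proof.
move=> Oz; apply: ctS => a; apply: ctS => b; apply: ctD; apply: ctM.
- by apply: ctM; [exact: SDb_cont|exact: F1_cont].
- by apply: ctJ; exact: F1_cont.
- by apply: ctM; [exact: G_cont|exact: F1_cont].
- by apply: ctJ; exact: F2_cont.
Qed.

Let Y_cont z : O z -> continuous_at z Y.
Proof.
move=> Oz; apply: ctS => a; apply: ctS => b; apply: ctD; apply: ctD; apply: ctM.
- apply: ctM; last exact: F1_cont.
  apply: ctS => c; apply: ctD; apply: ctM.
  + by apply: ctS => d; apply: ctM; [exact: K_cont|apply: ctJ; exact: F1_cont].
  + by apply: ctJ; exact: F1_cont.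
  + exact: Db_cont.
  + by apply: ctJ; exact: F2_cont.
- by apply: ctJ; exact: F1_cont.
- by apply: ctM; [exact: SDb_cont|exact: F1_cont].
- by apply: ctJ; exact: F2_cont.
- by apply: ctM; [exact: SDb_cont|exact: F1_cont].
- by apply: ctJ; exact: F2_cont.
- by apply: ctM; [exact: G_cont|exact: F1_cont].
- by apply: ctJ; exact: F3_cont.
Qed.

Let X_cont z : O z -> continuous_at z X.
Proof.
move=> Oz; have -> : X = (fun z => \sum_a \sum_b
  ((\sum_c (\sum_d H d c a b z * F1 d z) * (F1 c z)^*) * F1 a z * (F1 b z)^*
   + (\sum_c Db c a b z * (F1 c z)^*) * F2 a z * (F1 b z)^*
   + (\sum_c D c a b z * F1 c z) * F1 a z * (F2 b z)^* + G a b z * F2 a z * (F2 b z)^*)).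
  apply: funext => y; apply: eq_bigr => a _; apply: eq_bigr => b _; rewrite !mxE.
  congr (_ * _ * _ + _ * _ * _ + _ * _ * _ + _); apply: eq_bigr => c _; rewrite mxE//.
  by congr (_ * _); apply: eq_bigr => d _; rewrite mxE.
apply: ctS => a; apply: ctS => b; apply: ctD; [apply: ctD; [apply: ctD|]|]; apply: ctM.
- apply: ctM; last exact: F1_cont.
  apply: ctS => c; apply: ctM; last by apply: ctJ; exact: F1_cont.
  by apply: ctS => d; apply: ctM; [exact: H_cont|exact: F1_cont].
- by apply: ctJ; exact: F1_cont.
- by apply: ctM; [exact: SDb_cont|exact: F2_cont].
- by apply: ctJ; exact: F1_cont.
- apply: ctM; last exact: F1_cont.
  by apply: ctS => c; apply: ctM; [exact: D_cont|exact: F1_cont].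
- by apply: ctJ; exact: F2_cont.
- by apply: ctM; [exact: G_cont|exact: F2_cont].
- by apply: ctJ; exact: F2_cont.
Qed.

Let Db_conj z b m d : O z -> Db b m d z = (D b d m z)^*.
Proof.
move=> Oz; have Vz := F_V Oz; rewrite /Db /D /dw /dwbar.
have E v : real_derive v (fun w => g w m d) (FF z) = (real_derive v (fun w => g w d m) (FF z))^*.
  have h : Ck_on 1 V (fun w => g w d m) by exact: g_smooth.
  have hd := cder_conj (real_derivableP ((h v).1 _ Vz)).
  have hn : \forall t \near (0 : R), (g (FF z + cr t *: v) d m)^* = g (FF z + cr t *: v) m d.
    by apply: filterS (line_near v V_open Vz) => t Vt; rewrite (g_conj (g_herm Vt)).
  by have [_ h1] := @cder_real_derive R n (fun w => g w m d) (FF z) v _ (cder_near hn hd).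
rewrite !E; move: (real_derive _ _ _) (real_derive _ _ _) => A B.
by rewrite fmorph_div /= rmorphB rmorphM /= conjCi rmorph_nat mulNr opprK.
Qed.

(** The numerator of the holomorphic sectional curvature in the direction [F']. *)
Definition curv_at z : R := re (\sum_a \sum_b \sum_c \sum_d
  curvature g (FF z) a b c d * xi z 0 a * (xi z 0 b)^* * xi z 0 c * (xi z 0 d)^* : C R).

(** As [dens] is real, [P] is the conjugate of [Q], whence these real derivatives. *)
Definition density_jet : jet R := Jet (fun p => re (dens (zc p)))
  (fun p => 2 * re (Q (zc p))) (fun p => 2 * im (Q (zc p)))
  (fun p => 2 * re (X (zc p) + Y (zc p))) (fun p => 2 * re (X (zc p) - Y (zc p))).

Lemma density_jet0 p : j0 density_jet p = re (sqnorm (g (FF (zc p))) (xi (zc p))).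
Proof. by []. Qed.

Lemma density_C2 p : O (zc p) -> C2_at density_jet p.
Proof.
move=> Op.
have ct (f : C R -> C R) : continuous_at (zc p) f -> continuous_at p (fun p => f (zc p)).
  by move=> cf; apply: continuous_comp; [exact: zc_cont|].
have ct2 (f : R * R -> R) : continuous_at p f -> continuous_at p (fun p => 2 * f p).
  move=> cf; have c2 : continuous_at p (fun=> 2 : R) by exact: cvg_cst.
  by apply: (@cvgM _ _ (nbhs p) _ (fun=> 2) f).
have NY : continuous_at (zc p) (fun z => X z - Y z).
  by apply: ctD; [exact: X_cont|exact: (cvgN (Y_cont Op))].
split => /=.
- by apply: cont_re_at; apply: ct; exact: dens_cont.
- by apply: ct2; apply: cont_re_at; apply: ct; exact: Q_cont.
- by apply: ct2; apply: cont_im_at; apply: ct; exact: Q_cont.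
- apply: ct2; apply: cont_re_at; apply: (ct (fun z => X z + Y z)).
  by apply: ctD; [exact: X_cont|exact: Y_cont].
- by apply: ct2; apply: cont_re_at; exact: (ct (fun z => X z - Y z)).
- have [h _] := @slice_x _ _ p.1 p.2 _ _ (w_dens Op); apply: (is_derive_eq h).
  by rewrite (PQ Op) !cE; ring.
- have [h _] := @slice_y _ _ p.1 p.2 _ _ (w_dens Op); apply: (is_derive_eq h).
  by rewrite (PQ Op) !cE; ring.
- have [h _] := @slice_x _ _ p.1 p.2 _ _ (w_Q Op).
  by have h2 := is_deriveZ 2 h; apply: (is_derive_eq h2).
- have [_ h] := @slice_y _ _ p.1 p.2 _ _ (w_Q Op).
  by have h2 := is_deriveZ 2 h; apply: (is_derive_eq h2).
Qed.

(** The Laplacian of [dens] is [4 re X] and the square of its gradient is [4 |P|^2]. *)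
Lemma density_ineq p : O (zc p) ->
  - 4 * (j0 density_jet p * curv_at (zc p)) <= j0 density_jet p * lap density_jet p - grad2 density_jet p
  /\ - 4 * curv_at (zc p) <= lap density_jet p.
Proof.
move=> Op; have Vz := F_V Op.
have lE : lap density_jet p = 4 * re (X (zc p)) by rewrite /lap /= !cE; ring.
have gE : grad2 density_jet p = 4 * cmod (P (zc p)) ^+ 2.
  by rewrite (PQ Op) cmod_conj cmod_sqr /grad2 /=; ring.
have dbc b m d : Db b m d (zc p) = (D b d m (zc p))^* by exact: Db_conj.
have h1 := @curv_log _ _ _ (g_herm Vz) (g_pos Vz) _ _ (fun a b c d => H a b c d (zc p)) dbc (xi (zc p)) (ze (zc p)).
have h2 := @curv_lap _ _ _ (g_herm Vz) (g_pos Vz) _ _ (fun a b c d => H a b c d (zc p)) dbc (xi (zc p)) (ze (zc p)).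
rewrite lE gE; split; last by rewrite mulNr -mulrN ler_pM2l//; exact: h2.
have -> : j0 density_jet p * (4 * re (X (zc p))) - 4 * cmod (P (zc p)) ^+ 2 =
  4 * (j0 density_jet p * re (X (zc p)) - cmod (P (zc p)) ^+ 2) by ring.
by rewrite mulNr -mulrN ler_pM2l//; exact: h1.
Qed.

End LocalDensity.

(** * Gluing local C^2 structures *)

Section Gluing.
Variable R : realType.
Let T := (R * R)%type.
Implicit Types (j k : jet R) (p : T).

Definition jet_eq j k p := [/\ j0 j p = j0 k p, jx j p = jx k p, jy j p = jy k p,
  jxx j p = jxx k p & jyy j p = jyy k p].

Lemma near_slice_x (A : T -> Prop) p : (\forall q \near p, A q) -> \forall s \near p.1, A (s, p.2).
Proof.
case: p => x y [[P Q] /= [hP hQ] h]; apply: filterS hP => s Ps.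
by apply: (h (s, y)); split=> //=; exact: nbhs_singleton hQ.
Qed.

Lemma near_slice_y (A : T -> Prop) p : (\forall q \near p, A q) -> \forall s \near p.2, A (p.1, s).
Proof.
case: p => x y [[P Q] /= [hP hQ] h]; apply: filterS hQ => s Qs.
by apply: (h (x, s)); split=> //=; exact: nbhs_singleton hP.
Qed.

Lemma derive_near_eq (a b : R -> R) (t da db : R) : (\forall s \near t, a s = b s) ->
  is_derive t 1 a da -> is_derive t 1 b db -> da = db.
Proof.
move=> h ha hb; have hc := is_derive_near h ha.
by rewrite -(@derive_val _ _ _ _ _ _ _ hb) (@derive_val _ _ _ _ _ _ _ hc).
Qed.

(** The derivatives are determined by the values near the point. *)
Lemma jet_uniq j k p :
  (\forall q \near p, [/\ C2_at j q, C2_at k q & j0 j q = j0 k q]) -> jet_eq j k p.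
Proof.
move=> H; have H2 := (@nbhs_interior _ p _ H).
have first q : (\forall q' \near q, [/\ C2_at j q', C2_at k q' & j0 j q' = j0 k q']) ->
    jx j q = jx k q /\ jy j q = jy k q.
  move=> Hq; have [hj hk _] := nbhs_singleton Hq; split.
    apply: derive_near_eq (dx_at hj) (dx_at hk).
    by apply: (@near_slice_x (fun q => j0 j q = j0 k q)); apply: filterS Hq => q' [].
  apply: derive_near_eq (dy_at hj) (dy_at hk).
  by apply: (@near_slice_y (fun q => j0 j q = j0 k q)); apply: filterS Hq => q' [].
have [hj hk e0] := nbhs_singleton H; have [ex ey] := first _ H; split=> //.
  apply: derive_near_eq (dxx_at hj) (dxx_at hk).
  by apply: (@near_slice_x (fun q => jx j q = jx k q)); apply: filterS H2 => q' /first[].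
apply: derive_near_eq (dyy_at hj) (dyy_at hk).
by apply: (@near_slice_y (fun q => jy j q = jy k q)); apply: filterS H2 => q' /first[].
Qed.

Variables (u : T -> R) (loc : T -> jet R).
Hypothesis loc_C2 : forall p, \forall q \near p, C2_at (loc p) q /\ j0 (loc p) q = u q.

(** The jets [loc p] agree where they are both valid, so their derivatives can be
    read off at the point [p] itself. *)
Definition glued_jet := Jet u (fun p => jx (loc p) p) (fun p => jy (loc p) p)
  (fun p => jxx (loc p) p) (fun p => jyy (loc p) p).

Lemma glued_jetE p : jet_eq (loc p) glued_jet p.
Proof. by split=> //=; have [] := nbhs_singleton (loc_C2 p). Qed.

Lemma glued_near p : \forall q \near p, jet_eq (loc p) glued_jet q.
Proof.
have := @nbhs_interior _ p _ (loc_C2 p); apply: filterS => q Hq.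
have : jet_eq (loc p) (loc q) q.
  apply: jet_uniq; apply: filterS2 Hq (loc_C2 q) => q' [h1 e1] [h2 e2].
  by split=> //; rewrite e1 e2.
have [a1 a2 a3 a4 a5] := glued_jetE q; move=> [b1 b2 b3 b4 b5].
by split; [rewrite b1|rewrite b2|rewrite b3|rewrite b4|rewrite b5].
Qed.

Lemma glued_C2 : isC2 glued_jet.
Proof.
have cont (P Q : T -> R) p : (\forall q \near p, P q = Q q) -> continuous_at p P -> continuous_at p Q.
  move=> h cP; rewrite /continuous_at -(nbhs_singleton h); apply: cvg_trans cP.
  by apply: near_eq_cvg; apply: filterS h => q ->.
have S p := (nbhs_singleton (loc_C2 p)).1.
split.
- by move=> p; apply: (cont (j0 (loc p)) _ _ _ (c0_at (S p))); apply: filterS (glued_near p) => q [].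
- by move=> p; apply: (cont (jx (loc p)) _ _ _ (cx_at (S p))); apply: filterS (glued_near p) => q [].
- by move=> p; apply: (cont (jy (loc p)) _ _ _ (cy_at (S p))); apply: filterS (glued_near p) => q [].
- by move=> p; apply: (cont (jxx (loc p)) _ _ _ (cxx_at (S p))); apply: filterS (glued_near p) => q [].
- by move=> p; apply: (cont (jyy (loc p)) _ _ _ (cyy_at (S p))); apply: filterS (glued_near p) => q [].
- move=> x y; apply: (is_derive_near _ (dx_at (S (x, y)))).
  apply: (@near_slice_x (fun q => j0 (loc (x, y)) q = u q) (x, y)).
  by apply: filterS (glued_near (x, y)) => q [].
- move=> x y; apply: (is_derive_near _ (dy_at (S (x, y)))).
  apply: (@near_slice_y (fun q => j0 (loc (x, y)) q = u q) (x, y)).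
  by apply: filterS (glued_near (x, y)) => q [].
- move=> x y; apply: (is_derive_near _ (dxx_at (S (x, y)))).
  apply: (@near_slice_x (fun q => jx (loc (x, y)) q = jx glued_jet q) (x, y)).
  by apply: filterS (glued_near (x, y)) => q [].
- move=> x y; apply: (is_derive_near _ (dyy_at (S (x, y)))).
  apply: (@near_slice_y (fun q => jy (loc (x, y)) q = jy glued_jet q) (x, y)).
  by apply: filterS (glued_near (x, y)) => q [].
Qed.

End Gluing.

(** * The projective line *)

Section ProjectiveLine.
Local Open Scope quotient_scope.
Variable R : realType.
Local Notation X := (CP1_space R).
Local Notation E := (punctured_plane R).

Lemma line_ofE (v w : E) (a : C R) : a != 0 -> \val w = a *: \val v -> line_of v = line_of w.
Proof. by move=> a0 h; apply/eqmodP; apply/asboolP; exists a. Qed.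

Lemma homog_line (v : E) : exists2 a : C R, a != 0 & homog (line_of v) = a *: \val v.
Proof.
have : (v == repr (line_of v : {eq_quot collinear_equiv R}) %[mod {eq_quot collinear_equiv R}]).
  by rewrite reprK.
by rewrite eqmodE => /asboolP[a a0 h]; exists a.
Qed.

Lemma homog_neq0 (p : X) : homog p != 0.
Proof. by have := valP (repr (p : {eq_quot collinear_equiv R})); rewrite inE. Qed.

Lemma line_of_homog (p : X) (v : E) (a : C R) : a != 0 -> \val v = a *: homog p -> line_of v = p.
Proof.
move=> a0 h; rewrite -[RHS](reprK (p : {eq_quot collinear_equiv R})).
by apply: esym; exact: line_ofE a0 h.
Qed.

Lemma line_of_continuous : continuous (@line_of R).
Proof. exact: (@pi_continuous _ {eq_quot collinear_equiv R}). Qed.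

Lemma val_continuous : continuous (fun v : E => \val v).
Proof. exact: initial_continuous. Qed.

Lemma to_plane_continuous (T : topologicalType) (f : T -> E) : continuous (fun t => \val (f t)) -> continuous f.
Proof. by move=> cf; apply: continuous_comp_initial. Qed.

(** The projective line carries the quotient topology, and [homog] returns a multiple
    of any other representative. *)
Lemma homog_continuous (h : 'rV[C R]_2 -> C R) :
  (forall v : 'rV[C R]_2, v != 0 -> continuous_at v h) ->
  (forall (a : C R) (v : 'rV[C R]_2), a != 0 -> h (a *: v) = h v) -> continuous (fun p : X => h (homog p)).
Proof.
move=> ch hh; apply/(@quotient_continuous _ {eq_quot collinear_equiv R}).
have -> : (fun p : X => h (homog p)) \o \pi_{eq_quot collinear_equiv R} = (fun v : E => h (\val v)).
  apply: funext => v /=; have [a a0 /= e] := homog_line v.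
  have e' : h (homog (line_of v)) = h (\val v) by rewrite e hh.
  exact: e'.
move=> v; apply: continuous_comp; first exact: val_continuous.
by apply: ch; have := valP v; rewrite inE.
Qed.

Lemma separated_hausdorff (T Z : topologicalType) (I : Type) (h : I -> T -> Z) : hausdorff_space Z ->
  (forall i, continuous (h i)) -> (forall p q, (forall i, h i p = h i q) -> p = q) -> hausdorff_space T.
Proof.
move=> hZ ch inj p q pq; apply: inj => i; apply: hZ => A B hA hB.
have [x [Ax Bx]] := pq _ _ (ch i p _ hA) (ch i q _ hB).
by exists (h i x).
Qed.

Let n2 (v : 'rV[C R]_2) : C R := v 0 0 * (v 0 0)^* + v 0 1 * (v 0 1)^*.

Lemma row2_eq0 (v : 'rV[C R]_2) : v 0 0 = 0 -> v 0 1 = 0 -> v = 0.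
Proof.
move=> h0 h1; apply/rowP => i; rewrite mxE.
by case: (unliftP 0 i) => [j ->|-> //]; rewrite (ord1 j) -h1; congr (v _ _); apply: val_inj.
Qed.

Let n2_neq0 v : v != 0 -> n2 v != 0.
Proof.
apply: contraNneq; rewrite /n2 -!normCK => /eqP.
rewrite paddr_eq0 ?exprn_ge0// !expf_eq0 !normr_eq0 /= => /andP[/eqP h0 /eqP h1].
by rewrite (row2_eq0 h0 h1).
Qed.

(* The first column of the orthogonal projector onto the line spanned by v, which
   determines the line. *)
Let sep (i : bool) (v : 'rV[C R]_2) : C R := (if i then v 0 0 else v 0 1) * (v 0 0)^* / n2 v.

Let coord_ct (v : 'rV[C R]_2) i : continuous_at v (fun v : 'rV[C R]_2 => v 0 i).
Proof. exact: coord_continuous. Qed.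

Let conj_ct (v : 'rV[C R]_2) i : continuous_at v (fun v : 'rV[C R]_2 => (v 0 i)^*).
Proof.
move=> A /nbhs_cmod[d d0 hd]; apply/nbhs_row; exists d => // w hw /=; apply: hd.
by rewrite -rmorphB cmod_conj; exact: hw.
Qed.

Lemma CP1_hausdorff : hausdorff_space X.
Proof.
apply: (@separated_hausdorff _ (C R) bool (fun i p => sep i (homog p))); first exact: norm_hausdorff.
  move=> i; apply: homog_continuous => [v v0|a v a0].
    have c2 : continuous_at v n2.
      by apply: (@cvgD _ _ _ (nbhs v) _ (fun v => v 0 0 * (v 0 0)^*)); apply: (@cvgM _ _ (nbhs v)); (exact: coord_ct || exact: conj_ct).
    have cV : continuous_at v (fun v => (n2 v)^-1) by exact: (cvgV (n2_neq0 v0) c2).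
    have cN : continuous_at v (fun v : 'rV[C R]_2 => (if i then v 0 0 else v 0 1) * (v 0 0)^*).
      by case: i; apply: (@cvgM _ _ (nbhs v)); (exact: coord_ct || exact: conj_ct).
    exact: (@cvgM _ _ (nbhs v) _ _ _ _ _ cN cV).
  have a2 : a * a^* != 0 by rewrite mulf_neq0 ?conjC_eq0.
  rewrite /sep /n2 !mxE !rmorphM /=.
  have -> : a * v 0 0 * (a^* * (v 0 0)^*) + a * v 0 1 * (a^* * (v 0 1)^*) = a * a^* * n2 v.
    by rewrite /n2; ring.
  have -> : (if i then a * v 0 0 else a * v 0 1) = a * (if i then v 0 0 else v 0 1) by case: i.
  by rewrite mulrACA -mulf_div divff// mul1r.
move=> p q h; have ht : sep true (homog p) = sep true (homog q) := h true.
have hf : sep false (homog p) = sep false (homog q) := h false.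
have hp := n2_neq0 (homog_neq0 p); have hq := n2_neq0 (homog_neq0 q).
have zz (v : 'rV[C R]_2) : v != 0 -> sep true v = 0 -> v 0 0 = 0.
  move=> v0 /eqP; rewrite /sep !mulf_eq0 invr_eq0 (negbTE (n2_neq0 v0)) orbF conjC_eq0 orbb.
  by move/eqP.
rewrite -[LHS](reprK (p : {eq_quot collinear_equiv R})) -[RHS](reprK (q : {eq_quot collinear_equiv R})).
have [e|e] := eqVneq (homog p 0 0) 0.
  have sp : sep true (homog p) = 0 by rewrite /sep e mul0r mul0r.
  have e' : homog q 0 0 = 0 by apply: zz; [exact: homog_neq0|rewrite -ht].
  have f1 : homog p 0 1 != 0 by apply: contraNneq (homog_neq0 p) => /(row2_eq0 e) ->.
  have f2 : homog q 0 1 != 0 by apply: contraNneq (homog_neq0 q) => /(row2_eq0 e') ->.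
  apply: (@line_ofE _ _ (homog q 0 1 / homog p 0 1)); first by rewrite mulf_neq0// invr_eq0.
  apply/eqP; rewrite -subr_eq0; apply/eqP; apply: row2_eq0; rewrite !mxE -/(homog p) -/(homog q).
    by rewrite e e' mulr0 subrr.
  by rewrite divfK// subrr.
have e' : homog q 0 0 != 0.
  apply: contraNneq e => h0; apply/eqP; apply: zz; first exact: homog_neq0.
  by rewrite ht /sep h0 mul0r mul0r.
apply: (@line_ofE _ _ (homog q 0 0 / homog p 0 0)); first by rewrite mulf_neq0// invr_eq0.
apply/eqP; rewrite -subr_eq0; apply/eqP; apply: row2_eq0; rewrite !mxE -/(homog p) -/(homog q).
  by rewrite divfK// subrr.
have quo (v : 'rV[C R]_2) : v != 0 -> v 0 0 != 0 -> sep false v / sep true v = v 0 1 / v 0 0.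
  move=> v0 w0; rewrite /sep; have := n2_neq0 v0; have : (v 0 0)^* != 0 by rewrite conjC_eq0.
  by move: (n2 v) (_^*) => A B B0 A0; field; rewrite w0 A0 B0.
have := quo _ (homog_neq0 p) e; rewrite ht hf quo ?homog_neq0// => k.
have -> : homog q 0 1 = homog q 0 0 * (homog q 0 1 / homog q 0 0) by rewrite mulrCA divff ?mulr1.
by rewrite k; apply/eqP; rewrite subr_eq0; apply/eqP; ring.
Qed.

End ProjectiveLine.

Section AffinePoints.
Variable R : realType.
Local Notation X := (CP1_space R).

Definition pt (i : 'I_2) (z : C R) : X := chart_inv (CP1_chart R i) (const_mx z).

Lemma homog_pt i z : exists2 a : C R, a != 0 & homog (pt i z) = a *: affine_vec i z.
Proof.
have [a a0 h] := homog_line (exist _ (affine_vec i z) (affine_vec_neq0 i z)).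
exists a => //; rewrite -h /pt /=; congr (homog (line_of _)); apply: val_inj => /=.
by rewrite mxE.
Qed.

Lemma dom_pt i z : chart_dom (CP1_chart R i) (pt i z).
Proof. by have [a a0 h] := homog_pt i z; rewrite /= h !mxE eqxx mulr1. Qed.

Lemma chart_pt i z : CP1_chart R i (pt i z) = const_mx z.
Proof.
have [a a0 h] := homog_pt i z; rewrite /= h !mxE eqxx mulr1.
have -> : (rev_ord i == i) = false by case: i {h} => [[|[|k]] hk].
by congr const_mx; rewrite mulrAC divff// mul1r.
Qed.

Lemma affine_continuous i : continuous (fun z : C R => affine_vec i z).
Proof.
move=> z A /nbhs_row[d d0 hd]; apply/nbhs_cmod; exists d => // w hw /=; apply: hd => b.
by rewrite !mxE; case: ifP => _; rewrite ?subrr ?cmod0.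
Qed.

Lemma pt_continuous i : continuous (pt i).
Proof.
have -> : pt i = (@line_of R) \o (fun z => exist _ (affine_vec i z) (affine_vec_neq0 i z)).
  by apply: funext => z; rewrite /pt /=; congr line_of; apply: val_inj; rewrite /= mxE.
move=> z; apply: continuous_comp; last exact: line_of_continuous.
by apply: to_plane_continuous; exact: affine_continuous.
Qed.

Lemma pt_swap z : z != 0 -> pt 0 z = pt 1 z^-1.
Proof.
move=> z0; rewrite /pt /=; apply: (@line_ofE _ _ _ z^-1); first by rewrite invr_eq0.
apply/rowP => k; rewrite /= !mxE; case: (unliftP 0 k) => [j ->|->].
  by rewrite (ord1 j) /= mulVf.
by rewrite /= mulr1.
Qed.

Lemma pt_cover (p : X) : (exists z, p = pt 0 z) \/ p = pt 1 0.
Proof.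
have [e|e] := eqVneq (homog p 0 0) 0; [right|left].
  have f : homog p 0 1 != 0 by apply: contraNneq (homog_neq0 p) => /(row2_eq0 e) ->.
  apply: esym; apply: (@line_of_homog _ _ _ (homog p 0 1)^-1); first by rewrite invr_eq0.
  apply/eqP; rewrite -subr_eq0; apply/eqP; apply: row2_eq0; rewrite /= !mxE /=.
    by rewrite e mulr0 subrr.
  by rewrite mulVf// subrr.
exists (homog p 0 1 / homog p 0 0).
apply: esym; apply: (@line_of_homog _ _ _ (homog p 0 0)^-1); first by rewrite invr_eq0.
apply/eqP; rewrite -subr_eq0; apply/eqP; apply: row2_eq0; rewrite /= !mxE /=.
  by rewrite mulVf// subrr.
by rewrite mulrC subrr.
Qed.

End AffinePoints.

Section CellStructure.
Variable R : realType.
Local Notation X := (CP1_space R).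

Let dimc (b : bool) : nat := if b then 2 else 0.
Let zv (v : 'rV[R]_2) : C R := Complex (v 0 0) (v 0 1).
Let ht (v : 'rV[R]_2) : R := Num.sqrt (1 - \sum_i v 0 i ^+ 2).

Let sum2 (v : 'rV[R]_2) : \sum_i v 0 i ^+ 2 = cmod (zv v) ^+ 2.
Proof. by rewrite big_ord_recl big_ord1 cmod_sqr; congr (_ + v _ _ ^+ 2); apply: val_inj. Qed.

Let cellv (v : 'rV[R]_2) : 'rV[C R]_2 := \row_k (if k == 0 then cr (ht v) else zv v).

Let cellv_neq0 v : cellv v \in [set v : 'rV[C R]_2 | v != 0].
Proof.
rewrite inE /=; apply/eqP => /rowP h.
have h0 := h 0; have h1 := h 1; rewrite !mxE /= in h0 h1.
move: h0; rewrite /ht sum2 h1 cmod0 expr0n subr0 sqrtr1 => /(congr1 (fun z : C R => complex.Re z)) /eqP.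
by rewrite /= oner_eq0.
Qed.

(* v |-> [sqrt (1 - |v|^2) : v] maps the open disc bijectively to the affine line and
   the unit circle to the point [0 : 1]. *)
Let disc (v : 'rV[R]_2) : X := line_of (exist _ (cellv v) (cellv_neq0 v)).

Let Phi b : 'rV[R]_(dimc b) -> X :=
  match b with true => disc | false => fun=> pt 1 0 end.

Let ht_gt0 v : open_disc v -> 0 < ht v /\ ht v ^+ 2 = 1 - cmod (zv v) ^+ 2.
Proof.
rewrite /open_disc /= sum2 -subr_gt0 /ht sum2 => h; split; first by rewrite sqrtr_gt0.
by rewrite sqr_sqrtr//; exact: ltW h.
Qed.

Let disc_pt v : open_disc v -> disc v = pt 0 (zv v / cr (ht v)).
Proof.
move=> /ht_gt0[h0 _]; have c0 : cr (ht v) != 0 by rewrite -cmod_gt0 cmod_cr gtr0_norm.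
apply: (@line_ofE _ _ _ (cr (ht v))^-1); first by rewrite invr_eq0.
apply/eqP; rewrite -subr_eq0; apply/eqP; apply: row2_eq0; rewrite /= !mxE /=.
  by rewrite mulVf// subrr.
by rewrite mulrC subrr.
Qed.

Let pt0_inj (z w : C R) : pt 0 z = pt 0 w -> z = w.
Proof.
move=> h; have : const_mx z = const_mx w :> 'rV[C R]_1 by rewrite -(chart_pt 0) h chart_pt.
by move=> /rowP/(_ 0); rewrite !mxE.
Qed.

Let pt0_neq (z : C R) : pt 0 z <> pt 1 0.
Proof.
move=> h; have [a a0 e] := homog_pt 1 (0 : C R); have := dom_pt 0 z; rewrite h /= e !mxE /=.
by rewrite mulr0 eqxx.
Qed.

Let disc_inj v w : open_disc v -> open_disc w -> disc v = disc w -> v = w.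
Proof.
move=> hv hw; rewrite !disc_pt// => /pt0_inj h.
have [hv0 ev] := ht_gt0 hv; have [hw0 ew] := ht_gt0 hw.
have e : cmod (zv v) / ht v = cmod (zv w) / ht w.
  by have := congr1 (@cmod R) h; rewrite !cmodM !cmodV !cmod_cr !gtr0_norm.
have k : ht v ^+ 2 = ht w ^+ 2.
  have : (cmod (zv v) * ht w) ^+ 2 = (cmod (zv w) * ht v) ^+ 2.
    congr (_ ^+ 2); have -> : cmod (zv v) = cmod (zv w) / ht w * ht v by rewrite -e divfK// gt_eqF.
    by rewrite mulrAC divfK// gt_eqF.
  rewrite !exprMn; have -> : cmod (zv v) ^+ 2 = 1 - ht v ^+ 2 by lra.
  have -> : cmod (zv w) ^+ 2 = 1 - ht w ^+ 2 by lra.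
  lra.
have {}k : ht v = ht w by apply/eqP; rewrite -(eqrXn2 (n := 2))// ?ltW// k.
have c0 : cr (ht w) != 0 by rewrite -cmod_gt0 cmod_cr gtr0_norm.
move: h; rewrite k => /(congr1 (fun z => z * cr (ht w))); rewrite !divfK// => -[h0 h1].
apply/rowP => i; case: (unliftP 0 i) => [j ->|->//].
have -> : lift 0 j = 1 by rewrite (ord1 j); apply: val_inj.
by [].
Qed.

(* |v|^2 = |z|^2 / (1 + |z|^2) is the solution of |v|^2 / (1 - |v|^2) = |z|^2 *)
Let disc_surj (z : C R) : exists2 v, open_disc v & disc v = pt 0 z.
Proof.
pose s : R := (Num.sqrt (1 + cmod z ^+ 2))^-1.
have p0 : 0 < 1 + cmod z ^+ 2 by rewrite ltr_wpDr// sqr_ge0.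
have s0 : 0 < s by rewrite invr_gt0 sqrtr_gt0.
have s2 : s ^+ 2 = (1 + cmod z ^+ 2)^-1 by rewrite exprVn sqr_sqrtr// ltW.
pose v : 'rV[R]_2 := \row_i (if i == 0 then re z * s else im z * s).
have zE : zv v = z * cr s by apply: ceq; rewrite /zv !mxE !cE /=; ring.
have nE : cmod (zv v) ^+ 2 = 1 - s ^+ 2.
  rewrite zE cmodM cmod_cr gtr0_norm// exprMn s2; field; exact: lt0r_neq0.
have hs : ht v = s by rewrite /ht sum2 nE opprB addrC subrK sqrtr_sqr gtr0_norm.
have dv : open_disc v by rewrite /open_disc /= sum2 nE gtrDl oppr_lt0 exprn_gt0.
exists v => //; rewrite disc_pt// hs zE mulfK//.
by rewrite -cmod_gt0 cmod_cr gtr0_norm.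
Qed.

Let disc_continuous : continuous disc.
Proof.
have cc i : continuous (fun v : 'rV[R]_2 => v 0 i) by move=> v; exact: coord_continuous.
have c_ht : continuous ht.
  have E : (fun v : 'rV[R]_2 => 1 - \sum_i v 0 i ^+ 2) = (fun v => 1 - (v 0 0 * v 0 0 + v 0 1 * v 0 1)).
    by apply: funext => w; rewrite sum2 cmod_sqr !expr2.
  have c : continuous (fun v : 'rV[R]_2 => 1 - \sum_i v 0 i ^+ 2).
    have m i v : continuous_at v (fun v : 'rV[R]_2 => v 0 i * v 0 i).
      exact: (@cvgM _ _ (nbhs v) _ _ _ _ _ (cc i v) (cc i v)).
    have d v : continuous_at v (fun v : 'rV[R]_2 => v 0 0 * v 0 0 + v 0 1 * v 0 1).
      exact: (@cvgD _ _ _ (nbhs v) _ _ _ _ _ (m 0 v) (m 1 v)).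
    have o (v : 'rV[R]_2) : continuous_at v (fun _ : 'rV[R]_2 => 1 : R) by exact: cst_continuous.
    by rewrite E => v; exact: (@cvgB _ _ _ (nbhs v) _ _ _ _ _ (o v) (d v)).
  move=> v; exact: (@continuous_comp _ _ _ (fun v : 'rV[R]_2 => 1 - \sum_i v 0 i ^+ 2) Num.sqrt v (c v) (@sqrt_continuous R _)).
have near (f : 'rV[R]_2 -> R) v d : continuous f -> 0 < d -> \forall w \near v, `|f w - f v| < d.
  move=> cf d0; have := @cvgr_distC_lt _ _ _ _ _ f (f v) (cf v) d d0; exact.
pose e v : punctured_plane R := exist _ (cellv v) (cellv_neq0 v).
have ce : continuous e.
  apply: to_plane_continuous => v A /nbhs_row[d d0 hd] /=.
  have d2 : 0 < d / 2 by rewrite divr_gt0.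
  have := near _ v _ c_ht d2; have := near _ v _ (cc 0) d2; have := near _ v _ (cc 1) d2.
  apply: filterS3 => w h1 h0 h; apply: hd => b; rewrite !mxE; case: ifP => _.
    by rewrite -crN -crD cmod_cr; lra.
  by apply: le_lt_trans (cmod_le _) _; rewrite !cE /=; lra.
by move=> v; exact: (@continuous_comp _ _ _ e (@line_of R) v (ce v) (@line_of_continuous R _)).
Qed.

Theorem CP1_euler : euler_characteristic R X 2.
Proof.
exists bool, dimc, Phi; split; last by rewrite big_bool /= expr0 sqrrN expr1n.
split.
- exact: CP1_hausdorff.
- case=> /=; first exact: continuous_subspaceT disc_continuous.
  by apply: continuous_subspaceT; exact: cst_continuous.
- move=> x; case: (pt_cover x) => [[z ->]|->].
    have [v dv e] := disc_surj z; exists (existT _ true v); split=> // -[[] w] /= [dw ew].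
      by congr existT; apply: disc_inj => //; rewrite ew.
    by case: (@pt0_neq z).
  exists (existT (fun b => 'rV[R]_(dimc b)) false (0 : 'rV[R]_0)); split.
    by split=> //; rewrite /open_disc /= big_ord0.
  move=> [[] w] /= [dw ew]; last by congr existT; apply/rowP => -[].
  by case: (@pt0_neq (zv w / cr (ht w))); rewrite -disc_pt.
- case=> /= v; rewrite /unit_sphere /=; last by rewrite big_ord0 => /eqP; rewrite eq_sym oner_eq0.
  move=> hv; exists false, (0 : 'rV[R]_0); split=> //; first by rewrite /open_disc /= big_ord0.
  have e0 : ht v = 0 by rewrite /ht hv subrr sqrtr0.
  have z0 : zv v != 0.
    by rewrite -cmod_gt0 lt_def cmod_ge0 andbT; apply/eqP => h; move: hv => /eqP; rewrite sum2 h expr0n eq_sym oner_eq0.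
  apply: (@line_ofE _ _ _ (zv v)) => //.
  apply/eqP; rewrite -subr_eq0; apply/eqP; apply: row2_eq0; rewrite /= !mxE /=.
    by rewrite e0 mulr0 subrr.
  by rewrite mulr1 subrr.
Qed.

End CellStructure.

(** * Holomorphic maps from the projective line in charts *)

Section Components.
Variable R : realType.

Lemma const_mx_line (h z : C R) : h *: (const_mx 1 : 'rV[C R]_1) + const_mx z = const_mx (h + z).
Proof. by apply/rowP => k; rewrite !mxE mulr1. Qed.

Lemma differentiable_cdiff n (G : 'rV[C R]_1 -> 'rV[C R]_n) (z : C R) b :
  differentiable G (const_mx z : 'rV[C R]_1) ->
  cdiff (fun w => G (const_mx w) 0 b) z (jacobian G (const_mx z : 'rV[C R]_1) 0 b).
Proof.
move=> dG; apply/cdiffP; set a : 'rV[C R]_1 := const_mx z; set v : 'rV[C R]_1 := const_mx 1.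
have dr : derivable G a v by exact: diff_derivable.
have H : h^-1 *: ((G \o shift a) (h *: v) - G a) @[h --> 0^'] --> v *m jacobian G a.
  by rewrite -deriveEjacobian//; exact: dr.
have Hb := @cvg_comp _ _ _ _ (fun M : 'rV[C R]_n => M 0 b) _ _ _ H (@coord_continuous _ _ _ 0 b _).
have vE : (v *m jacobian G a) 0 b = jacobian G a 0 b.
  by rewrite mxE big_ord1 mxE mul1r.
have E : (fun h => h^-1 *: (((fun w => G (const_mx w) 0 b) \o shift (z : (C R)^o)) (h *: 1) - G (const_mx z) 0 b))
   = (fun M : 'rV[C R]_n => M 0 b) \o (fun h => h^-1 *: ((G \o shift a) (h *: v) - G a)).
  by apply: funext => h /=; rewrite !mxE const_mx_line /GRing.scale /= mulr1.
have {}Hb : h^-1 *: (((fun w => G (const_mx w) 0 b) \o shift (z : (C R)^o)) (h *: 1) - G (const_mx z) 0 b)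
   @[h --> 0^'] --> jacobian G a 0 b by rewrite E -vE; exact: Hb.
by apply: DeriveDef; [apply/cvg_ex; exists (jacobian G a 0 b)|exact: cvg_lim Hb].
Qed.

Lemma holo_derivative n (O : set (C R)) (F dF : 'I_n -> C R -> C R) : open O ->
  (forall z b, O z -> cdiff (F b) z (dF b z)) ->
  exists ddF : 'I_n -> C R -> C R, forall z b, O z -> cdiff (dF b) z (ddF b z).
Proof.
move=> oO hF.
have key bz : exists l, O bz.2 -> cdiff (dF bz.1) bz.2 l.
  have [Oz|nO] := pselect (O bz.2); last by exists 0.
  have /nbhs_cmod[d d0 hd] : nbhs bz.2 O by move: oO; rewrite openE => /(_ _ Oz).
  have d20 : 0 < d / 2 by rewrite divr_gt0.
  have d2d : d / 2 < d by rewrite ltr_pdivrMr// ltr_pMr// ltr1n.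
  have hF' z : cmod (z - bz.2) < d -> cdiff (F bz.1) z (dF bz.1 z) by move=> /hd Oz'; exact: hF.
  have h0 : cmod (bz.2 - bz.2) < d / 2 by rewrite subrr cmod0.
  by have [l hl] := derivative_diff d20 d2d hF' h0; exists l.
have [dd hdd] := choice key.
by exists (fun b z => dd (b, z)) => z b Oz; exact: (hdd (b, z)).
Qed.

End Components.

Section PullbackDensity.
Local Open Scope sesquilinear_scope.
Variables (R : realType) (n : nat) (Y : chartedSpace R n) (eta : form11 Y) (f : CP1 R -> Y).
Hypothesis Y_manifold : complex_manifold Y.
Hypothesis eta_kahler : kahler_metric eta.
Hypothesis f_holo : holomorphic_map f.
Implicit Types (psi : chart R n Y) (i : 'I_2) (z : C R) (b : 'I_n).

(** The components of [f] in the affine coordinate [z] of the chart [i] and the chart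
    [psi] of the target. *)
Definition loc psi i b z : C R := psi (f (pt i z)) 0 b.
Definition dloc psi i b z : C R := chart_jacobian (CP1_chart R i) psi f (const_mx z) 0 b.
Definition locdom psi i : set (C R) := [set z | chart_dom psi (f (pt i z))].

Lemma f_pt_continuous i : continuous (fun z => f (pt i z)).
Proof.
move=> z; exact: (@continuous_comp _ _ _ (@pt R i) f z (@pt_continuous R i z) (f_holo.1 _)).
Qed.

Lemma locdom_open psi i : atlas psi -> open (locdom psi i).
Proof.
move=> hp; apply: (@open_comp _ _ (fun z => f (pt i z)) (chart_dom psi)).
  by move=> z _; exact: f_pt_continuous.
exact: chart_dom_open Y_manifold _ hp.
Qed.

Lemma loc_row psi i z : \row_b loc psi i b z = psi (f (pt i z)).
Proof. by apply/rowP => b; rewrite mxE. Qed.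

Lemma loc_differentiable psi i z : atlas psi -> locdom psi i z ->
  differentiable (psi \o f \o chart_inv (CP1_chart R i) : 'rV[C R]_1 -> 'rV[C R]_n) (const_mx z : 'rV[C R]_1).
Proof.
move=> hp hz; apply: (f_holo.2 (CP1_chart R i) psi) => //; first by exists i.
exists (pt i z); last exact: chart_pt.
by split=> //; exact: dom_pt.
Qed.

Lemma loc_cdiff psi i z b : atlas psi -> locdom psi i z -> cdiff (loc psi i b) z (dloc psi i b z).
Proof. by move=> hp hz; have := differentiable_cdiff b (loc_differentiable hp hz). Qed.

Lemma form_sqnorm (g : 'M[C R]_n) (W : 'rV[C R]_n) : (W *m g *m W ^t*) 0 0 = sqnorm g W.
Proof.
rewrite mxE /sqnorm exchange_big /=; apply: eq_bigr => b _.
by rewrite !mxE mulr_suml; apply: eq_bigr => a _; rewrite [W 0 a * _]mulrC.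
Qed.

Lemma jacobian_comp m k (F : 'rV[C R]_m -> 'rV[C R]_n) (G : 'rV[C R]_n -> 'rV[C R]_k) x :
  differentiable F x -> differentiable G (F x) -> jacobian (G \o F) x = jacobian F x *m jacobian G (F x).
Proof.
move=> dF dG; apply/row_matrixP => r; rewrite !rowE mulmxA !mul_rV_lin1 /=.
by rewrite diff_comp.
Qed.

(** The form [pullback f eta] is computed in the chart chosen at each point. By the
    compatibility of [eta] with changes of charts and the chain rule, a fixed chart
    gives the same density on its domain, which is needed to differentiate it. *)
Lemma pullback_loc psi i z : atlas psi -> locdom psi i z ->
  pullback f eta (CP1_chart R i) (const_mx z) 0 0 =
  sqnorm (eta psi (\row_b loc psi i b z)) (\row_b dloc psi i b z).
Proof.
move=> hp hz; set x := f (pt i z); set phi := chart_at x.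
have hq : atlas phi by exact: chart_at_atlas.
have xq : chart_dom phi x by exact: chart_at_dom.
have zq : locdom phi i z by [].
have xp : chart_dom psi x by [].
have Jpsi : \row_b dloc psi i b z = chart_jacobian (CP1_chart R i) psi f (const_mx z).
  by apply/rowP => b; rewrite mxE.
rewrite Jpsi loc_row -/x.
have -> : pullback f eta (CP1_chart R i) (const_mx z) = pullback_in f eta (CP1_chart R i) phi (const_mx z) by [].
set Jp := chart_jacobian _ psi _ _; rewrite /pullback_in /=; set Jq := chart_jacobian _ phi _ _.
have -> : f (chart_inv (CP1_chart R i) (const_mx z)) = x by [].
rewrite (kahler_glue eta_kahler hq hp xq xp) /pullback_in.
set K := chart_jacobian phi psi id (phi x); have -> : id (chart_inv phi (phi x)) = x by rewrite /= (chart_invK Y_manifold hq).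
suff -> : Jp = Jq *m K by rewrite -form_sqnorm trmx_mul map_mxM !mulmxA.
pose Fq : 'rV[C R]_1 -> 'rV[C R]_n := phi \o f \o chart_inv (CP1_chart R i).
pose T : 'rV[C R]_n -> 'rV[C R]_n := psi \o id \o chart_inv phi.
have dT : differentiable T (phi x).
  by apply: (chart_compatible Y_manifold hq hp); exists x.
have dF : differentiable Fq (const_mx z : 'rV[C R]_1) by exact: loc_differentiable.
have Fx : Fq (const_mx z) = phi x by [].
have dTF : differentiable (T \o Fq) (const_mx z : 'rV[C R]_1) by apply: differentiable_comp => //; rewrite Fx.
have JE : jacobian (T \o Fq) (const_mx z : 'rV[C R]_1) = Jq *m K by rewrite jacobian_comp// Fx.
apply/rowP => b; rewrite -JE.
have h1 := differentiable_cdiff b dTF.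
have h2 : cdiff (loc psi i b) z (Jp 0 b) by exact: loc_cdiff.
apply: cdiff_uniq h2 _; apply: cdiff_near h1.
have /nbhs_cmod[d d0 hd] : nbhs z (locdom phi i).
  by have := @locdom_open phi i hq; rewrite openE => /(_ _ zq).
exists d => // w /hd hw.
have -> : (T \o Fq) (const_mx w) = psi (chart_inv phi (phi (f (pt i w)))) by [].
by rewrite (chart_invK Y_manifold hq).
Qed.

Lemma mul_conjE z : z * z^* = cr (cmod z ^+ 2).
Proof. by rewrite -normCK normE !expr2 crM. Qed.

Lemma hform_scale (g : 'M[C R]_n) (k : C R) (x : 'rV[C R]_n) :
  re (hform g (k *: x) (k *: x)) = cmod k ^+ 2 * re (hform g x x).
Proof.
have -> : hform g (k *: x) (k *: x) = cr (cmod k ^+ 2) * hform g x x.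
  rewrite /hform mulr_sumr; apply: eq_bigr => a _; rewrite mulr_sumr; apply: eq_bigr => b _.
  by rewrite !mxE -mul_conjE rmorphM /=; ring.
by move: (hform g x x) => A; rewrite !cE /=; ring.
Qed.

Definition pdens i z : R := re (pullback f eta (CP1_chart R i) (const_mx z) 0 0).

Lemma locdom_at i z : locdom (chart_at (f (pt i z))) i z.
Proof. exact: chart_at_dom. Qed.

Lemma loc_img psi i z : locdom psi i z -> chart_img psi (\row_b loc psi i b z).
Proof. by move=> hz; rewrite loc_row; exists (f (pt i z)). Qed.

Lemma pdens_loc psi i z : atlas psi -> locdom psi i z ->
  pdens i z = re (hform (eta psi (\row_b loc psi i b z)) (\row_b dloc psi i b z) (\row_b dloc psi i b z)).
Proof. by move=> hp hz; rewrite /pdens (pullback_loc hp hz). Qed.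

Lemma pdens_ge0 i z : 0 <= pdens i z.
Proof.
have hp := chart_at_atlas Y_manifold (f (pt i z)).
rewrite (pdens_loc hp (locdom_at i z)); apply: hform_re_ge0.
exact: (kahler_posdef eta_kahler hp (loc_img (locdom_at i z))).
Qed.

(** The derivative of [z |-> 1/z] is [- z^-2]. *)
Lemma pdens_swap z : z != 0 -> pdens 0 z = pdens 1 z^-1 / cmod z ^+ 4.
Proof.
move=> z0; set psi := chart_at (f (pt 0 z)).
have hp : atlas psi by exact: chart_at_atlas.
have h0 : locdom psi 0 z by exact: locdom_at.
have h1 : locdom psi 1 z^-1 by rewrite /locdom /= -pt_swap.
have E0 := pdens_loc hp h0; have E1 := pdens_loc hp h1.
rewrite loc_row in E0; rewrite loc_row -pt_swap// in E1.
pose D0 : 'rV[C R]_n := \row_b dloc psi 0 b z; pose D1 : 'rV[C R]_n := \row_b dloc psi 1 b z^-1.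
rewrite -/D0 in E0; rewrite -/D1 in E1.
have dE : D0 = (- z^-1 ^+ 2) *: D1.
  apply/rowP => b; rewrite /D0 /D1 !mxE.
  have hc : cder (fun t => z + cr t) 0 1.
    by have := cderD (cder_cst z 0) (cder_cr 0); rewrite add0r.
  have c0 : z + cr 0 = z by rewrite cr0 addr0.
  have hi : cder (fun t => (z + cr t)^-1) 0 (- z^-1 ^+ 2).
    have k := cdiff_invsub z0; rewrite -[X in cdiff _ X _]c0 in k.
    have := cdiff_cder (c := fun t => z + cr t) k hc; rewrite mulr1 !subr0.
    by have -> : (fun w : C R => (w - 0)^-1) \o (fun t => z + cr t) = (fun t => (z + cr t)^-1)
      by apply: funext => t /=; rewrite subr0.
  have e0 : cder (fun t => loc psi 0 b (z + cr t)) 0 (dloc psi 0 b z * 1).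
    apply: (cdiff_cder (F := loc psi 0 b) (c := fun t => z + cr t)) hc.
    by rewrite c0; exact: loc_cdiff.
  have e1 : cder (fun t => loc psi 1 b (z + cr t)^-1) 0 (dloc psi 1 b z^-1 * (- z^-1 ^+ 2)).
    apply: (cdiff_cder (F := loc psi 1 b) (c := fun t => (z + cr t)^-1)) hi.
    by rewrite c0; exact: loc_cdiff.
  rewrite mulr1 in e0; rewrite [RHS]mulrC.
  apply: cder_uniq e0 _; apply: cder_near e1.
  have zp : 0 < cmod z by rewrite cmod_gt0.
  apply/nbhs_normP; exists (cmod z) => // t /=; rewrite sub0r normrN => ht.
  rewrite /loc pt_swap//; apply/eqP => h; move: ht.
  have -> : z = - cr t by apply/eqP; rewrite -addr_eq0 h.
  by rewrite cmodN cmod_cr ltxx.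
by rewrite E0 E1 dE hform_scale cmodN cmodX cmodV -exprM exprVn mulrC.
Qed.

End PullbackDensity.

Section DensityJet.
Local Open Scope sesquilinear_scope.
Variables (R : realType) (n : nat) (Y : chartedSpace R n) (eta : form11 Y) (f : CP1 R -> Y).
Hypothesis Y_manifold : complex_manifold Y.
Hypothesis eta_kahler : kahler_metric eta.
Hypothesis f_holo : holomorphic_map f.

(** For [xi = 0] both sides vanish. *)
Lemma curv_num_le (g : 'rV[C R]_n -> 'M[C R]_n) w (xi : 'rV[C R]_n) (S : R) :
  (forall W, W != 0 -> 0 < sqnorm (g w) W) -> (xi != 0 -> hol_sect_curv g w xi <= S) ->
  re (\sum_a \sum_b \sum_c \sum_d
    curvature g w a b c d * xi 0 a * (xi 0 b)^* * xi 0 c * (xi 0 d)^* : C R)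
  <= S * re (hform (g w) xi xi) ^+ 2.
Proof.
move=> pos hS; have [x0|x0] := eqVneq xi 0.
  have -> : hform (g w) xi xi = 0.
    by rewrite x0 /hform big1// => a _; rewrite big1// => b _; rewrite !mxE mulr0 mul0r.
  rewrite big1; first by rewrite /= expr0n mulr0.
  move=> a _; rewrite big1// => b _; rewrite big1// => c _; rewrite big1// => d _.
  have -> : xi 0 a = 0 by rewrite x0 mxE.
  by rewrite mulr0 !mul0r.
have sE : sqnorm (g w) xi = cr (re (hform (g w) xi xi)) by exact: hform_real.
have u0 : 0 < re (hform (g w) xi xi).
  by have := pos _ x0; rewrite sE ltcE => /andP[].
move: (hS x0); rewrite /hol_sect_curv sE; move: u0; move: (re (hform _ _ _)) => u u0.
move: (\sum_a _) => N; have -> : re (N / cr u ^+ 2) = re N / u ^+ 2.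
  have cu : cr u ^+ 2 != 0 by rewrite expf_neq0// -cmod_gt0 cmod_cr gtr0_norm.
  have -> : N / cr u ^+ 2 = cr (u ^+ 2)^-1 * N.
    apply: (mulIf cu); rewrite divfK// [RHS]mulrAC -[LHS]mul1r; congr (_ * _).
    by rewrite [cr u ^+ 2]expr2 -!crM -expr2 mulVf// expf_neq0// gt_eqF.
  by rewrite !cE /=; ring.
by rewrite ler_pdivrMr// exprn_gt0.
Qed.

Lemma curv_at_le (S : R) i z (psi := chart_at (f (pt i z))) : (sup_hsc eta <= S%:E)%E ->
  curv_at (eta psi) (loc f psi i) (dloc f psi i) z <= S * pdens eta f i z ^+ 2.
Proof.
move=> hS; have hp : atlas psi by exact: chart_at_atlas.
have hz : locdom f psi i z by exact: locdom_at.
rewrite (pdens_loc Y_manifold eta_kahler f_holo hp hz) /curv_at.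
have wE : \row_b loc f psi i b z = psi (f (pt i z)) by exact: loc_row.
apply: curv_num_le => [|x0]; first by apply: (kahler_posdef eta_kahler hp); exact: loc_img.
rewrite -lee_fin; apply: le_trans hS; apply: (@le_trans _ _ (hsc_at eta (f (pt i z)))).
  apply: ereal_sup_ubound; exists (\row_b dloc f psi i b z) => //=.
  by rewrite wE.
by apply: ereal_sup_ubound; exists (f (pt i z)).
Qed.

(** The jet is taken in the chart chosen at [p] itself, the one in which the
    holomorphic sectional curvature is computed at that point. *)
Lemma local_jet i p (psi := chart_at (f (pt i (zc p)))) : exists j : jet R,
  (forall q, locdom f psi i (zc q) -> C2_at j q /\ j0 j q = pdens eta f i (zc q)) /\
  (forall S : R, (sup_hsc eta <= S%:E)%E ->
    - 4 * S * j0 j p ^+ 3 <= j0 j p * lap j p - grad2 j p /\ - 4 * S * j0 j p ^+ 2 <= lap j p).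
Proof.
have hp : atlas psi by exact: chart_at_atlas.
have oO : open (locdom f psi i) := @locdom_open _ _ _ _ Y_manifold f_holo psi i hp.
have dF z b : locdom f psi i z -> cdiff (loc f psi i b) z (dloc f psi i b z).
  by move=> hz; exact: loc_cdiff.
have [F2 dF1] := holo_derivative oO dF.
have [F3 dF2] := holo_derivative oO dF1.
have [F4 dF3] := holo_derivative oO dF2.
have cF3 z b : locdom f psi i z -> continuous_at z (F3 b).
  by move=> hz; exact: cdiff_continuous (dF3 z b hz).
have oV : open (chart_img psi) by exact: chart_img_open Y_manifold _ hp.
have sm := kahler_smooth eta_kahler hp.
have he := kahler_hermitian eta_kahler hp.
have po := kahler_posdef eta_kahler hp.
have im z : locdom f psi i z -> chart_img psi (\row_b loc f psi i b z) by exact: loc_img.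
exists (density_jet (eta psi) (loc f psi i) (dloc f psi i) F2 F3).
have jE q : locdom f psi i (zc q) -> j0 (density_jet (eta psi) (loc f psi i) (dloc f psi i) F2 F3) q = pdens eta f i (zc q).
  by move=> hq; rewrite density_jet0 (pdens_loc Y_manifold eta_kahler f_holo hp hq).
split=> [q hq|S hS].
  by split; [exact: (density_C2 oV sm po oO im dF dF1 dF2 cF3 hq)|exact: jE].
have hz : locdom f psi i (zc p) by exact: locdom_at.
have [h1 h2] := density_ineq oV sm he po F3 oO im dF dF1 hz.
have hc := @curv_at_le S i (zc p) hS; have u0 := pdens_ge0 Y_manifold eta_kahler f_holo i (zc p).
rewrite -(jE _ hz) in hc u0; split.
  by apply: le_trans h1; have := ler_wpM2l u0 hc; rewrite !exprS expr0; lra.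
by apply: le_trans h2; move: hc; rewrite !exprS expr0; lra.
Qed.

Lemma near_locdom i p : \forall q \near p, locdom f (chart_at (f (pt i (zc p)))) i (zc q).
Proof.
have hp := chart_at_atlas Y_manifold (f (pt i (zc p))).
have oO := @locdom_open _ _ _ _ Y_manifold f_holo _ i hp.
apply: (@zc_cont R p); rewrite openE in oO; apply: oO; exact: locdom_at.
Qed.

Theorem density_C2_jet i : exists U : jet R, [/\ isC2 U, (forall p, j0 U p = pdens eta f i (zc p)) &
  forall S : R, (sup_hsc eta <= S%:E)%E -> forall p,
    - 4 * S * j0 U p ^+ 3 <= j0 U p * lap U p - grad2 U p /\ - 4 * S * j0 U p ^+ 2 <= lap U p].
Proof.
have [L hL] := choice (local_jet i).
have nL p : \forall q \near p, C2_at (L p) q /\ j0 (L p) q = pdens eta f i (zc q).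
  by apply: filterS (near_locdom i p) => q; exact: (hL p).1.
exists (glued_jet (fun p => pdens eta f i (zc p)) L); split=> //; first exact: glued_C2.
move=> S hS p; have := (hL p).2 S hS.
by have [e0 ex ey exx eyy] := glued_jetE nL p; rewrite /lap /grad2 e0 ex ey exx eyy.
Qed.

Lemma pdens_continuous i : continuous (fun p => pdens eta f i (zc p)).
Proof.
have [U [[cU _ _ _ _ _ _ _ _] hU _]] := density_C2_jet i.
by have -> : (fun p => pdens eta f i (zc p)) = j0 U by apply: funext => p; rewrite hU.
Qed.

End DensityJet.

Section Constancy.
Variable R : realType.

Lemma derive0_segment (f : R -> R) : (forall t : R, 0 <= t <= 1 -> is_derive t 1 f 0) -> f 1 = f 0.
Proof.
move=> hd; have [||c _] := @MVT_segment R f (fun=> 0) 0 1 ler01.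
- by move=> t; rewrite in_itv /= => /andP[/ltW t0 /ltW t1]; apply: hd; rewrite t0.
- apply: derivable_within_continuous => t; rewrite in_itv /= => ht.
  by have [] := hd t ht.
- by rewrite mul0r => /eqP; rewrite subr_eq0 => /eqP.
Qed.

Lemma cder0_segment (c : R -> C R) : (forall t : R, 0 <= t <= 1 -> cder c t 0) -> c 1 = c 0.
Proof.
move=> hd; apply: ceq.
  by apply: (derive0_segment (f := fun s => re (c s))) => t /hd[].
by apply: (derive0_segment (f := fun s => im (c s))) => t /hd[].
Qed.

Lemma cdiff0_disc (F : C R -> C R) z0 d : (forall z, cmod (z - z0) < d -> cdiff F z 0) ->
  forall w, cmod (w - z0) < d -> F w = F z0.
Proof.
move=> hF w hw.
have cE t : cder (fun t => z0 + cr t * (w - z0)) t (0 + (1 * (w - z0) + cr t * 0)).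
  by apply: cderD; [exact: cder_cst|apply: cderM; [exact: cder_cr|exact: cder_cst]].
have h t : 0 <= t <= 1 -> cder (fun t => F (z0 + cr t * (w - z0))) t 0.
  move=> /andP[t0 t1]; have hz : cmod (z0 + cr t * (w - z0) - z0) < d.
    rewrite [z0 + _]addrC addrK cmodM cmod_cr ger0_norm//; apply: le_lt_trans hw.
    exact: ler_piMl (cmod_ge0 _) t1.
  have := @cdiff_cder R F (fun t => z0 + cr t * (w - z0)) t _ _ (hF _ hz) (cE t).
  by rewrite mul0r.
have := cder0_segment h; rewrite cr1 mul1r cr0 mul0r addr0 => <-.
by congr F; rewrite addrC subrK.
Qed.

(** Along a ray, the indicator of the value at the origin has derivative zero. *)
Lemma locally_constant (T : Type) (g : C R -> T) :
  (forall z0, exists2 d : R, 0 < d & forall w, cmod (w - z0) < d -> g w = g z0) ->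
  forall z, g z = g 0.
Proof.
move=> hg z; pose h (t : R) : R := if `[< g (cr t * z) = g 0 >] then 1 else 0.
have dh (t : R) : is_derive t (1 : R) h 0.
  apply: (@is_derive_near _ (fun=> h t)).
  have [d d0 hd] := hg (cr t * z).
  apply/nbhs_normP; exists (d / (cmod z + 1)); first by rewrite /= divr_gt0// cmod1_gt0.
  move=> s /=; rewrite ltr_pdivlMr ?cmod1_gt0// => hs; rewrite /h.
  rewrite (hd (cr s * z))// -mulrBl -crN -crD cmodM cmod_cr distrC; apply: le_lt_trans hs.
  by apply: ler_wpM2l => //; rewrite lerDl.
have := @is_derive_0_is_cst R h 1 0 dh.
rewrite /h cr1 mul1r cr0 mul0r [`[< g 0 = g 0 >]]asboolT//.
by case: asboolP => // _ /eqP; rewrite eq_sym oner_eq0.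
Qed.

End Constancy.

Section Nonconstant.
Variables (R : realType) (n : nat) (Y : chartedSpace R n) (eta : form11 Y) (f : CP1 R -> Y).
Hypothesis Y_manifold : complex_manifold Y.
Hypothesis eta_kahler : kahler_metric eta.
Hypothesis f_holo : holomorphic_map f.

Lemma dloc_eq0 psi i z b : atlas psi -> locdom f psi i z -> pdens eta f i z = 0 -> dloc f psi i b z = 0.
Proof.
move=> hp hz u0; have po := kahler_posdef eta_kahler hp (loc_img hz).
have e := pdens_loc Y_manifold eta_kahler f_holo hp hz; rewrite u0 in e.
suff /rowP/(_ b) : \row_b dloc f psi i b z = 0 by rewrite !mxE.
move: e po; move: (\row_b dloc f psi i b z) (eta psi _) => xi g e po.
apply/eqP; apply: contraT => x0; have := po _ x0.
by rewrite (_ : sqnorm g xi = hform g xi xi)// (hform_real po) -e ltxx.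
Qed.

(** If the density vanishes then so does the derivative of [f] in charts, so that [f] is
    locally constant on the affine line; its value at infinity follows by
    continuity, because [Y] is Hausdorff. *)
Lemma pdens_nonzero : ~ (exists y, forall p, f p = y) -> exists p, 0 < pdens eta f 0 (zc p).
Proof.
move=> nc; apply: contrapT => np; apply: nc.
have u0 z : pdens eta f 0 z = 0.
  apply/eqP; rewrite eq_le pdens_ge0// andbT leNgt; apply/negP => u0; apply: np.
  by exists (re z, im z); have -> : zc (re z, im z) = z by apply: ceq.
have cst0 z : f (pt 0 z) = f (pt 0 0).
  apply: (locally_constant (g := fun z => f (pt 0 z))) => z0.
  set psi := chart_at (f (pt 0 z0)).
  have hp : atlas psi by exact: chart_at_atlas.
  have /nbhs_cmod[d d0 hd] : nbhs z0 (locdom f psi 0).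
    have := @locdom_open _ _ _ _ Y_manifold f_holo psi 0 hp; rewrite openE; apply; exact: locdom_at.
  exists d => // w hw; have hz0 : locdom f psi 0 z0 by exact: locdom_at.
  rewrite -(chart_invK Y_manifold hp (hd _ hw)) -(chart_invK Y_manifold hp hz0); congr chart_inv.
  apply/rowP => b; apply: (cdiff0_disc (F := loc f psi 0 b) (d := d)) hw => v /hd hz.
  by rewrite -(dloc_eq0 b hp hz (u0 v)); exact: loc_cdiff.
exists (f (pt 0 0)) => p; case: (pt_cover p) => [[z ->]|->]; first exact: cst0.
apply: (manifold_hausdorff Y_manifold) => A B hA hB.
have /nbhs_cmod[d d0 hd] : nbhs (0 : C R) [set w | A (f (pt 1 w))] := f_pt_continuous f_holo hA.
have d2 : 0 < d / 2 by rewrite divr_gt0.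
have hw : cmod (cr (d / 2) - 0) < d by rewrite subr0 cmod_cr gtr0_norm// ltr_pdivrMr// ltr_pMr// ltr1n.
have w0 : cr (d / 2) != 0 by rewrite -cmod_gt0 cmod_cr gtr0_norm.
exists (f (pt 0 0)); split; last exact: nbhs_singleton hB.
by have := hd _ hw; rewrite /= -[cr _]invrK -pt_swap ?invr_eq0// cst0.
Qed.

(** For [|z| <= 1] by compactness; for [|z| >= 1] the density is [|z|^-4] times the one in
    the other affine coordinate, which is bounded for [|1/z| <= 1]. *)
Lemma pdens_bound : exists M : R, forall p, pdens eta f 0 (zc p) * q p ^+ 2 <= M.
Proof.
have box i : exists M : R, 0 <= M /\ forall z, cmod z <= 1 -> pdens eta f i z <= M.
  pose K := (`[(-1 : R), 1]%classic `*` `[(-1 : R), 1]%classic).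
  have cK : compact K by apply: compact_setX; exact: segment_compact.
  have cf : {within K, continuous (fun p => pdens eta f i (zc p))}.
    by apply: continuous_subspaceT; exact: pdens_continuous.
  have [M [_ hM]] := compact_bounded (continuous_compact cf cK).
  exists (`|M| + 1); split; first by rewrite addr_ge0.
  move=> z hz; have M1 : M < `|M| + 1 by have := ler_norm M; lra.
  apply: le_trans (hM _ M1 (pdens eta f i z) _); first exact: ler_norm.
  exists (re z, im z); last by have -> : zc (re z, im z) = z by apply: ceq.
  have h1 := le_trans (le_re z) hz; have h2 := le_trans (le_im z) hz.
  by split; rewrite /= in_itv /= -ler_norml.
have [M0 [M00 h0]] := box 0; have [M1 [M10 h1]] := box 1.
exists (4 * (M0 + M1)) => p; set z := zc p.
have qE : q p = 1 + cmod z ^+ 2 by rewrite /q cmod_sqr.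
have u0 i w := pdens_ge0 Y_manifold eta_kahler f_holo i w.
have key (u M s : R) : 0 <= u -> u <= M -> 0 <= s -> s <= 1 -> u * (1 + s) ^+ 2 <= 4 * M.
  move=> ? ? ? ?; have h4 : (1 + s) ^+ 2 <= 4 by nra.
  have h0' : 0 <= (1 + s) ^+ 2 by exact: sqr_ge0.
  by nra.
rewrite qE; have [z1|z1] := leP (cmod z) 1.
  have : pdens eta f 0 z * (1 + cmod z ^+ 2) ^+ 2 <= 4 * M0.
    apply: key (u0 0 z) (h0 z z1) _ _; first by rewrite sqr_ge0.
    by rewrite exprn_ile1// cmod_ge0.
  lra.
have c0 : 0 < cmod z by lra.
have z0 : z != 0 by rewrite -cmod_gt0.
rewrite (pdens_swap Y_manifold eta_kahler f_holo z0).
have i1 : cmod z^-1 <= 1 by rewrite cmodV invf_le1// ltW.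
have -> : pdens eta f 1 z^-1 / cmod z ^+ 4 * (1 + cmod z ^+ 2) ^+ 2 =
  pdens eta f 1 z^-1 * (1 + cmod z^-1 ^+ 2) ^+ 2.
  by rewrite cmodV; move: (pdens _ _ _ _) => u; field; rewrite gt_eqF.
have : pdens eta f 1 z^-1 * (1 + cmod z^-1 ^+ 2) ^+ 2 <= 4 * M1.
  apply: key (u0 1 _) (h1 _ i1) _ _; first by rewrite sqr_ge0.
  by rewrite exprn_ile1// cmod_ge0.
lra.
Qed.

End Nonconstant.

(** * The inequality *)

Section Assembly.
Variables (R : realType).
Local Notation mu := (@lebesgue_measure R).
Local Notation mu2 := (mu \x mu)%E.

Lemma continuous_integral_gt0 (u : R * R -> R) p0 : continuous u -> (forall p, 0 <= u p) -> 0 < u p0 ->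
  (0 < \int[mu2]_p (u p)%:E)%E.
Proof.
move=> cu u0 up; set c := u p0 / 2; have c0 : 0 < c by rewrite divr_gt0.
have : nbhs p0 [set p | c < u p].
  by apply: (cu p0 [set x | c < x]); apply: lt_nbhsr; rewrite /c ltr_pdivrMr// ltr_pMr// ltr1n.
case=> -[P Q] /= [/nbhs_ballP[r1 /= r10 h1] /nbhs_ballP[r2 /= r20 h2]] hPQ.
pose I (x r : R) : set R := `]x - r, x + r[%classic.
pose B := I p0.1 r1 `*` I p0.2 r2.
have mI x r : measurable (I x r : set (measurableTypeR R)) by exact: measurable_itv.
have mB : measurable (B : set (measurableTypeR R * measurableTypeR R)) by exact: measurableX.
have mu_I x r : 0 < r -> (0 < mu (I x r))%E.
  move=> r0; rewrite /I lebesgue_measure_itv /= lte_fin.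
  by rewrite ifT -?EFinD ?lte_fin; lra.
have inB p : B p -> c < u p.
  move=> [h3 h4]; apply: hPQ; split; [apply: h1|apply: h2]; rewrite /ball /= ltr_distlC.
    by move: h3; rewrite /I /= in_itv.
  by move: h4; rewrite /I /= in_itv.
have mu' : measurable_fun [set: measurableTypeR R * measurableTypeR R] (EFin \o u).
  by apply/measurable_EFinP; exact: continuous_measurable2.
apply: (@lt_le_trans _ _ (\int[mu2]_(p in B) (u p)%:E)%E); last first.
  apply: ge0_subset_integral => //.
  by move=> p _; rewrite lee_fin.
apply: (@lt_le_trans _ _ (\int[mu2]_(p in B) (cst c%:E p))%E).
  rewrite integral_cst//= product_measure1E//.
  by rewrite !mule_gt0// ?mu_I.
apply: ge0_le_integral => //.
- by move=> p _; rewrite lee_fin ltW.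
- exact: measurable_funS mu'.
- by move=> p /inB; rewrite lee_fin; exact: ltW.
Qed.

End Assembly.

Theorem proposition1p5 (R : realType) (n : nat) (Y : chartedSpace R n)
    (eta : form11 Y) (f : CP1 R -> Y) :
  complex_manifold Y ->
  compact [set: Y] ->
  kahler_metric eta ->
  holomorphic_map f ->
  ~ (exists y, forall p, f p = y) ->
  exists chi : int,
    [/\ euler_characteristic R (CP1 R) chi,
        ((2 * pi * chi%:~R)%:E <= sup_hsc eta * CP1_integral (pullback f eta))%E &
        2 * pi * chi%:~R = 4 * pi :> R].
Proof.
move=> hY _ heta hf nc; exists 2.
have chiE : 2 * pi * (2 : int)%:~R = 4 * pi :> R by rewrite -[2%:~R]/(2%:R); ring.
split=> //; first exact: CP1_euler.
rewrite chiE.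
have [p0 up0] := pdens_nonzero hY heta hf nc.
have [M hM] := pdens_bound hY heta hf.
have [U [hU UE hcurv]] := density_C2_jet hY heta hf 0.
have U_ge0 p : 0 <= j0 U p by rewrite UE; exact: pdens_ge0.
have UM p : j0 U p * q p ^+ 2 <= M by rewrite UE.
have Up0 : 0 < j0 U p0 by rewrite UE.
have IE : CP1_integral (pullback f eta) =
    (\int[(@lebesgue_measure R) \x (@lebesgue_measure R)]_p (2 * j0 U p)%:E)%E.
  by apply: eq_integral => p _; rewrite UE.
rewrite IE.
have I_gt0 : (0 < \int[(@lebesgue_measure R) \x (@lebesgue_measure R)]_p (2 * j0 U p)%:E)%E.
  apply: (@continuous_integral_gt0 R (fun p => 2 * j0 U p) p0); last by rewrite mulr_gt0.
    by move=> p; apply: (@cvgM _ _ (nbhs p) _ (fun=> 2) (j0 U)); [exact: cvg_cst|exact: c0].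
  by move=> p; rewrite mulr_ge0.
case hS : (sup_hsc eta) => [S| |].
- have hS' : (sup_hsc eta <= S%:E)%E by rewrite hS.
  have ineq1 p := (hcurv S hS' p).1; have ineq2 p := (hcurv S hS' p).2.
  have area := area_inequality hU U_ge0 ineq1 ineq2 UM Up0.
  have IU := U_integrable hU U_ge0 UM.
  have -> : (\int[(@lebesgue_measure R) \x (@lebesgue_measure R)]_p (2 * j0 U p)%:E)%E =
     (2 * \int[((@lebesgue_measure R) \x (@lebesgue_measure R))%E]_p j0 U p)%R%:E.
    rewrite EFinM /Rintegral fineK; last exact: integrable_fin_num.
    by rewrite -integralZl//; apply: eq_integral => p _; rewrite EFinM.
  by rewrite -EFinM lee_fin; lra.
(* an infinite upper bound is harmless because the integral is positive *)
- by rewrite gt0_mulye// leey.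
(* the supremum is not -oo because the derivative of f provides a tangent vector *)
- have x0 : 0 < pdens eta f 0 (zc p0) := up0.
  have [W W0] : exists W : 'rV[C R]_n, W != 0.
    apply: contrapT => h; move: x0.
    have hp := chart_at_atlas hY (f (pt 0 (zc p0))).
    rewrite (pdens_loc hY heta hf hp (locdom_at f hY 0 (zc p0))).
    move: (\row_b _) => w; move: (\row_b _) => xi.
    have -> : xi = 0 by apply/eqP; apply: contrapT => /negP x0; apply: h; exists xi.
    rewrite /hform big1 ?ltxx// => a _; rewrite big1// => b _; by rewrite !mxE mulr0 mul0r.
  have y := f (pt 0 0).
  have : ((hol_sect_curv (eta (chart_at y)) (chart_at y y) W)%:E <= sup_hsc eta)%E.
    apply: (@le_trans _ _ (hsc_at eta y)); first by apply: ereal_sup_ubound; exists W.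
    by apply: ereal_sup_ubound; exists y.
  by rewrite hS leeNy_eq.
Qed.
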